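(* Let $m\ge1$ and $0\le q\le m$ be integers, let $\mu:=(2^{(q)},1^{(2m+1-2q)},0^{(q)})$, and let $I\subset J$ be nonempty subsets of $\{0,\dots,m\}$ satisfying $1\in I\implies0\in I$ and $1\in J\implies0\in J$. Then $$\mathrm{Adm}_{J,I,B_m}(\mu)=\mathrm{SPerm}_{J,I,B_m}(\mu),$$ i.e. an element of $W_{J,B_m}\backslash\widetilde W_{B_m}/W_{I,B_m}$ is $\mu$-admissible if and only if it is $\mu$-spin-permissible.
   Context: Notation. For $v\in\mathbb R^n$, $v(j)$ is the $j$th entry, $v^*(j)=v(n+1-j)$, $\mathbf d=(d,\dots,d)$, $v\ge w$ means entrywise, and $(d^{(i)},e^{(j)},\dots)$ denotes $d$ repeated $i$ times, then $e$ repeated $j$ times, etc. $i^*:=2m+2-i$ for $i\in\{1,\dots,2m+1\}$. Root datum of split $GO_{2m+1}$. $X_*:=\{x\in\mathbb Z^{2m+1}: x_i+x_{i^*}=2x_{m+1}\ \forall i\}$; $Q^\vee_{B_m}:=\{x\in X_*: x_i+x_{i^*}=0\ \forall i,\ x_1+\dots+x_m\text{ even}\}$; $S_{2m+1}^*:=\{\sigma\in S_{2m+1}:\sigma(i^* )=\sigma(i)^*\ \forall i\}$. $\widetilde W_{B_m}:=X_*\rtimes S_{2m+1}^*$ acts on $\mathbb R^{2m+1}$ by affine transformations, $X_*$ by translations ($t_\lambda$) and $S^*_{2m+1}$ by permuting coordinates; $W_{\mathrm{aff},B_m}:=Q^\vee_{B_m}\rtimes S_{2m+1}^*$. $\mathcal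 A:=X_*\otimes\mathbb R\subset\mathbb R^{2m+1}$, with affine root hyperplanes $\{x_i-x_j=d\}$, $j\ne i,i^*$, $d\in\mathbb Z$ ($i$ or $j$ may equal $m+1$), and base alcove $A_{B_m}:=\{x\in\mathcal A: x_1,\,x_{2m+1}-1<x_2<x_3<\dots<x_{m+1}\}$. Let $a_k:=((-\frac12)^{(k)},0^{(2m+1-2k)},(\frac12)^{(k)})$ for $0\le k\le m$, and $W_{I,B_m}:=\{w\in W_{\mathrm{aff},B_m}: wa_k=a_k\ \forall k\in I\}$. Bruhat order. $W_{\mathrm{aff},B_m}$ is a Coxeter group generated by the reflections across the walls of $A_{B_m}$; with $\Omega$ the stabilizer of $A_{B_m}$ in $\widetilde W_{B_m}$, $\widetilde W_{B_m}=W_{\mathrm{aff},B_m}\rtimes\Omega$, $\ell(x\tau)=\ell(x)$ and $x\tau\le x'\tau'$ iff $\tau=\tau'$ and $x\le x'$. Each double coset in $W_{J,B_m}\backslash\widetilde W_{B_m}/W_{I,B_m}$ contains a unique element of minimal length, and the Bruhat order on double cosets is defined by comparing these. $\mathrm{Adm}_{J,I,B_m}(\mu)$ is the set of $w$ with $w\le W_{J,B_m}t_\lambda W_{I,B_m}$ for some $\lambda\in S^*_{2m+1}\mu$ ($\mu$-admissible elements). Spin-permissibility. For $k=(2m+1)b+c$ with $0\le c<2m+1$ let $\omega_k:=((-1)^{(c)},0^{(2m+1-c)})-\mathbf b$. For $\tilde w\in\widetilde W_{B_m}/W_{I,B_m}$ and $k\in I$ the vectors $\mu_{\pm k}^{\tilde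 w}:=\tilde w\omega_{\pm k}-\omega_{\pm k}$ are well defined; $\mu_k^{\tilde w}$ is self-dual if $\mu_k^{\tilde w}=\mu_{-k}^{\tilde w}$. $A_k:=\{1,\dots,k\}\cup\{2m+2-k,\dots,2m+1\}$. A double coset $w$ is $\mu$-spin-permissible if $w\equiv t_\mu\bmod W_{\mathrm{aff},B_m}$ and for one, hence any, representative $\tilde w\in\widetilde W_{B_m}/W_{I,B_m}$ of $w$ and all $k\in I$: (sp1) $\mu_k^{\tilde w}+(\mu_{-k}^{\tilde w})^*=\mathbf2$ and $\mathbf0\le\mu_k^{\tilde w}\le\mathbf2$; (sp2) $\#\{j:\mu_k^{\tilde w}(j)=2\}\le q$; (sp3) if $\mu_k^{\tilde w}$ is self-dual and $\mu_k^{\tilde w}\not\equiv\mu\bmod Q^\vee_{B_m}$, then there exists $j\in A_k$ with $\mu_k^{\tilde w}(j)=1$. $\mathrm{SPerm}_{J,I,B_m}(\mu)$ is the set of $\mu$-spin-permissible double cosets. *)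

(* Defs.v *)
From HB Require Import structures.
From mathcomp Require Import all_boot all_order all_algebra all_fingroup.
From mathcomp Require Import boolp classical_sets reals topology normedtype.

Set Implicit Arguments.
Unset Strict Implicit.
Unset Printing Implicit Defensive.

Import Order.TTheory GRing.Theory Num.Theory.
Import numFieldNormedType.Exports.

Local Open Scope classical_set_scope.
Local Open Scope ring_scope.

(* Coordinates are numbered 0, ..., 2m instead of 1, ..., 2m+1, so that i^* is
   rev_ord i and the middle coordinate is m. *)
Notation dimB m := (m.*2.+1).

(* The group Z^N ><| S_N of affine transformations of R^N; the element with
   components (l, s) is x |-> l + s x, where (s x)(s i) = x i. *)
Record affperm (N : nat) := AffPerm { trans : 'rV[int]_N ; lin : 'S_N }.

Definition affperm_pair N (w : affperm N) := (trans w, lin w).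
Definition pair_affperm N (p : 'rV[int]_N * 'S_N) := AffPerm p.1 p.2.
Lemma affperm_pairK N : cancel (@affperm_pair N) (@pair_affperm N).
Proof. by case. Qed.
HB.instance Definition _ N :=
  Choice.copy (affperm N) (can_type (@affperm_pairK N)).

Definition affact (K : nzRingType) N (w : affperm N) (x : 'rV[K]_N) : 'rV[K]_N :=
  \row_j ((trans w 0 j)%:~R + x 0 ((lin w)^-1%g j)).

(* (s * t)%g is "s first, then t" in MathComp, whence the order below. *)
Definition affperm_mul N (u v : affperm N) :=
  AffPerm (affact u (trans v)) (lin v * lin u)%g.
Definition affperm_one N : affperm N := AffPerm 0 1%g.
Definition affperm_inv N (u : affperm N) :=
  AffPerm (\row_j (- trans u 0 (lin u j))) (lin u)^-1%g.

Lemma act_mul (K : nzRingType) N (u v : affperm N) (x : 'rV[K]_N) :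
  affact (affperm_mul u v) x = affact u (affact v x).
Proof.
apply/rowP => j; rewrite !mxE /= invMg permM intrD addrA; congr (_ + _ + _).
by rewrite intz.
Qed.

Lemma affperm_mulA N : associative (@affperm_mul N).
Proof.
by move=> u v w; rewrite {1 3}/affperm_mul /= -act_mul mulgA.
Qed.

Lemma affperm_mul1 N : left_id (affperm_one N) (@affperm_mul N).
Proof.
case=> l s; congr AffPerm; last by rewrite /= mulg1.
by apply/rowP => j; rewrite !mxE /= mulr0z add0r invg1 perm1.
Qed.

Lemma affperm_mulr1 N : right_id (affperm_one N) (@affperm_mul N).
Proof.
case=> l s; congr AffPerm; last by rewrite /= mul1g.
by apply/rowP => j; rewrite !mxE /= addr0 intz.
Qed.

Lemma affperm_mulV N : left_inverse (affperm_one N) (@affperm_inv N) (@affperm_mul N).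
Proof.
case=> l s; congr AffPerm; last by rewrite /= mulgV.
by apply/rowP => j; rewrite !mxE /= intz invgK addNr.
Qed.

Lemma affperm_mulrV N : right_inverse (affperm_one N) (@affperm_inv N) (@affperm_mul N).
Proof.
case=> l s; congr AffPerm; last by rewrite /= mulVg.
by apply/rowP => j; rewrite !mxE /= intz permKV subrr.
Qed.

HB.instance Definition _ N := isGroup.Build (affperm N) (@affperm_mulA N)
  (@affperm_mul1 N) (@affperm_mulr1 N) (@affperm_mulV N) (@affperm_mulrV N).

Definition transl N (l : 'rV[int]_N) : affperm N := AffPerm l 1%g.

Definition mid m : 'I_(dimB m) := inord m.

(* X_* for K = int, and X_* (x) R for K = R. *)
Definition in_Xstar (K : nzRingType) m : set 'rV[K]_(dimB m) :=
  [set x | forall i, x 0 i + x 0 (rev_ord i) = x 0 (mid m) *+ 2].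

Definition in_Qvee m : set 'rV[int]_(dimB m) :=
  [set x | [/\ @in_Xstar int m x,
               forall i, x 0 i + x 0 (rev_ord i) = 0 &
               (2 %| (\sum_(i < dimB m | (i < m)%N) x 0 i))%Z]].

Definition Sstar m : set 'S_(dimB m) :=
  [set s | forall i, s (rev_ord i) = rev_ord (s i)].

Definition Wext m : set (affperm (dimB m)) :=
  [set w | in_Xstar (trans w) /\ Sstar (lin w)].

Definition Waff m : set (affperm (dimB m)) :=
  [set w | in_Qvee (trans w) /\ Sstar (lin w)].

Definition root_hyperplane (R : realType) m : set (set 'rV[R]_(dimB m)) :=
  [set H | exists (i j : 'I_(dimB m)) (d : int), [/\ j != i, j != rev_ord i &
     H = [set x | in_Xstar x /\ x 0 i - x 0 j = d%:~R]]].

Definition base_alcove (R : realType) m : set 'rV[R]_(dimB m) :=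
  [set x | [/\ in_Xstar x,
               x 0 (inord 0) < x 0 (inord 1),
               x 0 (inord m.*2) - 1 < x 0 (inord 1) &
               forall i : nat, (1 <= i < m)%N ->
                 x 0 (inord i) < x 0 (inord i.+1)]].
Arguments base_alcove : clear implicits.

(* A root hyperplane is a wall iff it is the support of a facet, i.e. iff some
   point of the closed alcove lies on it and on no other root hyperplane. *)
Definition wall (R : realType) m (H : set 'rV[R]_(dimB m)) : Prop :=
  root_hyperplane H /\
  exists x, [/\ closure (base_alcove R m) x, H x &
    forall H', root_hyperplane H' -> H' x -> H' = H].

(* Waff acts faithfully and by isometries on X_* (x) R, so the reflection
   across H is its only nontrivial element fixing H pointwise. *)
Definition simple_refl (R : realType) m (s : affperm (dimB m)) : Prop :=
  [/\ Waff s, s != 1%g &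
      exists H : set 'rV[R]_(dimB m), wall H /\ forall x, H x -> affact s x = x].
Arguments simple_refl : clear implicits.

Definition is_word (R : realType) m (x : affperm (dimB m)) (n : nat) : Prop :=
  exists s : seq (affperm (dimB m)), [/\ size s = n,
    forall t, t \in s -> simple_refl R m t & x = (\prod_(t <- s) t)%g].
Arguments is_word : clear implicits.

(* The default 0 is never used: Waff is generated by the simple reflections. *)
Definition coxeter_length (R : realType) m (x : affperm (dimB m)) : nat :=
  xget 0%N [set n | is_word R m x n /\
                    forall k, is_word R m x k -> (n <= k)%N].
Arguments coxeter_length : clear implicits.

Definition coxeter_refl (R : realType) m (t : affperm (dimB m)) : Prop :=
  exists u s, [/\ Waff u, simple_refl R m s & t = (u * s * u^-1)%g].
Arguments coxeter_refl : clear implicits.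

(* The Bruhat order is generated by y < y t for t a reflection, i.e. a conjugate
   of a simple one, with l(y) < l(y t). *)
Inductive bruhat_aff (R : realType) m (x : affperm (dimB m)) :
    affperm (dimB m) -> Prop :=
| bruhat_refl : bruhat_aff R x x
| bruhat_step y t : bruhat_aff R x y -> coxeter_refl R m t ->
    (coxeter_length R m y < coxeter_length R m (y * t)%g)%N ->
    bruhat_aff R x (y * t)%g.
Arguments bruhat_aff : clear implicits.

Definition Omega (R : realType) m : set (affperm (dimB m)) :=
  [set tau | Wext tau /\ @affact R _ tau @` base_alcove R m = base_alcove R m].
Arguments Omega : clear implicits.

(* l(x tau) = l(x); every w in Wext is uniquely of the form x tau. *)
Definition ext_length (R : realType) m (w : affperm (dimB m)) : nat :=
  xget 0%N [set n | exists x tau, [/\ Waff x, Omega R m tau,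
                      w = (x * tau)%g & n = coxeter_length R m x]].
Arguments ext_length : clear implicits.

Definition bruhat (R : realType) m (w w' : affperm (dimB m)) : Prop :=
  exists x x' tau, [/\ Waff x, Waff x', Omega R m tau &
    [/\ w = (x * tau)%g, w' = (x' * tau)%g & bruhat_aff R m x x']].
Arguments bruhat : clear implicits.

Definition avec (R : realType) m (k : nat) : 'rV[R]_(dimB m) :=
  \row_j (if (j < k)%N then - 2^-1 else if (j < dimB m - k)%N then 0 else 2^-1).
Arguments avec : clear implicits.

Definition Wfix (R : realType) m (I : {set 'I_m.+1}) : set (affperm (dimB m)) :=
  [set w | Waff w /\ forall k, k \in I -> affact w (avec R m k) = avec R m k].
Arguments Wfix : clear implicits.

Definition dcoset (R : realType) m (J I : {set 'I_m.+1})
    (w : affperm (dimB m)) : set (affperm (dimB m)) :=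
  [set x | exists u v, [/\ Wfix R m J u, Wfix R m I v & x = (u * w * v)%g]].
Arguments dcoset : clear implicits.

Definition dcosets (R : realType) m (J I : {set 'I_m.+1}) :
    set (set (affperm (dimB m))) :=
  [set D | exists w, Wext w /\ D = dcoset R m J I w].
Arguments dcosets : clear implicits.

Definition min_length_in (R : realType) m (D : set (affperm (dimB m)))
    (x : affperm (dimB m)) : Prop :=
  D x /\ forall y, D y -> (ext_length R m x <= ext_length R m y)%N.
Arguments min_length_in : clear implicits.

Definition bruhat_dcoset (R : realType) m (D D' : set (affperm (dimB m))) :=
  exists x x', [/\ min_length_in R m D x, min_length_in R m D' x' &
                   bruhat R m x x'].
Arguments bruhat_dcoset : clear implicits.

Definition perm_vec N (s : 'S_N) (v : 'rV[int]_N) : 'rV[int]_N :=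
  \row_j v 0 (s^-1%g j).

Definition Adm (R : realType) m (J I : {set 'I_m.+1}) (mu : 'rV[int]_(dimB m)) :
    set (set (affperm (dimB m))) :=
  [set D | dcosets R m J I D /\
     exists s, Sstar s /\
       bruhat_dcoset R m D (dcoset R m J I (transl (perm_vec s mu)))].
Arguments Adm : clear implicits.

(* Entry i of omega_k in the 1-based numbering is entry i - 1 here, and b, c are
   the Euclidean quotient and remainder, also for k < 0. *)
Definition omega m (k : int) : 'rV[int]_(dimB m) :=
  \row_j ((if (j%:Z < k %% (dimB m)%:Z)%Z then -1 else 0)
          - (k %/ (dimB m)%:Z)%Z).

Definition muvec m (w : affperm (dimB m)) (k : int) : 'rV[int]_(dimB m) :=
  affact w (omega m k) - omega m k.

Definition Aset m (k : nat) : {set 'I_(dimB m)} :=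
  [set j : 'I_(dimB m) | (j < k)%N || (dimB m - k <= j)%N]%SET.

Definition spin_conditions m (q : nat) (mu : 'rV[int]_(dimB m))
    (w : affperm (dimB m)) (k : nat) : Prop :=
  let muk : 'rV[int]_(dimB m) := muvec w k%:Z in
  let mu_mk : 'rV[int]_(dimB m) := muvec w (- k%:Z) in
  [/\ forall j, muk 0 j + mu_mk 0 (rev_ord j) = 2,
      forall j, 0 <= muk 0 j <= 2,
      (#|[pred j | (muk 0 j == 2)%R]| <= q)%N &
      muk = mu_mk -> ~ in_Qvee (muk - mu) ->
        exists2 j, j \in Aset m k & muk 0 j = 1].

(* A left coset in Wext / W_I contained in D is given by any of its elements w;
   muvec w k does not depend on the choice for k in I. *)
Definition SPerm (R : realType) m (q : nat) (J I : {set 'I_m.+1})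
    (mu : 'rV[int]_(dimB m)) : set (set (affperm (dimB m))) :=
  [set D | dcosets R m J I D /\
     exists w, [/\ D w, Waff (w * (transl mu)^-1)%g &
       forall k : 'I_m.+1, k \in I -> spin_conditions q mu w k]].
Arguments SPerm : clear implicits.

Definition mu_vec m (q : nat) : 'rV[int]_(dimB m) :=
  \row_j (if (j < q)%N then 2 else if (j < dimB m - q)%N then 1 else 0).

(* Main.v *)
(* Idea.  Put N = 2m + 1 and let p be the point of the base alcove with
   coordinates a / N.  An affine reflection x_i <-> x_t + D raises w in the Bruhat
   order iff it does not separate the base alcove from its image under w, which is
   read off the integers ht w a = N (w p)_a.  Let K be the set of integers congruent
   to k or -k modulo N for some k in I; the vectors g_k = mu_k - 1 extend to all k
   in K, are odd and N-periodic in k, and a reflection in (i, t, D) adds to entry i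
   and subtracts from entry t of g_k a number delta(k) of constant sign.

   Spin-permissibility is inherited downwards: |g_k| <= 1 and the bound on the
   number U_k of entries 1 by convexity, (sp3) by parity.  Conversely, if g_k is not
   a constant vector with U_k = q, some reflection raises w and keeps it
   spin-permissible: one raises an entry i on a maximal interval of K on which g is
   constant and which i entered by dropping from 1 to 0, and lowers there an entry
   which leaves it by dropping from 0 to -1 (or a substitute for it if (sp3) would
   fail).  Since sum_a (ht w a - a)^2 increases along the way and is bounded on
   spin-permissible elements, w lies below some x with constant g_k, that is,
   x = t_lambda v with lambda conjugate to mu and v in W_I.  The lifting property of
   the Bruhat order transports both statements between elements and double cosets. *)

From HB Require Import structures.
Require Import Defs.
From mathcomp Require Import all_boot all_order all_algebra all_fingroup.
From mathcomp Require Import zify ring lra.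
From mathcomp Require Import boolp classical_sets reals topology normedtype.

Set Implicit Arguments.
Unset Strict Implicit.
Unset Printing Implicit Defensive.
Import Order.TTheory GRing.Theory Num.Theory.
Import numFieldNormedType.Exports.

(** * Affine roots and reflections *)

(** The point [p] is chosen so that the integers [ht w a], for fixed w, have distinct residues
    modulo N: no root hyperplane meets its orbit, so sides are never ambiguous. The entries of
    omega_k and of w omega_k are floors, of (a - k) / N and (ht w a - k) / N, hence step functions
    of k that drop by 1 once per period. This is why they are followed along all of K. As g_k sums
    to 0, it has as many entries -1 as entries 1; where the ones can only grow and the entries -1
    can only shrink, both are frozen.

    The obstacle is (sp3). A reflection acts on an interval of K and, by oddness, on its mirror
    image under k -> -k: U_k rises by 1 if the two are disjoint modulo N and by 2 if they coincide,
    unless t is [rev_ord i], when it rises by 1 but [D] must be even. Hence the distinctions by the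
    parity of q - U_k and by the centre of the interval, at 0, at N / 2 or elsewhere. If every
    available parity is even, U_k is taken minimal and then the centre as far right as possible, so
    that the longer interval which a substitute may need meets no further drop from 1 to 0. *)

Section AffineRoots.
Local Open Scope ring_scope.
Variable m : nat.
Implicit Types (i j t a b : 'I_(dimB m)) (u v w : affperm (dimB m)) (D : int).
Local Notation N := (dimB m).
Local Notation NZ := ((dimB m)%:Z).

Lemma mulE u v : (u * v)%g = affperm_mul u v. Proof. by []. Qed.
Lemma oneE : 1%g = affperm_one N. Proof. by []. Qed.
Lemma invE u : (u^-1)%g = affperm_inv u. Proof. by []. Qed.

Lemma trans_mul u v i :
  trans (u * v)%g 0 i = trans u 0 i + trans v 0 ((lin u)^-1%g i).
Proof. by rewrite mulE /= !mxE intz. Qed.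

Lemma lin_mul u v : lin (u * v)%g = (lin v * lin u)%g. Proof. by []. Qed.
Lemma lin_inv u : lin (u^-1)%g = ((lin u)^-1)%g. Proof. by []. Qed.

Lemma trans_inv u i : trans (u^-1)%g 0 i = - trans u 0 (lin u i).
Proof. by rewrite invE /= mxE. Qed.

Lemma affpermP u v :
  (forall i, trans u 0 i = trans v 0 i) -> (forall i, lin u i = lin v i) -> u = v.
Proof.
case: u v => [l s] [l' s'] /= Hl Hs; congr AffPerm; first by apply/rowP.
by apply/permP.
Qed.

Lemma rev_mid : rev_ord (mid m) = mid m.
Proof. by apply/val_inj => /=; rewrite /mid inordK; lia. Qed.

Lemma mid_val : nat_of_ord (mid m) = m.
Proof. by rewrite /mid inordK //; lia. Qed.

Lemma rev_val i : nat_of_ord (rev_ord i) = (m.*2 - i)%N.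
Proof. by rewrite /=; lia. Qed.

Lemma rev_eq_mid i : (rev_ord i == i) = (i == mid m).
Proof.
apply/eqP/eqP => [E|->]; last exact: rev_mid.
apply/val_inj; rewrite /= mid_val; have := congr1 val E; rewrite /=.
have := ltn_ord i; lia.
Qed.

Lemma rev_eq i j : (rev_ord i == rev_ord j) = (i == j).
Proof. by rewrite (inj_eq rev_ord_inj). Qed.

Lemma rev_eq_sym i j : (rev_ord i == j) = (i == rev_ord j).
Proof. by rewrite -(rev_eq i) rev_ordK. Qed.

Lemma Wext_lin w i : Wext w -> lin w (rev_ord i) = rev_ord (lin w i).
Proof. by case=> _; apply. Qed.

Lemma Wext_linV w i : Wext w -> (lin w)^-1%g (rev_ord i) = rev_ord ((lin w)^-1%g i).
Proof.
move=> Ww; apply: (@perm_inj _ (lin w)).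
by rewrite permKV Wext_lin // permKV.
Qed.

Lemma Wext_trans w i : Wext w ->
  trans w 0 (rev_ord i) = trans w 0 (mid m) *+ 2 - trans w 0 i.
Proof. by case=> /(_ i) <- _; rewrite addrC addKr. Qed.

Lemma Wext_linmid w : Wext w -> lin w (mid m) = mid m.
Proof. by move=> Ww; apply/eqP; rewrite -rev_eq_mid -Wext_lin // rev_mid. Qed.

Lemma Wext_linVmid w : Wext w -> (lin w)^-1%g (mid m) = mid m.
Proof. by move=> Ww; apply/eqP; rewrite -rev_eq_mid -Wext_linV // rev_mid. Qed.

Lemma WextM u v : Wext u -> Wext v -> Wext (u * v)%g.
Proof.
move=> Wu Wv; split.
  move=> i; rewrite !trans_mul !Wext_linV // !Wext_trans // Wext_linVmid //.
  by rewrite mulrnDl !addrA; ring.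
by move=> i; rewrite lin_mul !permM !Wext_lin.
Qed.

Lemma WextV u : Wext u -> Wext (u^-1)%g.
Proof.
move=> Wu; split; last by move=> i; rewrite lin_inv Wext_linV.
move=> i; rewrite !trans_inv Wext_lin // Wext_linmid // (Wext_trans _ Wu).
by ring.
Qed.

Lemma Waff_ext w : Waff w -> Wext w.
Proof. by case=> -[]. Qed.

Lemma Wext1 : Wext (1%g : affperm N).
Proof. by split=> i /=; rewrite ?mxE ?perm1 ?addr0. Qed.

(* (i, t, D) stands for the hyperplane x_i - x_t = D. *)
Definition root := ('I_N * 'I_N * int)%type.
Implicit Types r : root.

(** On X_* the hyperplane x_i - x_mid = d is also x_i - x_i' = 2 d for i' = [rev_ord i]; pairs with
    a middle index are therefore left out and return as mirror pairs with even [D]. For odd [D] such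
    a reflection would violate the parity in [in_Qvee]. *)
Definition valid r := [&& r.1.1 != r.1.2, r.1.1 != mid m, r.1.2 != mid m &
  (r.1.2 == rev_ord r.1.1) ==> (2 %| r.2)%Z].

(** The values of [rperm] in a form suited to case analysis. When t is [rev_ord i] the last two
    tests are never reached, so both shapes of reflection share one formula. *)
Definition rp i t a := if a == i then t else if a == t then i
  else if a == rev_ord i then rev_ord t else if a == rev_ord t then rev_ord i else a.

(** The coroot: e_i - e_t minus its mirror image, collapsing to e_i - e_t when t is [rev_ord i]. *)
Definition rv i t a : int := if a == i then 1 else if a == t then -1
  else if a == rev_ord i then -1 else if a == rev_ord t then 1 else 0.

Definition rperm i t : 'S_N := if t == rev_ord i then tperm i t
  else (tperm i t * tperm (rev_ord i) (rev_ord t))%g.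

Definition refl r : affperm N :=
  AffPerm (\row_a (rv r.1.1 r.1.2 a * r.2)) (rperm r.1.1 r.1.2).

Lemma rpermE i t a : i != t -> i != mid m -> t != mid m ->
  rperm i t a = rp i t a.
Proof.
move=> it im tm; rewrite /rperm /rp.
have i'i : rev_ord i != i by rewrite rev_eq_mid.
have t't : rev_ord t != t by rewrite rev_eq_mid.
case: (eqVneq t (rev_ord i)) => [->|ti'].
  rewrite rev_ordK; case: tpermP => [->|->|/eqP ni /eqP ni'].
  - by rewrite eqxx.
  - by rewrite (negPf i'i) eqxx.
  by rewrite (negPf ni) (negPf ni').
have it' : i != rev_ord t by rewrite -rev_eq_sym eq_sym.
rewrite permM; case: (tpermP i t a) => [->|->|/eqP ni /eqP nt].
- by rewrite eqxx; apply: tpermD => //; rewrite eq_sym // .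
- rewrite eqxx [t == i]eq_sym (negPf it); apply: tpermD => //.
  by rewrite eq_sym.
rewrite (negPf ni) (negPf nt).
by case: tpermP => [->|->|/eqP ni' /eqP nt'];
  rewrite ?eqxx ?rev_eq ?[t == i]eq_sym ?(negPf it) ?(negPf ni') ?(negPf nt').
Qed.

Lemma rpK i t : i != t -> i != mid m -> t != mid m -> involutive (rp i t).
Proof.
move=> it im tm a; rewrite /rp.
have i'i : rev_ord i != i by rewrite rev_eq_mid.
have t't : rev_ord t != t by rewrite rev_eq_mid.
case: (eqVneq a i) => [->|ai]; first by rewrite eq_sym (negPf it) eqxx.
case: (eqVneq a t) => [->|at_]; first by rewrite eqxx.
case: (eqVneq a (rev_ord i)) => [->|ai'].
  rewrite rev_eq [t == i]eq_sym (negPf it).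
  case: (eqVneq (rev_ord t) i) => [<-|_]; first by rewrite rev_ordK.
  by rewrite (negPf t't) eqxx.
case: (eqVneq a (rev_ord t)) => [->|at'].
  rewrite (negPf i'i) eqxx.
  by case: (eqVneq (rev_ord i) t) => [<-|_]; rewrite ?rev_ordK.
by rewrite (negPf ai) (negPf at_) (negPf ai') (negPf at').
Qed.

Lemma valid_neq r : valid r -> [/\ r.1.1 != r.1.2, r.1.1 != mid m & r.1.2 != mid m].
Proof. by case/and4P. Qed.

Lemma lin_reflE r a : valid r -> lin (refl r) a = rp r.1.1 r.1.2 a.
Proof. by case/valid_neq=> *; rewrite /= rpermE. Qed.

Lemma lin_reflVE r a : valid r -> (lin (refl r))^-1%g a = rp r.1.1 r.1.2 a.
Proof.
move=> vr; apply: (@perm_inj _ (lin (refl r))); rewrite permKV lin_reflE //.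
by case/valid_neq: vr => *; rewrite rpK.
Qed.

Lemma trans_refl r a : trans (refl r) 0 a = rv r.1.1 r.1.2 a * r.2.
Proof. by rewrite mxE. Qed.

Lemma rp_rev i t a : i != t -> i != mid m -> t != mid m ->
  rp i t (rev_ord a) = rev_ord (rp i t a).
Proof.
move=> it im tm; rewrite /rp !rev_eq !rev_eq_sym.
case: (eqVneq a i) => [->|ai].
  case: (eqVneq i (rev_ord i)) => [/esym/eqP|_]; first by rewrite rev_eq_mid (negPf im).
  by case: (eqVneq i (rev_ord t)) => [->|//].
case: (eqVneq a t) => [->|at_].
  case: (eqVneq t (rev_ord i)) => [->//|_].
  by case: (eqVneq t (rev_ord t)) => [/esym/eqP|_ //]; rewrite rev_eq_mid (negPf tm).
case: (eqVneq a (rev_ord i)) => [_|ai']; first by rewrite rev_ordK.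
by case: (eqVneq a (rev_ord t)) => [_|at' //]; rewrite rev_ordK.
Qed.

Lemma rv_rev i t a : i != t -> i != mid m -> t != mid m ->
  rv i t (rev_ord a) = - rv i t a.
Proof.
move=> it im tm; rewrite /rv !rev_eq !rev_eq_sym.
case: (eqVneq a i) => [->|ai].
  case: (eqVneq i (rev_ord i)) => [/esym/eqP|_]; first by rewrite rev_eq_mid (negPf im).
  by case: (eqVneq i (rev_ord t)).
case: (eqVneq a t) => [->|at_].
  case: (eqVneq t (rev_ord i)) => [//|_].
  by case: (eqVneq t (rev_ord t)) => [/esym/eqP|_ //]; rewrite rev_eq_mid (negPf tm).
case: (eqVneq a (rev_ord i)) => [_|ai']; first by rewrite opprK.
by case: (eqVneq a (rev_ord t)); rewrite ?oppr0.
Qed.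

Lemma rv_mid i t : i != mid m -> t != mid m -> rv i t (mid m) = 0.
Proof.
by move=> im tm; rewrite /rv -!rev_eq_sym rev_mid ![mid m == _]eq_sym (negPf im) (negPf tm).
Qed.

Lemma refl_Wext r : valid r -> Wext (refl r).
Proof.
move=> vr; have [it im tm] := valid_neq vr; split.
  by move=> i; rewrite !trans_refl rv_rev // rv_mid // mulNr subrr mul0r.
by move=> i; rewrite !lin_reflE // rp_rev.
Qed.

End AffineRoots.

(** * Sides of hyperplanes, separation and displacement *)

Section Sides.
Local Open Scope ring_scope.
Variable m : nat.
Implicit Types (i j t a b : 'I_(dimB m)) (u v w : affperm (dimB m)) (D : int).
Implicit Types r : root m.
Local Notation N := (dimB m).
Local Notation NZ := ((dimB m)%:Z).

Lemma rv_rp i t a : i != t -> i != mid m -> t != mid m ->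
  rv i t (rp i t a) = - rv i t a.
Proof.
move=> it im tm; rewrite /rp.
have i'i : rev_ord i != i by rewrite rev_eq_mid.
have t't : rev_ord t != t by rewrite rev_eq_mid.
case: (eqVneq a i) => [->|ai].
  by rewrite /rv [t == i]eq_sym (negPf it) !eqxx.
case: (eqVneq a t) => [->|at_].
  by rewrite /rv [t == i]eq_sym (negPf it) !eqxx opprK.
case: (eqVneq a (rev_ord i)) => [->|ai'].
  by rewrite !rv_rev // /rv !eqxx [t == i]eq_sym (negPf it).
case: (eqVneq a (rev_ord t)) => [->|at'].
  by rewrite !rv_rev // /rv !eqxx [t == i]eq_sym (negPf it) opprK.
by rewrite /rv (negPf ai) (negPf at_) (negPf ai') (negPf at') oppr0.
Qed.

Lemma refl_invol r : valid r -> (refl r * refl r)%g = 1%g.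
Proof.
move=> vr; have [it im tm] := valid_neq vr; apply: affpermP => a.
  by rewrite trans_mul !trans_refl lin_reflVE // rv_rp // mulNr subrr oneE mxE.
by rewrite lin_mul permM !lin_reflE // rpK // perm1.
Qed.

Lemma refl_inv r : valid r -> ((refl r)^-1)%g = refl r.
Proof. by move=> vr; apply: (mulgI (refl r)); rewrite mulgV refl_invol. Qed.

Lemma refl_Waff r : valid r -> Waff (refl r).
Proof.
move=> vr; have [it im tm] := valid_neq vr; split; last by case: (refl_Wext vr).
split; first by case: (refl_Wext vr).
  by move=> a; rewrite !trans_refl rv_rev // mulNr subrr.
(* Indicator of the first half, with hf a + hf (rev a) = 1 off the middle. The half sum is thus 2
   (hf i - hf t) D for four distinct entries, and an odd multiple of the even number D for a mirror
   pair. *)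
pose hf a : int := (a < m)%N%:Z.
have hfE (x : 'I_N -> int) : \sum_(a < N | (a < m)%N) x a = \sum_a hf a * x a.
  rewrite big_mkcond; apply: eq_bigr => a _; rewrite /hf.
  by case: ifP; rewrite ?mul1r ?mul0r.
case/and4P: vr => _ _ _ /implyP D2.
have hfr a : a != mid m -> hf (rev_ord a) = 1 - hf a.
  move=> am; have {am}am : (a : nat) != m.
    by apply: contra am => /eqP E; apply/eqP/val_inj; rewrite /= mid_val.
  by rewrite /hf rev_val; have := ltn_ord a; case: ltnP; case: ltnP; lia.
rewrite hfE; under eq_bigr do rewrite trans_refl.
have i'i : rev_ord r.1.1 != r.1.1 by rewrite rev_eq_mid.
have t't : rev_ord r.1.2 != r.1.2 by rewrite rev_eq_mid.
rewrite (bigD1 r.1.1) //= (bigD1 r.1.2) 1?eq_sym //=.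
case: (eqVneq r.1.2 (rev_ord r.1.1)) D2 => [E /(_ isT) D2|ti' _].
  rewrite big1 => [|a /andP[ai at_]]; first by lia.
  rewrite /rv (negPf ai) (negPf at_) -E (negPf at_) E rev_ordK (negPf ai).
  by rewrite mul0r mulr0.
have it' : r.1.1 != rev_ord r.1.2 by rewrite -rev_eq_sym eq_sym.
rewrite (bigD1 (rev_ord r.1.1)) /=; last by rewrite i'i eq_sym.
rewrite (bigD1 (rev_ord r.1.2)) /=; last by rewrite t't eq_sym it' rev_eq eq_sym.
rewrite big1 => [|a /andP[/andP[/andP[ai at_] ai'] at']]; last first.
  by rewrite /rv (negPf ai) (negPf at_) (negPf ai') (negPf at') mul0r mulr0.
rewrite !hfr // !rv_rev // /rv !eqxx [r.1.2 == _]eq_sym (negPf it).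
by rewrite dvdzE; lia.
Qed.

Definition ract u r : root m := (lin u r.1.1, lin u r.1.2,
  r.2 + (trans u 0 (lin u r.1.1) - trans u 0 (lin u r.1.2))).

Lemma ract_mul u v r : ract (u * v)%g r = ract u (ract v r).
Proof.
case: r => [[i t] D]; rewrite /ract /= !permM !trans_mul !permK.
by congr (_, _, _); ring.
Qed.

Lemma ract1 r : ract 1%g r = r.
Proof. by case: r => [[i t] D]; rewrite /ract /= !perm1 !mxE subrr addr0. Qed.

Lemma ractK u : cancel (ract u) (ract u^-1%g).
Proof. by move=> r; rewrite -ract_mul mulVg ract1. Qed.

Lemma ractKV u : cancel (ract u^-1%g) (ract u).
Proof. by move=> r; rewrite -ract_mul mulgV ract1. Qed.

Lemma lin_eq_mid w a : Wext w -> (lin w a == mid m) = (a == mid m).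
Proof. by move=> Ww; rewrite -{1}(Wext_linmid Ww) (inj_eq perm_inj). Qed.

Lemma valid_ract u r : Wext u -> valid r -> valid (ract u r).
Proof.
move=> Wu /and4P[it im tm /implyP D2]; apply/and4P; split=> /=.
- by rewrite (inj_eq perm_inj).
- by rewrite lin_eq_mid.
- by rewrite lin_eq_mid.
rewrite -Wext_lin // (inj_eq perm_inj); apply/implyP => E; move/D2: (E).
by rewrite (eqP E) Wext_lin // (Wext_trans _ Wu) => D2'; lia.
Qed.

Lemma refl_ract u r : Wext u -> valid r ->
  refl (ract u r) = (u * refl r * u^-1)%g.
Proof.
move=> Wu vr; have vr' := valid_ract Wu vr; have [it im tm] := valid_neq vr.
have rpu a : rp (lin u r.1.1) (lin u r.1.2) (lin u a) = lin u (rp r.1.1 r.1.2 a).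
  rewrite /rp -!Wext_lin // !(inj_eq perm_inj).
  by case: eqP => // _; case: eqP => // _; case: eqP => // _; case: eqP.
have rvu a : rv (lin u r.1.1) (lin u r.1.2) (lin u a) = rv r.1.1 r.1.2 a.
  by rewrite /rv -!Wext_lin // !(inj_eq perm_inj).
apply: affpermP => a; last first.
  rewrite lin_reflE // !lin_mul !permM lin_inv lin_reflE //.
  by rewrite -{1}[a](permKV (lin u)) rpu.
rewrite -[a](permKV (lin u)); move: ((lin u)^-1%g a) => b.
rewrite trans_refl !trans_mul trans_refl rvu trans_inv permK.
rewrite lin_mul invMg !permM lin_reflVE // permK -rpu.
rewrite /rv /rp -!Wext_lin // !(inj_eq perm_inj) /=.
case: (eqVneq b r.1.1) => [->|_]; first by ring.
case: (eqVneq b r.1.2) => [->|_]; first by ring.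
case: (eqVneq b (rev_ord r.1.1)) => [->|_].
  by rewrite !Wext_lin // !(Wext_trans _ Wu); ring.
case: (eqVneq b (rev_ord r.1.2)) => [->|_]; last by rewrite mul0r; ring.
by rewrite !Wext_lin // !(Wext_trans _ Wu); ring.
Qed.

(* N times the a-th coordinate of the image under w of the point (a / N)_a of the
   base alcove. *)
Definition ht w a : int := NZ * trans w 0 a + ((lin w)^-1%g a : nat)%:Z.

Lemma ht_mul u w a : ht (u * w)%g a = NZ * trans u 0 a + ht w ((lin u)^-1%g a).
Proof. by rewrite /ht trans_mul lin_mul invMg permM; ring. Qed.

Lemma ht1 a : ht 1%g a = a%:Z.
Proof. by rewrite /ht /= mxE mulr0 add0r invg1 perm1. Qed.

Lemma ht_rev w a : Wext w ->
  ht w (rev_ord a) = NZ * (trans w 0 (mid m) *+ 2) + m.*2%:Z - ht w a.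
Proof.
move=> Ww; rewrite /ht Wext_trans // Wext_linV // rev_val.
by have := ltn_ord ((lin w)^-1%g a); nia.
Qed.

(** Modulo N the heights are the values of a permutation of 0, ..., N - 1. *)
Lemma ht_neq w i t D : i != t -> ht w i - ht w t != NZ * D.
Proof.
move=> it; apply: contra it => /eqP E.
rewrite -(inj_eq (@perm_inj _ (lin w)^-1%g)); apply/eqP/val_inj => /=.
move: E; rewrite /ht.
have := ltn_ord ((lin w)^-1%g i); have := ltn_ord ((lin w)^-1%g t).
move: (nat_of_ord _) (nat_of_ord _) => x y xN yN E.
have {}E : x%:Z - y%:Z = NZ * (D - trans w 0 i + trans w 0 t) by lia.
move: (D - _ + _) E => d E.
by have [K|K|K] := ltrgtP d 0; [nia | nia | rewrite K in E; lia].
Qed.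

(* sep w r: the hyperplane of r separates the base alcove from its image under w. *)
Definition side w r := ht w r.1.1 - ht w r.1.2 < NZ * r.2.
Definition sep w r := side w r != side 1%g r.

Lemma side_mul u w r : side (u * w)%g (ract u r) = side w r.
Proof. by rewrite /side !ht_mul /ract /= !permK; apply/idP/idP; lia. Qed.

(** The cocycle rule: a hyperplane separates A from u w A iff it separates exactly one of the pairs
    A, u A and u A, u w A, and the second pair is pulled back by u. *)
Lemma sep_mul u w r : sep (u * w)%g (ract u r) = sep u (ract u r) (+) sep w r.
Proof.
rewrite /sep side_mul -{2}(mulg1 u) side_mul.
by case: (side w r); case: (side 1%g r); case: (side 1%g _).
Qed.

Definition flipr r : root m := (r.1.2, r.1.1, - r.2).

Lemma valid_flip r : valid (flipr r) = valid r.
Proof.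
rewrite /valid /= -[r.1.1 == rev_ord _]rev_eq_sym [rev_ord _ == _]eq_sym.
by rewrite dvdzE abszN -dvdzE eq_sym; congr (_ && _); apply: andbCA.
Qed.

Lemma side_flip w r : r.1.1 != r.1.2 -> side w (flipr r) = ~~ side w r.
Proof.
move=> it; rewrite /side /= -leNgt le_eqVlt eq_sym (negPf (ht_neq _ _ it)) /=.
by apply/idP/idP; lia.
Qed.

Lemma sep_flip w r : r.1.1 != r.1.2 -> sep w (flipr r) = sep w r.
Proof. by move=> it; rewrite /sep !side_flip // (inj_eq negb_inj). Qed.

Lemma refl_flip r : valid r -> refl (flipr r) = refl r.
Proof.
move=> vr; have [it im tm] := valid_neq vr.
have vr' : valid (flipr r) by rewrite valid_flip.
apply: affpermP => a.
  rewrite !trans_refl /= /rv.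
  case: (eqVneq a r.1.2) => [->|at_]; first by rewrite eq_sym (negPf it); ring.
  case: (eqVneq a r.1.1) => [_|ai]; first by ring.
  case: (eqVneq a (rev_ord r.1.2)) => [->|at']; last by case: eqP => _; ring.
  by rewrite rev_eq eq_sym (negPf it); ring.
rewrite !lin_reflE // /= /rp.
case: (eqVneq a r.1.2) => [->|at_]; first by rewrite eq_sym (negPf it).
case: (eqVneq a r.1.1) => [//|ai].
case: (eqVneq a (rev_ord r.1.2)) => [->|at' //].
by rewrite rev_eq eq_sym (negPf it).
Qed.

Lemma ract_refl r : valid r -> ract (refl r) r = flipr r.
Proof.
move=> vr; have [it im tm] := valid_neq vr; rewrite /ract !lin_reflE //.
rewrite /rp !eqxx [r.1.2 == _]eq_sym (negPf it) !trans_refl /rv !eqxx.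
by rewrite [r.1.2 == _]eq_sym (negPf it); congr (_, _, _); ring.
Qed.

Lemma sep_refl_self r : valid r -> sep (refl r) r.
Proof.
move=> vr; have [it _ _] := valid_neq vr.
have := side_mul (refl r) 1%g (flipr r).
rewrite mulg1 {2}/flipr /sep side_flip // => E.
have -> : side (refl r) r = ~~ side 1%g r.
  by rewrite -E -{1}ract_refl // -ract_mul refl_invol // ract1.
by case: side.
Qed.

Lemma sep_refl_mul w r : valid r -> sep (refl r * w)%g r = ~~ sep w r.
Proof.
move=> vr; have [it _ _] := valid_neq vr.
have E : ract (refl r) (flipr r) = r.
  by rewrite -ract_refl // -ract_mul refl_invol // ract1.
by rewrite -{2}E sep_mul E sep_flip // sep_refl_self.
Qed.

(** N^2 times the squared distance from [p] to w p. It serves as induction measure in both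
    directions. *)
Definition disp w : int := \sum_a (ht w a - a%:Z) ^+ 2.

Lemma ht_refl r w a : Wext w -> valid r -> ht (refl r * w)%g a =
  ht w a + rv r.1.1 r.1.2 a * (NZ * r.2 - (ht w r.1.1 - ht w r.1.2)).
Proof.
move=> Ww vr; have [it im tm] := valid_neq vr.
rewrite ht_mul lin_reflVE // trans_refl /rv /rp.
case: (eqVneq a r.1.1) => [->|ai]; first by ring.
case: (eqVneq a r.1.2) => [->|at_]; first by ring.
case: (eqVneq a (rev_ord r.1.1)) => [->|ai']; first by rewrite !ht_rev //; ring.
case: (eqVneq a (rev_ord r.1.2)) => [->|at']; first by rewrite !ht_rev //; ring.
by ring.
Qed.

Lemma sum_rv i t (F : 'I_N -> int) : i != t -> i != mid m -> t != mid m ->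
  \sum_a rv i t a * F a = if t == rev_ord i then F i - F t
    else F i - F t - F (rev_ord i) + F (rev_ord t).
Proof.
move=> it im tm.
have i'i : rev_ord i != i by rewrite rev_eq_mid.
have t't : rev_ord t != t by rewrite rev_eq_mid.
rewrite (bigD1 i) //= (bigD1 t) 1?eq_sym //=.
case: (eqVneq t (rev_ord i)) => [E|ti'].
  rewrite big1 => [|a /andP[ai at_]].
    by rewrite /rv !eqxx [t == i]eq_sym (negPf it); ring.
  by rewrite /rv (negPf ai) (negPf at_) -E (negPf at_) E rev_ordK (negPf ai) mul0r.
have it' : i != rev_ord t by rewrite -rev_eq_sym eq_sym.
rewrite (bigD1 (rev_ord i)) /=; last by rewrite i'i eq_sym.
rewrite (bigD1 (rev_ord t)) /=; last by rewrite t't eq_sym it' rev_eq eq_sym.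
rewrite big1 => [|a /andP[/andP[/andP[ai at_] ai'] at']]; last first.
  by rewrite /rv (negPf ai) (negPf at_) (negPf ai') (negPf at') mul0r.
by rewrite !rv_rev // /rv !eqxx [t == i]eq_sym (negPf it); ring.
Qed.

(** Reflection moves w p along the coroot in proportion to its signed distance from the hyperplane.
    Expanding the squares leaves the product of the signed distances of w p and of p, times the
    squared length [c] of the coroot. *)
Lemma disp_refl r w : Wext w -> valid r -> exists2 c : int, 0 < c &
  disp (refl r * w)%g - disp w = c * ((NZ * r.2 - (ht w r.1.1 - ht w r.1.2)) *
                                     (NZ * r.2 - (ht 1%g r.1.1 - ht 1%g r.1.2))).
Proof.
move=> Ww vr; have [it im tm] := valid_neq vr.
exists (if r.1.2 == rev_ord r.1.1 then 2 else 4); first by case: ifP.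
set e := NZ * r.2 - (ht w r.1.1 - _); rewrite !ht1.
have E : disp (refl r * w)%g - disp w = \sum_a rv r.1.1 r.1.2 a *
  (2 * e * (ht w a - a%:Z) + e ^+ 2 * rv r.1.1 r.1.2 a).
  by rewrite /disp -sumrB; apply: eq_bigr => a _; rewrite ht_refl // -/e; ring.
rewrite E sum_rv // !rv_rev // /rv !eqxx [r.1.2 == r.1.1]eq_sym (negPf it).
case: ifP => _; first by rewrite /e; ring.
rewrite !ht_rev // !rev_val /e.
have -> : (m.*2 - r.1.1)%N%:Z = m.*2%:Z - r.1.1%:Z by have := ltn_ord r.1.1; lia.
have -> : (m.*2 - r.1.2)%N%:Z = m.*2%:Z - r.1.2%:Z by have := ltn_ord r.1.2; lia.
by ring.
Qed.

Lemma sep_disp r w : Wext w -> valid r ->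
  sep w r = (disp (refl r * w)%g < disp w).
Proof.
move=> Ww vr; have [c c0 E] := disp_refl Ww vr; have [it _ _] := valid_neq vr.
rewrite -subr_lt0 E pmulr_rlt0 // /sep /side.
have := ht_neq w r.2 it; have := ht_neq 1%g r.2 it.
set x := ht w _ - _; set y := ht 1%g _ - _; set z := NZ * _ => yz xz.
have [xz'|xz'] := ltP x z; have [yz'|yz'] := ltP y z; apply/esym => /=.
- by rewrite ltNge mulr_ge0 // subr_ge0 ltW.
- by rewrite pmulr_rlt0 ?subr_gt0 // subr_lt0 lt_neqAle eq_sym yz yz'.
- by rewrite pmulr_llt0 ?subr_gt0 // subr_lt0 lt_neqAle eq_sym xz xz'.
- by rewrite ltNge mulr_le0 // subr_le0.
Qed.

Lemma disp_ge0 w : 0 <= disp w.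
Proof. by apply: sumr_ge0 => a _; rewrite sqr_ge0. Qed.

End Sides.

(** * The base alcove and generation by simple reflections *)

Section Alcove.
Local Open Scope ring_scope.
Variable m : nat.
Implicit Types (i j t a b : 'I_(dimB m)) (u v w : affperm (dimB m)) (D : int).
Implicit Types r : root m.
Local Notation N := (dimB m).
Local Notation NZ := ((dimB m)%:Z).
Hypothesis m_gt0 : (0 < m)%N.

(** [e] is the unit of length: 1 for points of the alcove, N for the integers [ht w]. Only the first
    and last coordinates can be [e] or more apart; the weaker bound for mirror pairs suffices
    because their [D] is even. *)
Lemma alcove_gaps (K : realDomainType) (F : 'I_N -> K) (c e : K) :
  (forall i, F i + F (rev_ord i) = c) ->
  F (inord 0) < F (inord 1) -> F (inord m.*2) - e < F (inord 1) ->
  (forall i : nat, (1 <= i < m)%N -> F (inord i) < F (inord i.+1)) ->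
  forall i j, (i < j)%N ->
    [/\ F i < F j, F j - F i < e *+ 2 & j != rev_ord i -> F j - F i < e].
Proof.
move=> Fr F01 Fe Fi.
have rv_inord k : (k <= m.*2)%N -> rev_ord (inord k : 'I_N) = inord (m.*2 - k)%N.
  by move=> km; apply/val_inj; rewrite /= !inordK; lia.
have Fs k : (k < m.*2)%N -> F (inord k) < F (inord k.+1).
  move=> k2; case: (ltnP k m) => km.
    by case: k km {k2} => [_|k km]; [exact: F01 | apply: Fi; lia].
  have := Fr (inord k); have := Fr (inord k.+1); rewrite !rv_inord ?(ltnW k2) //.
  have -> : (m.*2 - k = (m.*2 - k.+1).+1)%N by lia.
  have : F (inord (m.*2 - k.+1)) < F (inord (m.*2 - k.+1).+1).
    case: (posnP (m.*2 - k.+1)%N) => [->|k0]; first exact: F01.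
    by apply: Fi; lia.
  by move: (F _) (F _) (F _) (F _) => x y z t'; lra.
have mono i j : (i <= j)%N -> F i <= F j.
  move=> ij; rewrite -(inord_val i) -(inord_val j).
  have := ltn_ord j; rewrite -(subnKC ij).
  elim: (j - i)%N => [|d IH] dj; first by rewrite addn0.
  by rewrite addnS; apply: le_trans (IH _) (ltW (Fs _ _)); lia.
have smono i j : (i < j)%N -> F i < F j.
  move=> ij; rewrite -(inord_val i).
  have k2 : (i < m.*2)%N by have := ltn_ord j; lia.
  by apply: lt_le_trans (Fs _ k2) _; apply: mono; rewrite inordK //; lia.
have gap i j : (0 < i)%N -> F j - F i < e.
  move=> i0; apply: le_lt_trans (_ : F (inord m.*2) - F (inord 1) < e); last by lra.
  apply: lerB; apply: mono; rewrite inordK //; first by have := ltn_ord j; lia.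
  by have := ltn_ord i; lia.
have gap' i j : (j < m.*2)%N -> F j - F i < e.
  move=> j2; have := gap (rev_ord j) (rev_ord i); have := Fr i; have := Fr j.
  by rewrite /= subn_gt0 => hj hi /(_ j2); lra.
move=> i j ij; split; first exact: smono.
  case: (posnP i) => [i0|i0]; last first.
    by have := gap i j i0; have := smono _ _ ij; rewrite mulr2n; lra.
  have h1 := gap (inord 1) j; have h2 := gap' i (inord 1).
  have v1 : nat_of_ord (inord 1 : 'I_N) = 1%N by rewrite inordK //; lia.
  by rewrite v1 in h1 h2; move: (h1 isT) (h2 ltac:(lia)); rewrite mulr2n; lra.
move=> jri; case: (posnP i) => [i0|]; last exact: gap.
apply: gap'; have := ltn_ord j; rewrite ltnS leq_eqVlt => /orP[/eqP j2|//].
by case/eqP: jri; apply/val_inj; rewrite /= i0 j2; lia.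
Qed.

Definition noninv w := forall r, valid r -> ~~ sep w r.

(** The simple affine roots, oriented so that the base alcove lies on the side [<]. The wall x_(m-1)
    = x_m appears as x_(m-1) = x_(m+1). For m = 1 the index 1 is the middle one, so the affine wall
    x_2 - 1 = x_1 becomes x_2 - x_0 = 2. *)
Definition base r := [&& valid r &
  [|| [&& r.1.1.+1 == r.1.2 :> nat, (r.1.2 < m)%N & r.2 == 0],
      [&& r.1.1.+1 == m, r.1.2 == m.+1 :> nat & r.2 == 0] |
      if m == 1%N then [&& r.1.1 == 2%N :> nat, r.1.2 == 0%N :> nat & r.2 == 2]
      else [&& r.1.1 == m.*2 :> nat, r.1.2 == 1%N :> nat & r.2 == 1]]].

Lemma sideE w r : side w r =
  (trans w 0 r.1.1 - trans w 0 r.1.2 < r.2) ||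
  (trans w 0 r.1.1 - trans w 0 r.1.2 == r.2) &&
  ((lin w)^-1%g r.1.1 < (lin w)^-1%g r.1.2)%N.
Proof.
rewrite /side /ht.
have := ltn_ord ((lin w)^-1%g r.1.1); have := ltn_ord ((lin w)^-1%g r.1.2).
move: (nat_of_ord ((lin w)^-1%g r.1.1)) (nat_of_ord ((lin w)^-1%g r.1.2)) => x y.
move: (trans w 0 r.1.1) (trans w 0 r.1.2) r.2 => p q d yN xN.
have [K|K|K] := ltrgtP (p - q) d => /=.
- have : p <= q + d - 1 by lia.
  by move=> K'; apply/idP; nia.
- by apply/negbTE; rewrite -leNgt; nia.
by rewrite -K; apply/idP/idP; nia.
Qed.

(** Any [F] with the gaps of the base alcove can replace [p] as the test point. For a mirror pair
    the two integers compared differ by an even number, which a gap below 2 [e] cannot outweigh. *)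
Lemma side_sorted (K : realDomainType) w (F : 'I_N -> K) (e : K) r :
  Wext w -> valid r -> 0 < e ->
  (forall i j, (i < j)%N ->
    [/\ F i < F j, F j - F i < e *+ 2 & j != rev_ord i -> F j - F i < e]) ->
  side w r = ((trans w 0 r.1.1 - trans w 0 r.1.2)%:~R * e +
     (F ((lin w)^-1%g r.1.1) - F ((lin w)^-1%g r.1.2)) < r.2%:~R * e).
Proof.
move=> Ww vr e0 HF; have [it im tm] := valid_neq vr.
case/and4P: vr => _ _ _ /implyP D2.
have par : r.1.2 = rev_ord r.1.1 ->
    exists d : int, r.2 - (trans w 0 r.1.1 - trans w 0 r.1.2) = 2 * d.
  move=> E; have {D2} := D2 _; rewrite E eqxx (Wext_trans _ Ww) => /(_ isT) D2.
  exists (divz r.2 2 - trans w 0 r.1.1 + trans w 0 (mid m)); lia.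
rewrite sideE; set p := _ - trans w 0 _ in par *; set D := r.2 in par *.
set a := (lin w)^-1%g r.1.1; set b := (lin w)^-1%g r.1.2.
have ab : a != b by rewrite (inj_eq perm_inj).
have abr : (b == rev_ord a) = (r.1.2 == rev_ord r.1.1).
  by rewrite -Wext_linV // (inj_eq perm_inj).
have -> : (p%:~R * e + (F a - F b) < D%:~R * e) = (F a - F b < (D - p)%:~R * e).
  by rewrite intrB mulrBl ltrBrDl.
have e1 (d : int) : 0 < d -> e <= d%:~R * e.
  by move=> d0; apply: ler_peMl; [exact: ltW | rewrite ler1z; lia].
have e2 (d : int) : 1 < d -> e *+ 2 <= d%:~R * e.
  move=> d1; rewrite -mulr_natl ler_pM2r // -[2%:R]/(2%:~R : K) ler_int; lia.
have [K'|K'|K'] := ltrgtP p D => /=.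
- have Dp : 0 < D - p by rewrite subr_gt0.
  apply/esym; have [ba|ab'|/val_inj/eqP] := ltngtP a b; last by rewrite (negPf ab).
    have [h _ _] := HF _ _ ba; apply: lt_le_trans (_ : 0 <= _); first by rewrite subr_lt0.
    by rewrite mulr_ge0 ?ler0z ?ltW.
  have [h1 h2 h3] := HF _ _ ab'.
  case: (eqVneq r.1.2 (rev_ord r.1.1)) => [/par[d dE]|ne].
    by apply: lt_le_trans h2 (e2 _ _); move: Dp; rewrite dE; clear; lia.
  apply: lt_le_trans (h3 _) (e1 _ Dp).
  by rewrite -rev_eq_sym eq_sym abr.
- have pD : 0 < p - D by rewrite subr_gt0.
  apply/esym/negbTE; rewrite -leNgt -lerN2 -mulNr -intrN !opprB.
  have [ba|ab'|/val_inj/eqP] := ltngtP a b; last by rewrite (negPf ab).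
    have [h1 h2 h3] := HF _ _ ba.
    case: (eqVneq r.1.2 (rev_ord r.1.1)) => [/par[d dE]|ne].
      apply: le_trans (ltW h2) (e2 _ _); move: pD.
      by rewrite -opprB dE; clear; lia.
    by apply: le_trans (ltW (h3 _)) (e1 _ pD); rewrite abr.
  have [h _ _] := HF _ _ ab'; apply: le_trans (_ : 0 <= _); first by rewrite subr_le0 ltW.
  by rewrite mulr_ge0 ?ler0z ?ltW.
rewrite K' subrr mul0r subr_lt0.
have [ba|ab'|/val_inj/eqP] := ltngtP a b; last by rewrite (negPf ab).
  by have [-> _ _] := HF _ _ ba.
by have [h _ _] := HF _ _ ab'; apply/esym/negbTE; rewrite -leNgt ltW.
Qed.

Lemma side1_sorted r (F : 'I_N -> int) :
  valid r -> (forall i j, (i < j)%N ->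
    [/\ F i < F j, F j - F i < NZ *+ 2 & j != rev_ord i -> F j - F i < NZ]) ->
  side 1%g r = (F r.1.1 - F r.1.2 < NZ * r.2).
Proof.
move=> vr HF; rewrite (side_sorted (Wext1 m) vr _ HF) //.
by rewrite !mxE subrr mul0r add0r invg1 !perm1 intz mulrC.
Qed.

Lemma base_intro k l D : (k < N)%N -> (l < N)%N ->
  base (inord k, inord l, D) =
   [&& [&& k != l, k != m, l != m & (l + k == m.*2)%N ==> (2 %| D)%Z] &
    [|| [&& k.+1 == l, (l < m)%N & D == 0], [&& k.+1 == m, l == m.+1 & D == 0] |
      if m == 1%N then [&& k == 2%N, l == 0%N & D == 2]
      else [&& k == m.*2, l == 1%N & D == 1]]].
Proof.
move=> kN lN; rewrite /base /valid /= -!val_eqE /= !mid_val !inordK //.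
by have -> : (l == N - k.+1)%N = (l + k == m.*2)%N by apply/idP/idP; lia.
Qed.

Lemma base_gaps (K : realDomainType) (F : 'I_N -> K) (c e : K) :
  (forall i, F i + F (rev_ord i) = c) ->
  (forall r, base r -> F r.1.1 - F r.1.2 < r.2%:~R * e) ->
  [/\ F (inord 0) < F (inord 1), F (inord m.*2) - e < F (inord 1) &
      forall i : nat, (1 <= i < m)%N -> F (inord i) < F (inord i.+1)].
Proof.
move=> Fr Hb.
have rv_inord k : (k <= m.*2)%N -> rev_ord (inord k : 'I_N) = inord (m.*2 - k)%N.
  by move=> km; apply/val_inj; rewrite /= !inordK; lia.
have B k l D : (k < N)%N -> (l < N)%N -> base (inord k, inord l, D) ->
    F (inord k) - F (inord l) < D%:~R * e.
  by move=> kN lN /Hb.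
have Fi k : (k < m)%N -> F (inord k) < F (inord k.+1).
  move=> km; have [k1|k1] := ltnP k.+1 m.
    have := @B k k.+1 0; rewrite base_intro; [|lia|lia].
    move=> h; have {}h := h ltac:(lia) ltac:(lia) ltac:(lia).
    by rewrite -subr_lt0 -[0](mul0r e).
  have {k1}Ek : k = m.-1 by lia.
  have := @B k m.+1 0; rewrite base_intro; [|lia|lia] => h.
  have {}h := h ltac:(lia) ltac:(lia) ltac:(lia); rewrite mul0r in h.
  have := Fr (inord k); have := Fr (inord m).
  rewrite !rv_inord; [|lia|lia].
  have -> : (m.*2 - m = m)%N by lia.
  have -> : (m.*2 - k = m.+1)%N by lia.
  have -> : k.+1 = m by lia.
  by move: h; move: (F _) (F _) (F _) => x y z; lra.
split; [exact: Fi | | by move=> k km; apply: Fi; lia].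
have [m1|m1] := eqVneq m 1%N.
  have := @B 2%N 0%N 2; rewrite base_intro; [|lia|lia] => h.
  have {}h := h ltac:(lia) ltac:(lia) ltac:(by rewrite m1).
  have := Fr (inord 0); have := Fr (inord 1); rewrite !rv_inord; [|lia|lia].
  have -> : (m.*2 - 1 = 1)%N by lia.
  have -> : (m.*2 - 0 = 2)%N by lia.
  have -> : inord m.*2 = inord 2 :> 'I_N by congr inord; lia.
  by move: h; rewrite -[2%:~R]/(2 : K); move: (F _) (F _) (F _) => x y z; lra.
have := @B m.*2 1%N 1; rewrite base_intro ?(negPf m1); [|lia|lia] => h.
by have {}h := h ltac:(lia) ltac:(lia) ltac:(lia); rewrite ltrBlDr -ltrBlDl -[e]mul1r.
Qed.

Lemma side1_base r : base r -> side 1%g r.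
Proof.
case: r => [[i t] D]; rewrite -(inord_val i) -(inord_val t) base_intro //.
rewrite /side /= !ht1 !inordK //; case/andP=> _ /or3P[].
- by move=> /and3P[/eqP <- _ /eqP->]; rewrite mulr0; lia.
- by move=> /and3P[/eqP im /eqP-> /eqP->]; rewrite mulr0; lia.
case: ifP => m1 /and3P[/eqP-> /eqP-> /eqP->]; first by rewrite (eqP m1).
by rewrite mulr1; lia.
Qed.

(** If no wall separates, the heights of w satisfy the inequalities of the base alcove scaled by N.
    They may then serve as test point for the identity, so w p and p lie on the same side of every
    hyperplane. *)
Lemma noninv_base w : Wext w -> (forall r, base r -> ~~ sep w r) -> noninv w.
Proof.
move=> Ww Hb.
have htr i : ht w i + ht w (rev_ord i) = ht w (mid m) *+ 2.
  by have := ht_rev (mid m) Ww; rewrite rev_mid ht_rev // => E; lia.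
have hb r : base r -> ht w r.1.1 - ht w r.1.2 < r.2%:~R * NZ.
  by move=> br; move: (Hb r br); rewrite /sep (side1_base br) /side intz mulrC; case: (_ < _).
have [F01 Fe Fi] := base_gaps htr hb.
move=> r vr; rewrite /sep {1}/side negbK; apply/eqP/esym.
exact/side1_sorted/(alcove_gaps htr).
Qed.

End Alcove.

(** * Parity of translation parts; freeness of the action on alcoves *)

Section Generation.
Local Open Scope ring_scope.
Variable m : nat.
Implicit Types (i j t a b : 'I_(dimB m)) (u v w x y : affperm (dimB m)) (D : int).
Implicit Types r : root m.
Local Notation N := (dimB m).
Local Notation NZ := ((dimB m)%:Z).

Lemma Waff_trans_mid w : Waff w -> trans w 0 (mid m) = 0.
Proof.
case=> [[_ /(_ (mid m)) E _] _]; move: E; rewrite rev_mid -mulr2n => /eqP.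
by rewrite mulrn_eq0 => /eqP.
Qed.

Lemma Waff_trans_rev w i : Waff w -> trans w 0 (rev_ord i) = - trans w 0 i.
Proof.
by move=> Ww; rewrite (Wext_trans _ (Waff_ext Ww)) Waff_trans_mid // mul0rn sub0r.
Qed.

Lemma sum_norm_low (G : 'I_N -> int) : (forall i, G (rev_ord i) = - G i) ->
  \sum_(i < N) `|G i| = (\sum_(i < N | (i < m)%N) `|G i|) *+ 2.
Proof.
move=> Gr; have G0 : G (mid m) = 0 by have := Gr (mid m); rewrite rev_mid; lia.
rewrite (bigID (fun i : 'I_N => (i < m)%N)) /= mulr2n; congr (_ + _).
rewrite (bigD1 (mid m)) /=; last by rewrite mid_val ltnn.
rewrite G0 normr0 add0r (reindex_inj (@rev_ord_inj _)) /=.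
apply: eq_big => [i|i _]; last by rewrite Gr normrN.
have -> : (rev_ord i == mid m) = (i == m :> nat).
  by rewrite rev_eq_sym rev_mid -val_eqE /= mid_val.
by have := ltn_ord i; lia.
Qed.

Lemma sum_norm_mod2 (G : 'I_N -> int) :
  (2 %| \sum_(i < N | (i < m)%N) `|G i| - \sum_(i < N | (i < m)%N) G i)%Z.
Proof. by rewrite -sumrB; apply: (big_ind (fun z => (2 %| z)%Z)) => // [x y|i _]; lia. Qed.

(** Modulo 2 entries may be replaced by absolute values, whose sum over the first half is half the
    total, and the total is invariant under permutation. *)
Lemma sum_low_mod2 (F : 'I_N -> int) (s : 'S_N) :
  Sstar s -> (forall i, F (rev_ord i) = - F i) ->
  (2 %| \sum_(i < N | (i < m)%N) F (s i) - \sum_(i < N | (i < m)%N) F i)%Z.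
Proof.
move=> Ss Fr; have E : \sum_(i < N | (i < m)%N) `|F (s i)| = \sum_(i < N | (i < m)%N) `|F i|.
  have := sum_norm_low (fun i => ltac:(by rewrite /= Ss Fr) : F (s (rev_ord i)) = - F (s i)).
  have -> : \sum_(i < N) `|F (s i)| = \sum_(i < N) `|F i|.
    by rewrite [RHS](reindex_inj (@perm_inj _ s)).
  by rewrite sum_norm_low // => /eqP; rewrite eqr_pMn2r // => /eqP.
have dv (x y z : int) : (2 %| x - y)%Z -> (2 %| x - z)%Z -> (2 %| y - z)%Z by lia.
by have := sum_norm_mod2 F; have := sum_norm_mod2 (fun i => F (s i)); rewrite /= E; apply: dv.
Qed.

Lemma Sstar_inv (s : 'S_N) : Sstar s -> Sstar (s^-1)%g.
Proof. by move=> Ss i; apply: (@perm_inj _ s); rewrite permKV Ss permKV. Qed.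

Lemma WaffM u v : Waff u -> Waff v -> Waff (u * v)%g.
Proof.
move=> Wu Wv; have [[_ _ pu] Su] := Wu; have [[_ _ pv] Sv] := Wv.
have [Xuv Suv] := WextM (Waff_ext Wu) (Waff_ext Wv).
split=> //; split=> //.
  move=> i; rewrite !trans_mul Wext_linV; last exact: Waff_ext.
  by rewrite !Waff_trans_rev //; ring.
under eq_bigr do rewrite trans_mul; rewrite big_split /=.
have := sum_low_mod2 (Sstar_inv Su) (fun i => Waff_trans_rev i Wv).
by move: (\sum_(i < N | _) _) (\sum_(i < N | _) _) (\sum_(i < N | _) _) pu pv => a b c; lia.
Qed.

Lemma WaffV u : Waff u -> Waff (u^-1)%g.
Proof.
move=> Wu; have [[_ _ pu] Su] := Wu; have [Xuv Suv] := WextV (Waff_ext Wu).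
split=> //; split=> //.
  move=> i; rewrite !trans_inv Wext_lin; last exact: Waff_ext.
  by rewrite !Waff_trans_rev //; ring.
under eq_bigr do rewrite trans_inv; rewrite sumrN.
have := sum_low_mod2 Su (fun i => Waff_trans_rev i Wu).
by move: (\sum_(i < N | _) _) (\sum_(i < N | _) _) pu => a b; lia.
Qed.

Lemma Waff1 : Waff (1%g : affperm N).
Proof.
have [X S] := Wext1 m; split=> //; split=> // [i|]; first by rewrite !mxE.
by rewrite big1 // => i _; rewrite mxE.
Qed.

Lemma Waff_conj u v : Wext u -> Waff v -> Waff (u * v * u^-1)%g.
Proof.
move=> Wu Wv; have [[_ _ pv] Sv] := Wv; have [_ Su] := Wu.
have [X S] := WextM (WextM Wu (Waff_ext Wv)) (WextV Wu).
have E i : trans (u * v * u^-1)%g 0 i = trans v 0 ((lin u)^-1%g i) +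
    (trans u 0 i - trans u 0 (((lin u)^-1 * (lin v)^-1 * lin u)%g i)).
  by rewrite !trans_mul trans_inv !lin_mul !invMg !permM; ring.
have Ss : Sstar ((lin u)^-1 * (lin v)^-1 * lin u)%g.
  by move=> i; rewrite !permM (Sstar_inv Su) (Sstar_inv Sv) Su.
split=> //; split=> //.
  by move=> i; rewrite !E Wext_linV // Waff_trans_rev // Ss !(Wext_trans _ Wu); ring.
under eq_bigr do rewrite E; rewrite big_split /= sumrB.
(* Subtracting the middle entry makes the translation part odd under [rev_ord], as [sum_low_mod2]
   requires. *)
pose F i := trans u 0 i - trans u 0 (mid m).
have Fr i : F (rev_ord i) = - F i by rewrite /F (Wext_trans _ Wu); ring.
have := sum_low_mod2 Ss Fr.
have := sum_low_mod2 (Sstar_inv Su) (fun i => Waff_trans_rev i Wv).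
rewrite /F !sumrB; move: (\sum_(i < N | _) trans v 0 _) => a.
move: (\sum_(i < N | _) _) (\sum_(i < N | _) _) (\sum_(i < N | _) _) (\sum_(i < N | _) _) pv => b c d e; lia.
Qed.

Hypothesis m_gt0 : (0 < m)%N.

(** Freeness of Waff on alcoves. The inequalities confine the heights of the first half so tightly
    that the translation part vanishes; the permutation is then increasing, hence trivial. *)
Lemma noninv_Waff w : Waff w -> noninv w -> w = 1%g.
Proof.
move=> Ww Hw; have Wx := Waff_ext Ww.
have htr i : ht w (rev_ord i) = m.*2%:Z - ht w i.
  by rewrite ht_rev // Waff_trans_mid //; lia.
have v k : (k < N)%N -> nat_of_ord (inord k : 'I_N) = k by move=> kN; rewrite inordK.
have S i j D : i != j -> i != mid m -> j != mid m -> ((j == rev_ord i) ==> (2 %| D)%Z) ->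
    (i%:Z - j%:Z < NZ * D) -> ht w i - ht w j < NZ * D.
  move=> ij im jm D2 s; have vr : valid ((i, j, D) : root m) by apply/and4P.
  by move: (Hw _ vr); rewrite /sep negbK /side /= !ht1 s => /eqP.
have nmid i : (i : nat) != m -> i != mid m.
  by apply: contra => /eqP->; rewrite mid_val.
have mono i j : (i < j)%N -> (i : nat) != m -> (j : nat) != m -> ht w i < ht w j.
  move=> ij im jm; rewrite -subr_lt0 -(mulr0 NZ); apply: S; rewrite ?nmid //.
  - by rewrite neq_ltn ij.
  - by rewrite dvdz0 implybT.
  by rewrite mulr0; lia.
have lt_m i : (i < m)%N -> ht w i < m%:Z.
  move=> im; have := mono i (rev_ord i); rewrite htr rev_val.
  by move=> /(_ ltac:(lia) ltac:(lia) ltac:(lia)); lia.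
have top : - m%:Z - 1 < ht w (inord 0) /\
    (forall i, (0 < i < m)%N -> 0 <= ht w i).
  have [m1|m1] := eqVneq m 1%N.
    split; last by move=> i; lia.
    have := @S (inord 2) (inord 0) 2.
    have -> : inord 2 = rev_ord (inord 0 : 'I_N) by apply/val_inj; rewrite /= !v; lia.
    rewrite htr rev_ordK eqxx => h.
    have : m.*2%:Z - ht w (inord 0) - ht w (inord 0) < NZ * 2.
      apply: h => //; rewrite ?rev_eq_mid ?nmid ?v ?rev_val ?v //; try lia.
    lia.
  have h : ht w (inord m.*2) - ht w (inord 1) < NZ * 1.
    apply: S; rewrite ?nmid -?val_eqE /= ?v; lia.
  have r1 : ht w (inord m.*2.-1) = m.*2%:Z - ht w (inord 1).
    by rewrite -htr; congr ht; apply/val_inj; rewrite /= !v; lia.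
  have r0 : ht w (inord m.*2) = m.*2%:Z - ht w (inord 0).
    by rewrite -htr; congr ht; apply/val_inj; rewrite /= !v; lia.
  have := mono (inord m.*2.-1) (inord m.*2).
  rewrite !v; [|lia|lia] => /(_ ltac:(lia) ltac:(lia) ltac:(lia)) h2.
  have := lt_m (inord 1); rewrite v; [|lia] => /(_ ltac:(lia)) h3.
  split=> [|i i0]; first by lia.
  have h4 : 0 <= ht w (inord 1) by lia.
  have [i1|i1] := eqVneq (i : nat) 1%N; first by rewrite -(inord_val i) i1.
  apply: le_trans h4 (ltW _); apply: mono; rewrite ?v; lia.
have [top0 topi] := top.
have zlam (l : int) (s : nat) : (s < N)%N -> - m%:Z - 1 < NZ * l + s%:Z ->
    NZ * l + s%:Z < m%:Z -> l = 0 \/ l = -1.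
  by move=> sN h1 h2; case: (ltrgtP l 0) => [h|h|->]; [right; nia | nia | left].
have tr i : (i < m)%N -> trans w 0 i = 0.
  have tri (k : 'I_N) : (0 < k < m)%N -> trans w 0 k = 0.
    move=> k0; have := topi _ k0; have := lt_m k ltac:(lia); rewrite /ht.
    have := ltn_ord ((lin w)^-1%g k); move: (nat_of_ord ((lin w)^-1%g k)) => s sN h1 h2.
    by case: (zlam (trans w 0 k) s sN) => //; nia.
  move=> im; case: (posnP i) => [i0|i0]; last by apply: tri; rewrite i0.
  (* The inequalities leave 0 and -1 for entry 0. As the other entries of the first half vanish, the
     parity in [in_Qvee] excludes -1. *)
  have [[_ _ +] _] := Ww; rewrite (bigD1 i) //= big1 => [|k /andP[km ki]].
    have := lt_m i im; move: top0; have -> : inord 0 = i by rewrite -i0 inord_val.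
    rewrite /ht.
    have := ltn_ord ((lin w)^-1%g i); move: (nat_of_ord ((lin w)^-1%g i)) => s sN h1 h2.
    by case: (zlam (trans w 0 i) s sN) => // ->.
  apply: tri; rewrite km andbT lt0n; apply: contra ki => /eqP k0.
  by apply/eqP/val_inj; rewrite /= k0 i0.
have tr0 i : trans w 0 i = 0.
  have [im|im|im] := ltngtP (i : nat) m; first exact: tr.
    by rewrite -[i]rev_ordK Waff_trans_rev // tr ?oppr0 // rev_val; have := ltn_ord i; lia.
  have -> : i = mid m by apply/val_inj; rewrite /= mid_val.
  exact: Waff_trans_mid.
have hs i : ht w i = ((lin w)^-1%g i : nat)%:Z by rewrite /ht tr0 mulr0 add0r.
have incr i j : (i < j)%N -> ((lin w)^-1%g i < (lin w)^-1%g j)%N.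
  have hm : ht w (mid m) = m%:Z by have := htr (mid m); rewrite rev_mid; lia.
  move=> ij; rewrite -ltz_nat -!hs.
  have [im|im] := eqVneq (i : nat) m.
    have -> : i = mid m by apply/val_inj; rewrite /= mid_val.
    rewrite hm -[j]rev_ordK htr; have := lt_m (rev_ord j).
    by rewrite rev_val => /(_ ltac:(lia)); lia.
  have [jm|jm] := eqVneq (j : nat) m; last exact: mono.
  have -> : j = mid m by apply/val_inj; rewrite /= mid_val.
  by rewrite hm; apply: lt_m; lia.
have ge' k : (k < N)%N -> (k <= (lin w)^-1%g (inord k))%N.
  elim: k => // k IH kN; apply: leq_ltn_trans (IH (ltnW kN)) _.
  by apply: incr; rewrite !v //; exact: ltnW.
have ge i : (i <= (lin w)^-1%g i)%N by have := ge' i (ltn_ord i); rewrite inord_val.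
have idV i : (lin w)^-1%g i = i.
  apply/val_inj/eqP; rewrite /= eqn_leq ge andbT.
  have := ge (rev_ord i); rewrite Wext_linV // !rev_val.
  by have := ltn_ord i; have := ltn_ord ((lin w)^-1%g i); lia.
apply: affpermP => i; rewrite ?tr0 ?mxE //=.
by rewrite perm1 -{1}(idV i) permKV.
Qed.

(** Reflecting in a separating wall brings w p closer to [p], so the induction runs on [disp]. *)
Lemma Wext_descent (Q : affperm N -> Prop) :
  (forall w, Wext w -> noninv w -> Q w) ->
  (forall w r, Wext w -> base r -> sep w r -> Q (refl r * w)%g -> Q w) ->
  forall w, Wext w -> Q w.
Proof.
move=> Q0 QS w; have [n] := ubnP (absz (disp w)).
elim: n => // n IH in w * => wn Ww.
have [h|/existsNP[r /not_implyP[br /negP]]] := pselect (forall r, base r -> ~~ sep w r).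
  exact/Q0/noninv_base.
rewrite negbK => sr; have /andP[vr _] := br.
apply: (QS w r) => //; apply: IH; last exact: WextM (refl_Wext vr) Ww.
move: sr; rewrite sep_disp //; have := disp_ge0 (refl r * w)%g; lia.
Qed.

End Generation.

(** * Walls *)

Section Walls.
Local Open Scope ring_scope.
Variables (R : realType) (m : nat).
Implicit Types (i j a b : 'I_(dimB m)) (s t u v w : affperm (dimB m)) (D : int).
Implicit Types r : root m.
Local Notation N := (dimB m).
Local Notation NZ := ((dimB m)%:Z).
Implicit Types x y z : 'rV[R]_N.
Hypothesis m_gt0 : (0 < m)%N.

Lemma affactE u x a : affact u x 0 a = (trans u 0 a)%:~R + x 0 ((lin u)^-1%g a).
Proof. by rewrite mxE. Qed.

Lemma affact_mul u v x : affact (u * v)%g x = affact u (affact v x).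
Proof. exact: act_mul. Qed.

Lemma affact1 x : affact 1%g x = x.
Proof. by apply/rowP => a; rewrite affactE mxE mulr0z add0r invg1 perm1. Qed.

Lemma affactK u : cancel (@affact R _ u) (@affact R _ u^-1%g).
Proof. by move=> x; rewrite -affact_mul mulVg affact1. Qed.

Lemma affactKV u : cancel (@affact R _ u^-1%g) (@affact R _ u).
Proof. by move=> x; rewrite -affact_mul mulgV affact1. Qed.

Lemma affact_Xstar u x : Wext u -> in_Xstar x -> in_Xstar (affact u x).
Proof.
move=> Wu Xx a; rewrite !affactE Wext_linV // Wext_trans // Wext_linVmid //.
have := Xx ((lin u)^-1%g a); rewrite !mulr2n intrB intrD => E.
by rewrite -addrA addrACA -addrA; move: E; move: (x 0 _) (x 0 _) (x 0 _) => p q s; lra.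
Qed.

Lemma alcove_Xstar x : base_alcove R m x -> in_Xstar x.
Proof. by case. Qed.

Lemma alcove_sorted x : base_alcove R m x -> forall i j, (i < j)%N ->
  [/\ x 0 i < x 0 j, x 0 j - x 0 i < 1 *+ 2 & j != rev_ord i -> x 0 j - x 0 i < 1].
Proof. by case=> Xx x01 x1 xi; apply: (alcove_gaps m_gt0 Xx). Qed.

Lemma side_alcove w x r : base_alcove R m x -> Wext w -> valid r ->
  side w r = (affact w x 0 r.1.1 - affact w x 0 r.1.2 < r.2%:~R).
Proof.
move=> Ax Ww vr; rewrite (side_sorted m_gt0 Ww vr ltr01 (alcove_sorted Ax)).
by rewrite !affactE !mulr1 intrB opprD addrACA.
Qed.

Lemma side_alcoveN w x r : base_alcove R m x -> Wext w -> valid r ->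
  ~~ side w r = (r.2%:~R < affact w x 0 r.1.1 - affact w x 0 r.1.2).
Proof.
move=> Ax Ww vr; have [it _ _] := valid_neq vr.
by rewrite -side_flip // (side_alcove Ax) ?valid_flip //= intrN ltrNr opprB.
Qed.

Lemma alcoveP x : in_Xstar x -> (forall r, base r -> x 0 r.1.1 - x 0 r.1.2 < r.2%:~R) ->
  base_alcove R m x.
Proof.
move=> Xx Hb; have Hb1 r : base r -> x 0 r.1.1 - x 0 r.1.2 < r.2%:~R * 1.
  by move=> /Hb; rewrite mulr1.
by have [x01 x1 xi] := base_gaps m_gt0 Xx Hb1; split.
Qed.

Definition apt : 'rV[R]_N := \row_a (a%:R / N%:R).

(** The denominator is 2 N, twice that of [apt], to accommodate the midpoints in [mirror_pt]. *)
Lemma Xstar_row (F : 'I_N -> int) (c : int) : (forall a, F a + F (rev_ord a) = c) ->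
  in_Xstar (\row_a ((F a)%:~R / (N * 2)%:R) : 'rV[R]_N).
Proof.
move=> Fr a; rewrite !mxE -mulrDl -mulrnAl -intrD Fr -(Fr (mid m)) rev_mid intrD.
by rewrite mulr2n.
Qed.

Lemma aptE : apt = \row_a ((2 * a%:Z)%:~R / (N * 2)%:R).
Proof.
apply/rowP => a; rewrite !mxE natrM intrM -[2%:~R]/(2%:R) -[a%:Z%:~R]/(a%:R).
by rewrite [N%:R * 2]mulrC -mulf_div divff ?mul1r // pnatr_eq0.
Qed.

Lemma lt_row (F : 'I_N -> int) i j D :
  ((\row_a ((F a)%:~R / (N * 2)%:R) : 'rV[R]_N) 0 i -
   (\row_a ((F a)%:~R / (N * 2)%:R) : 'rV[R]_N) 0 j < D%:~R) = (F i - F j < 2 * (NZ * D)).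
Proof.
rewrite !mxE -mulrBl -intrB ltr_pdivrMr ?ltr0n // -[(N * 2)%:R]/((N * 2)%:Z%:~R) -intrM ltr_int.
by apply/idP/idP; lia.
Qed.

Lemma apt_alcove : base_alcove R m apt.
Proof.
apply: alcoveP => [|r br]; rewrite aptE.
  by apply: (@Xstar_row _ (m.*2.*2)%:Z) => a; rewrite rev_val; have := ltn_ord a; lia.
have := side1_base m_gt0 br; rewrite lt_row /side !ht1; lia.
Qed.

Lemma noninv_Omega t : Wext t -> (noninv t <-> Omega R m t).
Proof.
move=> Wt; split=> [Ht|[_ tA] r vr].
  have At u x : Wext u -> noninv u -> base_alcove R m x -> base_alcove R m (affact u x).
    move=> Wu Hu Ax; apply: alcoveP => [|r br]; first exact/affact_Xstar/alcove_Xstar.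
    have /andP[vr _] := br; rewrite -(side_alcove Ax Wu vr).
    by move: (Hu r vr); rewrite /sep (side1_base m_gt0 br); case: side.
  split=> //; apply/seteqP; split=> [_ [x Ax <-]|x Ax]; first exact: At.
  exists (affact t^-1%g x); last exact: affactKV.
  apply: At => //; first exact: WextV.
  move=> r vr; have := sep_mul t^-1%g t (ract t r).
  rewrite ractK mulVg (negPf (Ht _ (valid_ract Wt vr))) addbF => <-.
  by rewrite /sep eqxx.
have := apt_alcove; have : base_alcove R m (affact t apt) by rewrite -tA; exists apt => //; exact: apt_alcove.
move=> tA0 A0; rewrite /sep negbK (side_alcove A0 Wt vr).
by rewrite (side_alcove tA0 (Wext1 m) vr) affact1.
Qed.

Definition on_hyp r : set 'rV[R]_N :=
  [set x | in_Xstar x /\ x 0 r.1.1 - x 0 r.1.2 = r.2%:~R].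

Lemma root_hyperplane_on_hyp H : root_hyperplane H -> exists2 r, valid r & H = on_hyp r.
Proof.
case=> i [j [d [ji jri ->]]].
have XE x a : in_Xstar x -> x 0 (rev_ord a) = x 0 (mid m) *+ 2 - x 0 a.
  by move=> /(_ a) <-; rewrite addrC addKr.
case: (eqVneq j (mid m)) => [jm|jm].
  have im : i != mid m by rewrite -jm eq_sym.
  exists (i, rev_ord i, 2 * d).
    apply/and4P; split=> //=; first by rewrite eq_sym rev_eq_mid.
      by rewrite rev_eq_sym rev_mid.
    by apply/implyP => _; rewrite dvdz_mulr.
  apply/seteqP; rewrite jm; split=> x /= [Xx E]; split=> //; move: E;
    rewrite XE // mulr2n intrM -[2%:~R]/(2 : R); lra.
case: (eqVneq i (mid m)) => [im|im].
  exists (rev_ord j, j, 2 * d).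
    apply/and4P; split=> //=; first by rewrite rev_eq_mid.
      by rewrite rev_eq_sym rev_mid.
    by apply/implyP => _; rewrite dvdz_mulr.
  apply/seteqP; rewrite im; split=> x /= [Xx E]; split=> //; move: E;
    rewrite XE // mulr2n intrM -[2%:~R]/(2 : R); lra.
exists (i, j, d) => //; apply/and4P; split=> //=; first by rewrite eq_sym.
by rewrite (negPf jri).
Qed.

Lemma on_hyp_root_hyperplane r : valid r -> root_hyperplane (on_hyp r).
Proof.
case: r => [[i t] D] /and4P[/= it im tm /implyP D2].
case: (eqVneq t (rev_ord i)) => [E|ti]; last first.
  by exists i, t, D; split=> //; rewrite eq_sym.
have XE x a : in_Xstar x -> x 0 (rev_ord a) = x 0 (mid m) *+ 2 - x 0 a.
  by move=> /(_ a) <-; rewrite addrC addKr.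
have [d dE] : exists d, D = 2 * d by exists (divz D 2); move: D2; rewrite E eqxx => /(_ isT); lia.
exists i, (mid m), d; rewrite eq_sym im -rev_eq_sym rev_mid eq_sym im; split=> //.
apply/seteqP; rewrite E dE; split=> x /= [Xx E']; split=> //; move: E';
  rewrite XE // mulr2n intrM -[2%:~R]/(2 : R); lra.
Qed.

Lemma refl_fix r x : valid r -> on_hyp r x -> affact (refl r) x = x.
Proof.
move=> vr [Xx E]; have [it im tm] := valid_neq vr.
have XE a : x 0 (rev_ord a) = x 0 (mid m) *+ 2 - x 0 a.
  by rewrite -(Xx a) addrC addKr.
apply/rowP => a; rewrite affactE lin_reflVE // trans_refl intrM -E /rv /rp.
case: (eqVneq a r.1.1) => [->|_]; first by rewrite mul1r subrK.
case: (eqVneq a r.1.2) => [->|_]; first by rewrite -[(-1)%:~R]/(-1 : R); ring.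
case: (eqVneq a (rev_ord r.1.1)) => [->|_]; first by rewrite !XE -[(-1)%:~R]/(-1 : R); ring.
case: (eqVneq a (rev_ord r.1.2)) => [->|_]; first by rewrite !XE mul1r; ring.
by rewrite mul0r add0r.
Qed.

Lemma on_hyp_ract u r x : Wext u -> on_hyp r x -> on_hyp (ract u r) (affact u x).
Proof.
move=> Wu [Xx E]; split; first exact: affact_Xstar.
by rewrite /ract /= !affactE !permK intrD intrB -E; ring.
Qed.

Lemma closure_side w r x : Wext w -> valid r -> side w r -> closure (base_alcove R m) x ->
  affact w x 0 r.1.1 - affact w x 0 r.1.2 <= r.2%:~R.
Proof.
move=> Ww vr sr cx; rewrite leNgt; apply/negP; rewrite -subr_gt0.
set e := _ - _%:~R => e0.
have [y [Ay]] := cx _ (nbhsx_ballx x (e / 2) ltac:(by rewrite divr_gt0)).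
case=> _ yx; have cl a : `|x 0 a - y 0 a| < e / 2 by have := yx 0 a; rewrite -ball_normE.
move: sr; rewrite (side_alcove Ay Ww vr) !affactE.
have := cl ((lin w)^-1%g r.1.1); have := cl ((lin w)^-1%g r.1.2).
rewrite !ltr_norml => /andP[h1 h2] /andP[h3 h4].
by move: h1 h2 h3 h4; rewrite /e !affactE; lra.
Qed.

Lemma closure_sideN w r x : Wext w -> valid r -> ~~ side w r ->
  closure (base_alcove R m) x ->
  r.2%:~R <= affact w x 0 r.1.1 - affact w x 0 r.1.2.
Proof.
move=> Ww vr sr cx; have [it _ _] := valid_neq vr.
have := @closure_side w (flipr r) x Ww; rewrite valid_flip side_flip // => /(_ vr sr cx) /=.
by rewrite intrN; lra.
Qed.

(** A fixed point in the closed alcove lies in the closures of A and of w A, hence weakly on both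
    sides. *)
Lemma sep_on_hyp w r x : Wext w -> valid r -> sep w r ->
  closure (base_alcove R m) x -> affact w x = x -> in_Xstar x -> on_hyp r x.
Proof.
move=> Ww vr; rewrite /sep => srw cx wx Xx; split=> //; apply/eqP; rewrite eq_le.
have W1 := Wext1 m; have x1 := affact1 x.
case sw: (side w r) srw; case s1: (side 1%g r) => // _.
  have := closure_side Ww vr sw cx; rewrite wx => ->.
  by have := closure_sideN W1 vr (negbT s1) cx; rewrite x1.
have := closure_side W1 vr s1 cx; rewrite x1 => ->.
by have := closure_sideN Ww vr (negbT sw) cx; rewrite wx.
Qed.

Lemma convex_Xstar (e : R) x y : in_Xstar x -> in_Xstar y ->
  in_Xstar (x + e *: (y - x)).
Proof.
move=> Xx Xy a; rewrite !mxE; have := Xx a; have := Xy a; rewrite !mulr2n => Ey Ex.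
have -> : y 0 a = y 0 (mid m) + y 0 (mid m) - y 0 (rev_ord a) by rewrite -Ey addrK.
have -> : x 0 a = x 0 (mid m) + x 0 (mid m) - x 0 (rev_ord a) by rewrite -Ex addrK.
ring.
Qed.

(** Separation depends on the hyperplane as a set only. The segment from [p] to w p crosses the
    first hyperplane at an inner point [z], which also lies on the second; an affine function that
    vanishes at an inner point but at neither end changes sign. *)
Lemma sep_hyp_eq w r r' : Wext w -> valid r -> valid r' -> on_hyp r = on_hyp r' ->
  sep w r -> sep w r'.
Proof.
move=> Ww vr vr' E; have A0 := apt_alcove; have X0 := alcove_Xstar A0.
have Xw := affact_Xstar Ww X0; have W1 := Wext1 m.
rewrite /sep (side_alcove A0 Ww vr) (side_alcove A0 W1 vr).
rewrite (side_alcove A0 Ww vr') (side_alcove A0 W1 vr') affact1.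
have := side_alcoveN A0 Ww vr; have := side_alcoveN A0 W1 vr.
have := side_alcoveN A0 Ww vr'; have := side_alcoveN A0 W1 vr'.
rewrite (side_alcove A0 Ww vr) (side_alcove A0 W1 vr).
rewrite (side_alcove A0 Ww vr') (side_alcove A0 W1 vr') affact1.
set y := affact w apt in Xw *; set f := fun z : 'rV[R]_N => z 0 r.1.1 - z 0 r.1.2 - r.2%:~R.
set g := fun z : 'rV[R]_N => z 0 r'.1.1 - z 0 r'.1.2 - r'.2%:~R.
have fE z : (z 0 r.1.1 - z 0 r.1.2 < r.2%:~R) = (f z < 0) by rewrite subr_lt0.
have fE' z : (r.2%:~R < z 0 r.1.1 - z 0 r.1.2) = (0 < f z) by rewrite subr_gt0.
have gE z : (z 0 r'.1.1 - z 0 r'.1.2 < r'.2%:~R) = (g z < 0) by rewrite subr_lt0.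
have gE' z : (r'.2%:~R < z 0 r'.1.1 - z 0 r'.1.2) = (0 < g z) by rewrite subr_gt0.
rewrite !fE !fE' !gE !gE' => g0 g1 f0 f1 fs.
have f01 : 0 < f apt * (f apt - f y) /\ 0 < - f y * (f apt - f y).
  move: f0 f1 fs; case: (ltP (f apt) 0) => h0; case: (ltP (f y) 0) => h1 //= /esym h2 /esym h3 _.
    by split; [rewrite nmulr_rgt0 | rewrite nmulr_rgt0 ?oppr_lt0]; lra.
  by split; rewrite pmulr_rgt0; lra.
have fne : f apt - f y != 0.
  by case: f01 => h _; apply: contraTneq h => ->; rewrite mulr0 ltxx.
pose e := f apt / (f apt - f y); pose z := apt + e *: (y - apt).
have e01 : 0 < e < 1.
  have eE : e = f apt * (f apt - f y) / (f apt - f y) ^+ 2 by rewrite /e; field.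
  have e1E : 1 - e = - f y * (f apt - f y) / (f apt - f y) ^+ 2 by rewrite /e; field.
  have s0 : 0 < (f apt - f y) ^+ 2 by rewrite exprn_even_gt0.
  case: f01 => h1 h2; rewrite -(subr_gt0 e 1) e1E eE; apply/andP.
  by split; apply: divr_gt0.
have lin_z (F : 'rV[R]_N -> R) i j (c : R) : (F = fun z => z 0 i - z 0 j - c) ->
    F z = (1 - e) * F apt + e * F y by move=> ->; rewrite /z !mxE; ring.
have fz : f z = 0 by rewrite (lin_z f _ _ _ erefl) /e; field.
have gz : g z = 0.
  have [_] : on_hyp r' z; last by rewrite /g => ->; rewrite subrr.
  by rewrite -E; split; [exact: convex_Xstar | apply/eqP; rewrite -subr_eq0 -/(f z) fz].
move: gz; rewrite (lin_z g _ _ _ erefl) => gz.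
move: g0 g1; case: (ltP (g apt) 0) => h0; case: (ltP (g y) 0) => h1 //= /esym h2 /esym h3.
  have : (1 - e) * g apt < 0 by case/andP: e01 => e0 e1; rewrite pmulr_rlt0 //; lra.
  have : e * g y < 0 by case/andP: e01 => e0 e1; rewrite pmulr_rlt0.
  by lra.
have : 0 < (1 - e) * g apt by case/andP: e01 => e0 e1; rewrite pmulr_rgt0 -?h2 //; lra.
have : 0 < e * g y by case/andP: e01 => e0 e1; rewrite pmulr_rgt0 -?h3.
by lra.
Qed.

Lemma Waff_sep w : Waff w -> w != 1%g -> exists2 r, valid r & sep w r.
Proof.
move=> Ww w1; apply: contrapT => h; case/eqP: w1; apply: (noninv_Waff m_gt0 Ww) => r vr.
by apply/negP => s; apply: h; exists r.
Qed.

(** The point of the wall on no other hyperplane shows that s and t are each separated from 1 by H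
    alone. By the cocycle rule nothing separates t s, and [noninv_Waff] applies. *)
Lemma wall_fix_eq H s t : wall H -> Waff s -> Waff t -> s != 1%g -> t != 1%g ->
  (forall x, H x -> affact s x = x) -> (forall x, H x -> affact t x = x) -> (t * s)%g = 1%g.
Proof.
move=> [rH [x0 [cx0 Hx0 uH]]] Ws Wt s1 t1 fs ft.
have Xx0 : in_Xstar x0 by case: (root_hyperplane_on_hyp rH) Hx0 => r _ -> [].
have key w r : Waff w -> (forall x, H x -> affact w x = x) -> valid r -> sep w r -> on_hyp r = H.
  move=> Ww fw vr sr; apply: uH; first exact: on_hyp_root_hyperplane.
  by apply: (sep_on_hyp (Waff_ext Ww) vr sr cx0 (fw _ Hx0)).
have key2 w r : Waff w -> w != 1%g -> (forall x, H x -> affact w x = x) -> valid r ->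
    on_hyp r = H -> sep w r.
  move=> Ww w1 fw vr E; have [r' vr' sr'] := Waff_sep Ww w1.
  by apply: (sep_hyp_eq (Waff_ext Ww) vr' vr) => //; rewrite E; apply: (key w).
apply: (noninv_Waff m_gt0); first exact: WaffM.
move=> r vr.
have Wt' := Waff_ext Wt.
have vr' : valid (ract t^-1%g r) by apply: valid_ract => //; exact: WextV.
rewrite -(ractKV t r) sep_mul ractKV.
have onE : on_hyp r = H <-> on_hyp (ract t^-1%g r) = H.
  have ftV x : H x -> affact t^-1%g x = x by move=> Hx; rewrite -{1}(ft x Hx) affactK.
  split=> E; apply/seteqP; split=> y Hy.
  - have := on_hyp_ract Wt' Hy; rewrite ractKV E => Hty.
    by rewrite -[y](affactK t) ftV.
  - by rewrite -(ftV y Hy); apply: on_hyp_ract; [exact: WextV | rewrite E].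
  - have := on_hyp_ract (WextV Wt') Hy; rewrite E => Hty.
    by rewrite -[y](affactKV t) ft.
  by rewrite -(ft y Hy) -(ractKV t r); apply: on_hyp_ract; rewrite ?E.
case st: (sep t r).
  by rewrite (key2 s) //; apply/onE/(key t).
apply: contraFN st => ss; apply: (key2 t) => //; apply/onE; exact: (key s).
Qed.

Lemma refl_neq1 r : valid r -> refl r != 1%g.
Proof.
by move=> vr; apply: contraTneq (sep_refl_self vr) => ->; rewrite /sep eqxx.
Qed.

Lemma refl_wall_eq H s r : wall H -> Waff s -> s != 1%g -> (forall x, H x -> affact s x = x) ->
  valid r -> on_hyp r = H -> refl r = s.
Proof.
move=> wH Ws s1 fs vr E.
have fr x : H x -> affact (refl r) x = x by rewrite -E; exact: refl_fix.
have := wall_fix_eq wH Ws (refl_Waff vr) s1 (refl_neq1 vr) fs fr.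
by move=> /(congr1 (fun g => refl r * g)%g); rewrite mulgA refl_invol // mul1g mulg1.
Qed.

Lemma simple_refl_root s : simple_refl R m s -> exists2 r, valid r & s = refl r.
Proof.
case=> Ws s1 [H [wH fs]]; have [r vr E] := root_hyperplane_on_hyp wH.1.
by exists r => //; rewrite (refl_wall_eq wH Ws s1 fs vr) // E.
Qed.

(** The inversion set of a simple reflection is its own wall; the exchange condition and the lifting
    property both rest on this. *)
Lemma simple_refl_sep s r : simple_refl R m s -> valid r -> sep s r -> refl r = s.
Proof.
case=> Ws s1 [H [wH fs]] vr sr; have [rH [x0 [cx0 Hx0 uH]]] := wH.
have Xx0 : in_Xstar x0 by case: (root_hyperplane_on_hyp rH) Hx0 => r' _ -> [].
apply: (refl_wall_eq wH) => //; apply: uH; first exact: on_hyp_root_hyperplane.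
by apply: (sep_on_hyp (Waff_ext Ws) vr sr cx0 (fs _ Hx0)).
Qed.

(* 2N times the coordinates of the midpoint of apt and its mirror image in r. *)
Definition mirror_mid r (a : 'I_N) : int :=
  2 * a%:Z + rv r.1.1 r.1.2 a * (NZ * r.2 - (r.1.1%:Z - r.1.2%:Z)).

Lemma rv_nat r a : rv r.1.1 r.1.2 a = if (a == r.1.1 :> nat) then 1 else
  if (a == r.1.2 :> nat) then -1 else if (a + r.1.1 == m.*2)%N then -1 else
  if (a + r.1.2 == m.*2)%N then 1 else 0.
Proof.
have E b : (a == rev_ord b) = (a + b == m.*2)%N.
  by rewrite -val_eqE /=; have := ltn_ord b; case: eqP; case: eqP => //; lia.
by rewrite /rv !E.
Qed.

(* The cases are the walls x_k = x_(k+1), x_(m-1) = x_(m+1), and the affine wall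
   for m = 1 and for m > 1. *)
Definition mirror_vals (k a : nat) (v : int) (c : nat) : Prop :=
  match c with
  | 0 => ((a = k \/ a = k.+1) /\ v = 2 * k%:Z + 1) \/
     ((a + k = m.*2 \/ a + k.+1 = m.*2)%N /\ v = 4 * m%:Z - 2 * k%:Z - 1) \/
     (a <> k /\ a <> k.+1 /\ (a + k <> m.*2)%N /\ (a + k.+1 <> m.*2)%N /\ v = 2 * a%:Z)
  | 1 => ((a.+1 = m \/ a = m.+1) /\ v = 2 * m%:Z) \/ (a.+1 <> m /\ a <> m.+1 /\ v = 2 * a%:Z)
  | 2 => (a = 0%N /\ v = -4) \/ (a = 1%N /\ v = 2) \/ (a = 2%N /\ v = 8)
  | _ => (a = 0%N /\ v = -2) \/ (a = 1%N /\ v = 0) \/ (a = m.*2.-1 /\ v = 4 * m%:Z) \/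
     (a = m.*2 /\ v = 4 * m%:Z + 2) \/ ((1 < a < m.*2.-1)%N /\ v = 2 * a%:Z)
  end.

Lemma baseP r : base r -> exists c : nat, [/\
  forall a, mirror_vals r.1.1 a (mirror_mid r a) c &
  match c with
  | 0 => [/\ (r.1.1.+1 = r.1.2 :> nat)%N, (r.1.2 < m)%N & r.2 = 0]
  | 1 => [/\ r.1.1.+1 = m, r.1.2 = m.+1 :> nat & r.2 = 0]
  | 2 => [/\ m = 1%N, r.1.1 = 2%N :> nat, r.1.2 = 0%N :> nat & r.2 = 2]
  | _ => [/\ (1 < m)%N, r.1.1 = m.*2 :> nat, r.1.2 = 1%N :> nat & r.2 = 1]
  end].
Proof.
move=> /andP[_ h].
have [c H] : exists c : nat, match c with
  | 0 => [/\ (r.1.1.+1 = r.1.2 :> nat)%N, (r.1.2 < m)%N & r.2 = 0]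
  | 1 => [/\ r.1.1.+1 = m, r.1.2 = m.+1 :> nat & r.2 = 0]
  | 2 => [/\ m = 1%N, r.1.1 = 2%N :> nat, r.1.2 = 0%N :> nat & r.2 = 2]
  | _ => [/\ (1 < m)%N, r.1.1 = m.*2 :> nat, r.1.2 = 1%N :> nat & r.2 = 1]
  end.
  case/or3P: h => [/and3P[/eqP h1 h2 /eqP h3]|/and3P[/eqP h1 /eqP h2 /eqP h3]|].
  - by exists 0%N.
  - by exists 1%N.
  case: ifP => [/eqP m1|/eqP m1] /and3P[/eqP h1 /eqP h2 /eqP h3]; first by exists 2%N.
  by exists 3%N; split=> //; lia.
exists c; split=> // a; rewrite /mirror_mid rv_nat /mirror_vals.
move: H (ltn_ord a) (ltn_ord r.1.1) (ltn_ord r.1.2).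
move: (nat_of_ord a) (nat_of_ord r.1.1) (nat_of_ord r.1.2) r.2 => {}a k l D.
clear -m_gt0; case: c => [|[|[|_]]].
- case=> <- lm -> aN _ _; rewrite mulr0 sub0r.
  case: (eqVneq a k) => [|?]; first by lia.
  case: (eqVneq a k.+1) => [|?]; first by lia.
  case: (eqVneq (a + k)%N _) => [|?]; first by lia.
  by case: (eqVneq (a + k.+1)%N _); lia.
- case=> km -> -> aN _ _; rewrite mulr0 sub0r.
  case: (eqVneq a k) => [|?]; first by lia.
  case: (eqVneq a m.+1) => [|?]; first by lia.
  case: (eqVneq (a + k)%N _) => [|?]; first by lia.
  by case: (eqVneq (a + m.+1)%N _); lia.
- case=> -> -> -> -> aN _ _.
  by case: a aN => [|[|[|//]]] _ //=; lia.
case=> m1 -> -> -> aN _ _; rewrite mulr1.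
case: (eqVneq a _) => [|?]; first by lia.
case: (eqVneq a _) => [|?]; first by lia.
case: (eqVneq (a + m.*2)%N _) => [|?]; first by lia.
by case: (eqVneq (a + 1)%N _); lia.
Qed.

Lemma mirror_vals0 (k a b : nat) (v1 v2 : int) : (k.+1 < m)%N -> (a < N)%N -> (b < N)%N ->
  a != b -> a != m -> b != m -> mirror_vals k a v1 0 -> mirror_vals k b v2 0 -> v1 = v2 ->
  [\/ a = k /\ b = k.+1, a = k.+1 /\ b = k, (a + k.+1 = m.*2 /\ b + k = m.*2)%N |
    (a + k = m.*2 /\ b + k.+1 = m.*2)%N].
Proof.
move=> /= *; suff : (a = k /\ b = k.+1) \/ (a = k.+1 /\ b = k) \/
    (a + k.+1 = m.*2 /\ b + k = m.*2)%N \/ (a + k = m.*2 /\ b + k.+1 = m.*2)%N.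
  by case=> [|[|[|]]] ?; [constructor 1|constructor 2|constructor 3|constructor 4].
lia.
Qed.

Lemma mirror_vals1 (a b : nat) (v1 v2 : int) : (a < N)%N -> (b < N)%N -> a != b -> a != m -> b != m ->
  mirror_vals 0 a v1 1 -> mirror_vals 0 b v2 1 -> v1 = v2 ->
  (a.+1 = m /\ b = m.+1) \/ (a = m.+1 /\ b.+1 = m).
Proof. by rewrite /mirror_vals => *; lia. Qed.

Lemma mirror_vals2 (a b : nat) (v1 v2 : int) : m = 1%N -> (a < N)%N -> (b < N)%N -> a != b -> a != m ->
  b != m -> mirror_vals 0 a v1 2 -> mirror_vals 0 b v2 2 ->
  (a = 2%N /\ b = 0%N /\ v1 - v2 = 12) \/ (a = 0%N /\ b = 2%N /\ v1 - v2 = -12).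
Proof. by rewrite /mirror_vals => *; lia. Qed.

Lemma mirror_vals3 (a b : nat) (v1 v2 : int) : (1 < m)%N -> (a < N)%N -> (b < N)%N -> a != b -> a != m ->
  b != m -> mirror_vals 0 a v1 3 -> mirror_vals 0 b v2 3 -> v1 - v2 = 2 * NZ ->
  (a = m.*2 /\ b = 1%N) \/ (a.+1 = m.*2 /\ b = 0%N).
Proof. by rewrite /mirror_vals => *; lia. Qed.

Lemma mirror_vals3_neq (a b : nat) (v1 v2 : int) : (1 < m)%N -> (a < N)%N -> (b < N)%N -> a != b ->
  a != m -> b != m -> mirror_vals 0 a v1 3 -> mirror_vals 0 b v2 3 -> v1 <> v2.
Proof. by rewrite /mirror_vals => *; lia. Qed.

Lemma mirror_vals_range (k a : nat) (v : int) (c : nat) : (k <= m.*2)%N -> mirror_vals k a v c -> (a < N)%N ->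
  match c with | 0 => (k.+1 < m)%N ==> (0 <= v <= 4 * m%:Z) | 1 => 0 <= v <= 4 * m%:Z
    | 2 => true | _ => (1 < m)%N ==> (-2 <= v <= 4 * m%:Z + 2) end.
Proof. by rewrite /mirror_vals; case: c => [|[|[|c]]] *; lia. Qed.

(** The midpoint of [p] and its mirror image is the foot of the perpendicular from [p] to the wall;
    that it satisfies the weak inequalities of the alcove is checked type against type. *)
Lemma mirror_mid_base r r' : base r -> base r' ->
  mirror_mid r r'.1.1 - mirror_mid r r'.1.2 <= 2 * (NZ * r'.2).
Proof.
move=> /baseP[c [/[dup] /(_ r'.1.1) V1 /(_ r'.1.2) V2 H]] /baseP[c' [_ H']].
move: V1 V2 H H'.
move: (mirror_mid _ r'.1.1) (mirror_mid _ r'.1.2) (nat_of_ord r'.1.1) (nat_of_ord r'.1.2).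
move: (nat_of_ord r.1.1) (nat_of_ord r.1.2) r.2 r'.2 => k l D D' v1 v2 k' l'.
clear -m_gt0; case: c => [|[|[|c]]]; rewrite /mirror_vals => V1 V2.
- case=> h1 h2 _; case: c' => [|[|[|_]]].
  + by case=> h3 h4 h5; rewrite h5; lia.
  + by case=> h3 h4 h5; rewrite h5; lia.
  + by case=> h3 h4 h5 h6; rewrite h6; lia.
  by case=> h3 h4 h5 h6; rewrite h6; lia.
- case=> h1 h2 _; case: c' => [|[|[|_]]].
  + by case=> h3 h4 h5; rewrite h5; lia.
  + by case=> h3 h4 h5; rewrite h5; lia.
  + by case=> h3 h4 h5 h6; rewrite h6; lia.
  by case=> h3 h4 h5 h6; rewrite h6; lia.
- case=> h1 h2 _ _; case: c' => [|[|[|_]]].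
  + by case=> h3 h4 h5; rewrite h5; lia.
  + by case=> h3 h4 h5; rewrite h5; lia.
  + by case=> h3 h4 h5 h6; rewrite h6; lia.
  by case=> h3 h4 h5 h6; rewrite h6; lia.
case=> h1 h2 _ _; case: c' => [|[|[|_]]].
+ by case=> h3 h4 h5; rewrite h5; lia.
+ by case=> h3 h4 h5; rewrite h5; lia.
+ by case=> h3 h4 h5 h6; rewrite h6; lia.
by case=> h3 h4 h5 h6; rewrite h6; lia.
Qed.

(** The foot is generic on its wall. The four alternatives are the four names of one hyperplane,
    obtained by reversing the orientation and by passing to mirror indices. *)
Lemma mirror_mid_on r r' : base r -> valid r' ->
  mirror_mid r r'.1.1 - mirror_mid r r'.1.2 = 2 * (NZ * r'.2) ->
  [\/ [/\ r'.1.1 = r.1.1, r'.1.2 = r.1.2 & r'.2 = r.2],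
    [/\ r'.1.1 = r.1.2, r'.1.2 = r.1.1 & r'.2 = - r.2],
    [/\ r'.1.1 = rev_ord r.1.2, r'.1.2 = rev_ord r.1.1 & r'.2 = r.2] |
    [/\ r'.1.1 = rev_ord r.1.1, r'.1.2 = rev_ord r.1.2 & r'.2 = - r.2]].
Proof.
move=> /baseP[c [/[dup] /(_ r'.1.1) V1 /(_ r'.1.2) V2 H]] vr' E.
have [ab am bm] := valid_neq vr'.
have oE (p q : 'I_N) : (p : nat) = q -> p = q by move=> h; apply: val_inj.
have oR (p q : 'I_N) : (p + q = m.*2)%N -> p = rev_ord q.
  by move=> h; apply: val_inj => /=; lia.
have {}am : (r'.1.1 : nat) != m by apply: contra am => /eqP h; apply/eqP/oE; rewrite mid_val.
have {}bm : (r'.1.2 : nat) != m by apply: contra bm => /eqP h; apply/eqP/oE; rewrite mid_val.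
have {}ab : (r'.1.1 : nat) != r'.1.2 by [].
suff : [\/ [/\ (r'.1.1 : nat) = r.1.1, (r'.1.2 : nat) = r.1.2 & r'.2 = r.2],
    [/\ (r'.1.1 : nat) = r.1.2, (r'.1.2 : nat) = r.1.1 & r'.2 = - r.2],
    [/\ (r'.1.1 + r.1.2 = m.*2)%N, (r'.1.2 + r.1.1 = m.*2)%N & r'.2 = r.2] |
    [/\ (r'.1.1 + r.1.1 = m.*2)%N, (r'.1.2 + r.1.2 = m.*2)%N & r'.2 = - r.2]].
  case=> [[/oE h1 /oE h2 h3]|[/oE h1 /oE h2 h3]|[/oR h1 /oR h2 h3]|[/oR h1 /oR h2 h3]].
  - by constructor 1.
  - by constructor 2.
  - by constructor 3.
  by constructor 4.
have aN := ltn_ord r'.1.1; have bN := ltn_ord r'.1.2.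
have k2 : (r.1.1 <= m.*2)%N by rewrite -ltnS ltn_ord.
have R1 := mirror_vals_range k2 V1 aN; have R2 := mirror_vals_range k2 V2 bN.
move: V1 V2 R1 R2 E; set v1 := mirror_mid _ _; set v2 := mirror_mid _ _ => V1 V2 R1 R2 E.
have big (e : int) : - e <= v1 - v2 <= e -> e < 2 * NZ -> r'.2 = 0.
  by move=> h1 h3; case: (ltrgtP r'.2 0) => // h; nia.
case: c H V1 V2 R1 R2 => [|[|[|c]]].
- move=> [h1 h2 h3] V1 V2; have km : (r.1.1.+1 < m)%N by rewrite h1.
  rewrite km => /= R1 R2; have D0 : r'.2 = 0 by apply: (big (4 * m%:Z)); lia.
  have {}E : v1 = v2 by move: E; rewrite D0; lia.
  have := mirror_vals0 km aN bN ab am bm V1 V2 E; rewrite h1 D0 h3 oppr0.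
  by case=> -[-> ->]; [constructor 1|constructor 2|constructor 3|constructor 4].
- move=> [h1 h2 h3] V1 V2 R1 R2; have D0 : r'.2 = 0 by apply: (big (4 * m%:Z)); lia.
  have {}E : v1 = v2 by move: E; rewrite D0; lia.
  have := mirror_vals1 aN bN ab am bm V1 V2 E; rewrite D0 h3 oppr0 h2.
  by case=> -[h4 h5]; [constructor 1|constructor 2]; split=> //; lia.
- move=> [h1 h2 h3 h4] V1 V2 _ _.
  have := mirror_vals2 h1 aN bN ab am bm V1 V2; rewrite h2 h3 h4 E.
  by case=> -[-> [-> h5]]; [constructor 1|constructor 2]; split=> //; clear -h1 h5; lia.
move=> [h1 h2 h3 h4] V1 V2; rewrite h1 /= => R1 R2; rewrite h2 h3 h4.
case: (ltrgtP r'.2 0) => h5.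
- have h6 : r'.2 = -1 by nia.
  have ba : (r'.1.2 : nat) != r'.1.1 by rewrite eq_sym.
  have := mirror_vals3 h1 bN aN ba bm am V2 V1.
  case=> [|[h7 h8]|[h7 h8]]; [by move: E; rewrite h6; lia | constructor 2 | constructor 4];
    split=> //; lia.
- have h6 : r'.2 = 1 by nia.
  have := mirror_vals3 h1 aN bN ab am bm V1 V2.
  case=> [|[h7 h8]|[h7 h8]]; [by move: E; rewrite h6; lia | constructor 1 | constructor 3];
    split=> //; lia.
by case: (mirror_vals3_neq h1 aN bN ab am bm V1 V2); move: E; rewrite h5; lia.
Qed.

Definition mirror_pt r : 'rV[R]_N := \row_a ((mirror_mid r a)%:~R / (N * 2)%:R).

Lemma mirror_pt_Xstar r : valid r -> in_Xstar (mirror_pt r).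
Proof.
move=> vr; have [it im tm] := valid_neq vr.
apply: (@Xstar_row _ (m.*2.*2)%:Z) => a; rewrite /mirror_mid rv_rev // rev_val.
by rewrite mulNr; have := ltn_ord a; move: (rv _ _ _ * _) => x; lia.
Qed.

Lemma mirror_pt_on r : valid r -> on_hyp r (mirror_pt r).
Proof.
move=> vr; split; first exact: mirror_pt_Xstar.
have [it im tm] := valid_neq vr.
rewrite !mxE -mulrBl -intrB; apply: (mulIf (lt0r_neq0 (_ : 0 < (N * 2)%:R))).
  by rewrite ltr0n.
rewrite divfK ?pnatr_eq0 // -[(N * 2)%:R]/((N * 2)%:Z%:~R) -intrM; congr (_%:~R).
by rewrite /mirror_mid /rv !eqxx [r.1.2 == r.1.1]eq_sym (negPf it); lia.
Qed.

Lemma segmentE x y (d : R) a : (x + d *: (y - x)) 0 a = x 0 a + d * (y 0 a - x 0 a).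
Proof. by rewrite !mxE. Qed.

Lemma alcove_closure x : in_Xstar x ->
  (forall r, base r -> x 0 r.1.1 - x 0 r.1.2 <= r.2%:~R) -> closure (base_alcove R m) x.
Proof.
move=> Xm Hx; have A0 := apt_alcove; have X0 := alcove_Xstar A0.
move=> B /nbhs_ballP[e /= e0 eB].
set S := \sum_a `|apt 0 a - x 0 a|.
have s0 : 0 <= S by apply: sumr_ge0.
(* A step of relative length [d] towards [apt] moves each coordinate by at most e S / (1 + S) < e;
   the summand 1 keeps the denominator positive. *)
pose d := Num.min 1 (e / (1 + S)).
have d0 : 0 < d by rewrite lt_min ltr01 divr_gt0 // ltr_wpDr.
have d1 : d <= 1 by rewrite ge_min lexx.
exists (x + d *: (apt - x)); split.
  apply: alcoveP; first exact: convex_Xstar.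
  move=> r' br'; rewrite !segmentE.
  have h1 : apt 0 r'.1.1 - apt 0 r'.1.2 < r'.2%:~R.
    by rewrite aptE lt_row; have := side1_base m_gt0 br'; rewrite /side !ht1; lia.
  have h2 := Hx _ br'.
  have h3 : d * (apt 0 r'.1.1 - apt 0 r'.1.2 - r'.2%:~R) < 0.
    by rewrite pmulr_rlt0 // subr_lt0.
  have h4 : (1 - d) * (x 0 r'.1.1 - x 0 r'.1.2 - r'.2%:~R) <= 0.
    by rewrite mulr_ge0_le0 ?subr_ge0 // subr_le0.
  by move: h3 h4; clear; lra.
apply: eB; split=> // i a; rewrite ord1 -ball_normE /= segmentE opprD addNKr normrN normrM.
rewrite (gtr0_norm d0).
have hS : `|apt 0 a - x 0 a| <= S.
  by rewrite /S (bigD1 a) //= lerDl sumr_ge0.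
apply: le_lt_trans (_ : e / (1 + S) * S < e).
  by apply: ler_pM => //; [exact: ltW | rewrite ge_min lexx orbT].
by rewrite mulrAC ltr_pdivrMr ?ltr_wpDr // ltr_pM2l // ltrDr.
Qed.

Lemma mirror_pt_closure r : base r -> closure (base_alcove R m) (mirror_pt r).
Proof.
move=> br; have /andP[vr _] := br; apply: alcove_closure; first exact: mirror_pt_Xstar.
move=> r' br'; rewrite leNgt; apply/negP; rewrite !mxE -mulrBl -intrB ltr_pdivlMr ?ltr0n //.
rewrite -[(N * 2)%:R]/((N * 2)%:Z%:~R) -intrM ltr_int.
by have := mirror_mid_base br br'; lia.
Qed.

Lemma on_hyp_flip r : on_hyp (flipr r) = on_hyp r.
Proof.
by apply/seteqP; split=> x [Xx E]; split=> //; move: E => /=; rewrite ?intrN; lra.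
Qed.

Lemma on_hyp_rev i j D : on_hyp (rev_ord j, rev_ord i, D) = on_hyp (i, j, D).
Proof.
have XE x a : in_Xstar x -> x 0 (rev_ord a) = x 0 (mid m) *+ 2 - x 0 a.
  by move=> /(_ a) <-; rewrite addrC addKr.
by apply/seteqP; split=> x [Xx E]; split=> //; move: E => /=; rewrite !XE //; lra.
Qed.

Lemma base_wall r : base r -> wall (on_hyp r).
Proof.
move=> br; have /andP[vr _] := br; split; first exact: on_hyp_root_hyperplane.
exists (mirror_pt r); split; [exact: mirror_pt_closure | exact: mirror_pt_on |].
move=> H' /root_hyperplane_on_hyp[r' vr' ->] [_].
rewrite !mxE -mulrBl -intrB => /(congr1 (fun z : R => z * (N * 2)%:R)).
rewrite divfK ?pnatr_eq0 // -[(N * 2)%:R]/((N * 2)%:Z%:~R) -intrM => /eqP.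
rewrite eqr_int => /eqP E; have {}E : mirror_mid r r'.1.1 - mirror_mid r r'.1.2 = 2 * (NZ * r'.2).
  by rewrite E; lia.
move: (mirror_mid_on br vr' E); rewrite -[on_hyp r]on_hyp_flip.
case: r r' {br vr vr' E} => [[i t] D] [[a b] D'] /=.
case=> -[-> -> ->]; rewrite /flipr /=.
- by rewrite -[RHS]on_hyp_flip /flipr /= opprK.
- by [].
- by rewrite on_hyp_rev -[RHS]on_hyp_flip /flipr /= opprK.
by rewrite on_hyp_rev.
Qed.

Lemma base_simple r : base r -> simple_refl R m (refl r).
Proof.
move=> br; have /andP[vr _] := br.
split; [exact: refl_Waff | exact: refl_neq1 |].
by exists (on_hyp r); split; [exact: base_wall | move=> x; exact: refl_fix].
Qed.

End Walls.

(** * The Bruhat order *)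

Section Bruhat.
Local Open Scope ring_scope.
Variables (R : realType) (m : nat).
Implicit Types (s t u v w x y z : affperm (dimB m)).
Implicit Types r : root m.
Local Notation N := (dimB m).
Local Notation simple := (simple_refl R m).
Local Notation len := (coxeter_length R m).
Local Notation elen := (ext_length R m).
Local Notation simples := (fun l : seq (affperm (dimB m)) => forall t, t \in l -> simple t).
Hypothesis m_gt0 : (0 < m)%N.

Lemma Waff_word w : Waff w -> exists n, is_word R m w n.
Proof.
suff H v : Wext v -> Waff v -> exists n, is_word R m v n.
  by move=> Ww; exact: H (Waff_ext Ww) Ww.
move: v; apply: (Wext_descent m_gt0) => {}w.
  move=> _ nw Ww; exists 0%N, [::]; split=> //.
  by rewrite big_nil (noninv_Waff m_gt0 Ww nw).
move=> r _ br _ IH Ww; have /andP[vr _] := br.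
have [n [l [ln ls E]]] := IH (WaffM (refl_Waff vr) Ww).
exists n.+1, (refl r :: l); split=> /=; first by rewrite ln.
  by move=> t; rewrite inE => /predU1P[->|/ls//]; exact: base_simple.
by rewrite big_cons -E mulgA refl_invol // mul1g.
Qed.

Lemma lenP w : Waff w -> is_word R m w (len w) /\ forall k, is_word R m w k -> (len w <= k)%N.
Proof.
move=> Ww; rewrite /coxeter_length; case: xgetP => [n _ //|]; have [n0 h0] := Waff_word Ww.
have ex : exists n, `[< is_word R m w n >] by exists n0; exact/asboolP.
case: (ex_minnP ex) => n /asboolP h1 h2 /(_ n) []; split=> // k hk.
by apply: h2; exact/asboolP.
Qed.

Lemma simple_invol s : simple s -> (s * s = 1)%g.
Proof. by case/(simple_refl_root m_gt0) => r vr ->; exact: refl_invol. Qed.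

(** The strong exchange condition. The hyperplane is pulled back letter by letter with the cocycle
    rule until a letter separates it; it is then the wall of this letter, and [refl r] the
    corresponding conjugate. *)
Lemma word_sep l r : simples l -> valid r -> sep (\prod_(t <- l) t)%g r ->
  exists l1 t l2, l = l1 ++ t :: l2 /\
    refl r = ((\prod_(t <- l1) t) * t * (\prod_(t <- l1) t)^-1)%g.
Proof.
elim: l r => [|t l IH] r ls vr; first by rewrite big_nil /sep eqxx.
rewrite big_cons -{1}[r](ractKV t) sep_mul ractKV.
have st : simple t by apply: ls; rewrite inE eqxx.
have Wt : Wext t by case: st => /Waff_ext.
have vr' : valid (ract t^-1%g r) by apply: valid_ract => //; exact: WextV.
case: (boolP (sep t r)) => [str _|_ /= h].
  exists [::], t, l; split=> //; rewrite big_nil invg1 mulg1 mul1g.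
  exact: (simple_refl_sep m_gt0 st).
have [|l1 [t' [l2 [El E]]]] := IH _ _ vr' h.
  by move=> t' lt'; apply: ls; rewrite inE lt' orbT.
exists (t :: l1), t', l2; split; first by rewrite El.
have := refl_ract Wt vr'; rewrite ractKV => ->; rewrite E big_cons invMg.
by rewrite !mulgA.
Qed.

(** Multiplying by the conjugate found in [word_sep] deletes one letter of a reduced word. *)
Lemma len_sep y r : Waff y -> valid r -> sep y r -> (len (refl r * y)%g < len y)%N.
Proof.
move=> Wy vr syr; have [[l [ln ls E]] _] := lenP Wy.
have [|l1 [t [l2 [El Er]]]] := word_sep ls vr; first by rewrite -E.
have Wr : Waff (refl r * y)%g by apply: WaffM => //; exact: refl_Waff.
have [_ mn] := lenP Wr; rewrite -ln El size_cat /= addnS ltnS -size_cat.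
have st : simple t by apply: ls; rewrite El mem_cat inE eqxx orbT.
apply: mn; exists (l1 ++ l2); split=> //.
  by move=> t' h; apply: ls; move: h; rewrite El !mem_cat inE; case: (t' \in l1) => //= ->; rewrite orbT.
rewrite Er E El !big_cat big_cons /= !mulgA -[in RHS](mulg1 (\prod_(t <- l1) t)%g).
by rewrite mulgKV -!mulgA (mulgA t) simple_invol // mul1g.
Qed.

Lemma len_nsep y r : Waff y -> valid r -> ~~ sep y r -> (len y < len (refl r * y)%g)%N.
Proof.
move=> Wy vr ns; have := @len_sep (refl r * y)%g r; rewrite mulgA refl_invol // mul1g.
by apply; rewrite ?sep_refl_mul //; apply: WaffM => //; exact: refl_Waff.
Qed.

Lemma coxeter_refl_root t : coxeter_refl R m t <-> exists2 r, valid r & t = refl r.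
Proof.
split=> [[u [s [Wu /(simple_refl_root m_gt0)[r vr ->] ->]]]|[r vr ->]].
  have Wu' := Waff_ext Wu.
  by exists (ract u r); [exact: valid_ract | rewrite refl_ract].
(* The exchange argument is applied to a word for [refl r] itself, which its own hyperplane
   separates from 1. *)
have [n [l [_ ls E]]] := Waff_word (refl_Waff vr).
have [|l1 [t' [l2 [El Er]]]] := word_sep ls vr; first by rewrite -E sep_refl_self.
exists (\prod_(t <- l1) t)%g, t'; split=> //; last first.
  by apply: ls; rewrite El mem_cat inE eqxx orbT.
have {}ls : simples l1 by move=> t1 h; apply: ls; rewrite El mem_cat h.
elim: l1 ls {El Er} => [|t1 l1 IH] ls; rewrite ?big_nil ?big_cons; first exact: Waff1.
apply: WaffM; first by have [] := ls t1 (mem_head t1 l1).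
by apply: IH => t2 h; apply: ls; rewrite inE h orbT.
Qed.

(** The working form of the Bruhat order: reflections act on the left and [sep] replaces the
    comparison of lengths. It makes sense on all of Wext without the decomposition x tau. *)
Inductive gle x : affperm (dimB m) -> Prop :=
| gle_refl : gle x x
| gle_step y r : gle x y -> valid r -> ~~ sep y r -> gle x (refl r * y)%g.

Lemma gle_Waff x y : Waff x -> gle x y -> Waff y.
Proof. by move=> Wx; elim=> // {}y r _ Wy vr _; apply: WaffM => //; exact: refl_Waff. Qed.

Lemma gle_Wext x y : Wext x -> gle x y -> Wext y.
Proof. by move=> Wx; elim=> // {}y r _ Wy vr _; apply: WextM => //; exact: refl_Wext. Qed.

Lemma gle_trans y x z : gle x y -> gle y z -> gle x z.
Proof. by move=> h; elim=> // {}z r _ IH vr ns; apply: gle_step. Qed.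

Lemma bruhat_affP x y : Waff x -> bruhat_aff R m x y <-> gle x y.
Proof.
move=> Wx; split.
  elim=> [|{}y t _ IH /coxeter_refl_root[r vr ->]]; first exact: gle_refl.
  have Wy := gle_Waff Wx IH; have Wy' := Waff_ext Wy.
  have vr' := valid_ract Wy' vr.
  have -> : (y * refl r)%g = (refl (ract y r) * y)%g by rewrite refl_ract // mulgKV.
  move=> ll; apply: gle_step => //; apply: contraTN ll => s.
  by rewrite -leqNgt; apply/ltnW/len_sep.
elim=> [|{}y r h IH vr ns]; first exact: bruhat_refl.
have Wy := gle_Waff Wx h; have Wy' := WextV (Waff_ext Wy).
have vr' := valid_ract Wy' vr.
have E : (refl r * y)%g = (y * refl (ract y^-1%g r))%g.
  by rewrite refl_ract // invgK !mulgA mulgV mul1g.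
rewrite E; apply: bruhat_step => //; first by apply/coxeter_refl_root; exists (ract y^-1%g r).
by rewrite -E; exact: len_nsep.
Qed.

Lemma Omega_Wext t : Omega R m t -> Wext t. Proof. by case. Qed.

Lemma sep_Omega x t r : Omega R m t -> valid r -> Wext x -> sep (x * t)%g r = sep x r.
Proof.
move=> Ot vr Wx; have Wt := Omega_Wext Ot; rewrite -{1}[r](ractKV x) sep_mul ractKV.
have /(noninv_Omega R m_gt0 Wt) nt := Ot.
by rewrite (negPf (nt _ (valid_ract (WextV Wx) vr))) addbF.
Qed.

Lemma ext_decomp w : Wext w -> exists x t, [/\ Waff x, Omega R m t & w = (x * t)%g].
Proof.
move: w; apply: (Wext_descent m_gt0) => w.
  move=> Ww nw; exists 1%g, w; split; [exact: Waff1| |by rewrite mul1g].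
  exact/noninv_Omega.
move=> r _ br _ [x [t [Wx Ot E]]]; have /andP[vr _] := br.
exists (refl r * x)%g, t; split=> //; first by apply: WaffM => //; exact: refl_Waff.
by rewrite -mulgA -E mulgA refl_invol // mul1g.
Qed.

Lemma ext_decomp_uniq x t x' t' : Waff x -> Waff x' -> Omega R m t -> Omega R m t' ->
  (x * t = x' * t')%g -> x = x'.
Proof.
move=> Wx Wx' Ot Ot' E; pose z := (x'^-1 * x)%g.
have Wz : Waff z by apply: WaffM => //; exact: WaffV.
suff -> : x = (x' * z)%g.
  rewrite (noninv_Waff m_gt0 Wz) ?mulg1 // => r vr.
  have := sep_Omega Ot vr (Waff_ext Wz).
  have -> : (z * t)%g = t' by rewrite /z -mulgA E mulKg.
  by move=> <-; have /(noninv_Omega R m_gt0 (Omega_Wext Ot')) := Ot'; apply.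
by rewrite /z mulKVg.
Qed.

Lemma ext_lengthE x t : Waff x -> Omega R m t -> elen (x * t)%g = len x.
Proof.
move=> Wx Ot; rewrite /ext_length; case: xgetP => [n _ [x' [t' [Wx' Ot' E ->]]]|].
  by rewrite (ext_decomp_uniq Wx Wx' Ot Ot' E).
by move=> /(_ (len x)) []; exists x, t.
Qed.

Lemma elen_nsep w r : Wext w -> valid r -> ~~ sep w r -> (elen w < elen (refl r * w)%g)%N.
Proof.
move=> Ww vr; have [x [t [Wx Ot ->]]] := ext_decomp Ww.
rewrite sep_Omega //; last exact: Waff_ext.
move=> s; rewrite mulgA !ext_lengthE //; first exact: len_nsep.
by apply: WaffM => //; exact: refl_Waff.
Qed.

Lemma bruhatP w w' : Wext w -> bruhat R m w w' <-> gle w w'.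
Proof.
move=> Ww; split.
  case=> x [x' [t [Wx Wx' Ot [-> -> /(bruhat_affP _ Wx) h]]]].
  elim: h => [|y r h IH vr ns]; first exact: gle_refl.
  rewrite -mulgA; apply: gle_step => //.
  by rewrite sep_Omega //; exact/Waff_ext/(gle_Waff Wx).
have [x [t [Wx Ot E]]] := ext_decomp Ww.
move=> h; suff [x' [Wx' -> h']] : exists x', [/\ Waff x', w' = (x' * t)%g & gle x x'].
  by exists x, x', t; split=> //; split=> //; exact/bruhat_affP.
elim: h => [|y r h [x' [Wx' -> h']] vr ns]; first by exists x; split=> //; exact: gle_refl.
exists (refl r * x')%g; split; [by apply: WaffM => //; exact: refl_Waff | by rewrite mulgA |].
by apply: gle_step => //; move: ns; rewrite sep_Omega //; exact/Waff_ext.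
Qed.

End Bruhat.

(** * Double cosets *)

Section DoubleCosets.
Local Open Scope ring_scope.
Variables (R : realType) (m : nat).
Implicit Types (s t u v w x y z : affperm (dimB m)).
Implicit Types (r : root m) (I J : {set 'I_m.+1}).
Implicit Types D : set (affperm (dimB m)).
Local Notation N := (dimB m).
Local Notation elen := (ext_length R m).
Hypothesis m_gt0 : (0 < m)%N.

Lemma Wfix_Wext I u : Wfix R m I u -> Wext u. Proof. by case=> /Waff_ext. Qed.

Lemma Wfix1 I : Wfix R m I 1%g.
Proof. by split=> [|k _]; [exact: Waff1 | exact: affact1]. Qed.

Lemma WfixM I u v : Wfix R m I u -> Wfix R m I v -> Wfix R m I (u * v)%g.
Proof.
move=> [Wu fu] [Wv fv]; split=> [|k kI]; first exact: WaffM.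
by rewrite affact_mul fv // fu.
Qed.

Lemma WfixV I u : Wfix R m I u -> Wfix R m I u^-1%g.
Proof.
move=> [Wu fu]; split=> [|k kI]; first exact: WaffV.
by rewrite -{1}(fu _ kI) affactK.
Qed.

Lemma avec_closure k : (k <= m)%N ->
  in_Xstar (avec R m k) /\ closure (base_alcove R m) (avec R m k).
Proof.
move=> km; have X : in_Xstar (avec R m k).
  move=> a; rewrite !mxE rev_val mid_val.
  have -> : (m < k)%N = false by lia.
  have -> : (m < N - k)%N by lia.
  have aN := ltn_ord a; case: (ltnP a k) => ak.
    have -> : (m.*2 - a < k)%N = false by lia.
    have -> : (m.*2 - a < N - k)%N = false by lia.
    by rewrite addNr mul0rn.
  case: (ltnP a (N - k)) => ak'.
    have -> : (m.*2 - a < k)%N = false by lia.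
    have -> : (m.*2 - a < N - k)%N by lia.
    by rewrite addr0 mul0rn.
  have -> : (m.*2 - a < k)%N by lia.
  by rewrite addrN mul0rn.
split=> //; apply: alcove_closure => // r /andP[_ br].
have h0 : (0 : R) < 2^-1 by rewrite invr_gt0 ltr0n.
have h1 : (2^-1 : R) + 2^-1 = 1 by rewrite -mulr2n -[2^-1 *+ 2]mulr_natr mulVf // pnatr_eq0.
have gap (a b : 'I_N) : avec R m k 0 a - avec R m k 0 b <= 1.
  by rewrite !mxE; do 4?case: ifP => _; lra.
have mono (a b : 'I_N) : (a < b)%N -> avec R m k 0 a - avec R m k 0 b <= 0.
  move=> ab; rewrite !mxE; have aN := ltn_ord b.
  case: (ltnP a k) => ak; first by do 2?case: ifP => _; lra.
  have -> : (b < k)%N = false by lia.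
  case: (ltnP a (N - k)) => ak'; first by case: ifP => _; lra.
  by have -> : (b < N - k)%N = false; [lia | rewrite subrr].
case/or3P: br => [/and3P[/eqP h2 h3 /eqP ->]|/and3P[/eqP h2 /eqP h3 /eqP ->]|].
- by apply: mono; rewrite -h2.
- by apply: mono; lia.
case: ifP => _ /and3P[_ _ /eqP ->]; last exact: gap.
by apply: le_trans (gap _ _) _; rewrite (ler_int _ 1).
Qed.

(** A wall separating A from u A contains every point of the closed alcove fixed by u, in particular
    the a_k concerned; the descent therefore never leaves the stabiliser. *)
Lemma Wfix_gen I (Q : affperm N -> Prop) : Q 1%g ->
  (forall u r, base r -> Wfix R m I (refl r) -> Wfix R m I u -> Q u -> Q (refl r * u)%g) ->
  forall u, Wfix R m I u -> Q u.
Proof.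
move=> Q1 QM u; suff H v : Wext v -> Wfix R m I v -> Q v.
  by move=> Wu; exact: H (Wfix_Wext Wu) Wu.
move: v; apply: (Wext_descent m_gt0) => {}u.
  by move=> _ nu [Wu _]; rewrite (noninv_Waff m_gt0 Wu nu).
move=> r Wu br su IH fu; have /andP[vr _] := br.
have fr : Wfix R m I (refl r).
  split=> [|k kI]; first exact: refl_Waff.
  have [X c] := avec_closure (ltn_ord k : (k <= m)%N).
  by apply: refl_fix => //; apply: (sep_on_hyp m_gt0 Wu) => //; exact: fu.2.
have -> : u = (refl r * (refl r * u))%g by rewrite mulgA refl_invol // mul1g.
have fru := WfixM fr fu.
by apply: QM => //; exact: IH.
Qed.

Lemma dcoset_ind I J (P : affperm N -> Prop) :
  (forall z r, Wext z -> base r -> Wfix R m J (refl r) -> P z -> P (refl r * z)%g) ->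
  (forall z r, Wext z -> base r -> Wfix R m I (refl r) -> P z -> P (z * refl r)%g) ->
  forall z u v, Wext z -> Wfix R m J u -> Wfix R m I v -> P z -> P (u * z * v)%g.
Proof.
move=> PJ PI z u v Wz fu fv Pz.
suff : forall z', Wext z' -> P z' -> P (z' * v)%g.
  apply; first by apply: WextM => //; exact: Wfix_Wext fu.
  move: u fu; apply: Wfix_gen => [|u r br fr fu Pu]; first by rewrite mul1g.
  by rewrite -mulgA; apply: PJ => //; apply: WextM => //; exact: Wfix_Wext fu.
move: v fv; apply: Wfix_gen => [z' _|v r br fr fv IH z' Wz' Pz']; first by rewrite mulg1.
rewrite mulgA; apply: IH; last exact: PI.
by apply: WextM => //; exact: Wfix_Wext fr.
Qed.

Definition gstep x y := exists2 r, valid r & y = (refl r * x)%g /\ ~~ sep x r.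

Lemma gleS x y z : gle x y -> gstep y z -> gle x z.
Proof. by move=> h [r vr [-> ns]]; exact: gle_step. Qed.

Lemma gle_gstep x y : gstep x y -> gle x y.
Proof. by apply: gleS; exact: gle_refl. Qed.

Lemma gstep_elen x y : Wext x -> gstep x y -> (elen x < elen y)%N.
Proof. by move=> Wx [r vr [-> ns]]; exact: elen_nsep. Qed.

(* The lifting property of the Bruhat order; phi is left or right multiplication
   by a simple reflection. *)
Definition lifting (phi : affperm N -> affperm N) :=
  [/\ involutive phi,
      forall x, Wext x -> Wext (phi x),
      forall x, Wext x -> gstep x (phi x) \/ gstep (phi x) x &
      forall x y, Wext x -> gstep x y -> y = phi x \/ gstep (phi x) (phi y)].

(** Conjugating the reflection of a step by a simple one keeps the step upward, unless the
    conjugated hyperplane is the simple wall; then the step is phi itself. *)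
Lemma lifting_l r : base r -> lifting (fun x => (refl r * x)%g).
Proof.
move=> br; have /andP[vr _] := br; have Wr := refl_Wext vr.
have inv : involutive (fun x => (refl r * x)%g).
  by move=> x; rewrite mulgA refl_invol // mul1g.
split=> // [x Wx|x Wx|x y Wx [r' vr' [-> ns]]]; first exact: WextM.
  case: (boolP (sep x r)) => s; [right | left]; exists r => //.
  by rewrite mulgA refl_invol // mul1g sep_refl_mul // s.
have vr'' := valid_ract Wr vr'.
case: (boolP (sep (refl r) (ract (refl r) r'))) => s.
  left; have := simple_refl_sep m_gt0 (base_simple R m_gt0 br) vr'' s.
  rewrite refl_ract // => /(congr1 (fun z => refl r * z * refl r)%g).
  by rewrite refl_inv // !mulgA refl_invol // !mul1g -!mulgA refl_invol // mulg1 => ->.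
right; exists (ract (refl r) r') => //; split; last by rewrite sep_mul (negPf s).
by rewrite refl_ract // refl_inv // !mulgA -[(_ * refl r * refl r)%g]mulgA refl_invol // mulg1.
Qed.

Lemma lifting_r r : base r -> lifting (fun x => (x * refl r)%g).
Proof.
move=> br; have /andP[vr _] := br; have Wr := refl_Wext vr.
have inv : involutive (fun x => (x * refl r)%g).
  by move=> x; rewrite -mulgA refl_invol // mulg1.
have E x : Wext x -> (x * refl r)%g = (refl (ract x r) * x)%g.
  by move=> Wx; rewrite refl_ract // mulgKV.
split=> // [x Wx|x Wx|x y Wx [r' vr' [-> ns]]]; first exact: WextM.
  have vr' := valid_ract Wx vr.
  case: (boolP (sep x (ract x r))) => s; [right | left]; exists (ract x r) => //.
    by rewrite E // mulgA refl_invol // mul1g sep_refl_mul // s.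
  by rewrite E.
have vr'' := valid_ract (WextV Wx) vr'.
case: (boolP (sep (refl r) (ract x^-1%g r'))) => s.
  left; have := simple_refl_sep m_gt0 (base_simple R m_gt0 br) vr'' s.
  by rewrite refl_ract ?invgK => [<-||]; rewrite ?mulgA ?mulgV ?mul1g //; exact: WextV.
right; exists r' => //; split; first by rewrite mulgA.
by rewrite -[r'](ractKV x) sep_mul ractKV negb_add (negPf ns) (negPf s).
Qed.

Section Lifting.
Variables (phi : affperm N -> affperm N) (lphi : lifting phi).

Lemma gle_lift_left x y : Wext x -> gle x y -> gle (phi x) y \/ gle (phi x) (phi y).
Proof.
move=> Wx; have [inv Wphi _ st] := lphi.
elim=> [|{}y r h IH vr ns]; first by right; exact: gle_refl.
have sy : gstep y (refl r * y)%g by exists r.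
case: IH => IH; first by left; apply: gleS IH sy.
case: (st _ _ (gle_Wext Wx h) sy) => [E|h']; first by left; rewrite E.
by right; apply: gleS IH h'.
Qed.

Lemma gle_lift_right x y : Wext x -> gle x y -> gle x (phi y) \/ gle (phi x) (phi y).
Proof.
move=> Wx; have [inv Wphi _ st] := lphi.
elim=> [|{}y r h IH vr ns]; first by right; exact: gle_refl.
have sy : gstep y (refl r * y)%g by exists r.
case: (st _ _ (gle_Wext Wx h) sy) => [E|h']; first by left; rewrite E inv.
by case: IH => IH; [left | right]; apply: gleS IH h'.
Qed.

Lemma gle_lift_min x y : Wext x -> (elen x <= elen (phi x))%N -> gle x y -> gle x (phi y).
Proof.
move=> Wx mx h; have [inv Wphi cmp _] := lphi.
case: (gle_lift_right Wx h) => // h'; apply: gle_trans h'; apply: gle_gstep.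
case: (cmp _ Wx) => // /gstep_elen h'; move: (h' (Wphi _ Wx)).
by rewrite ltnNge mx.
Qed.

End Lifting.

Lemma dcoset_Wext J I w x : Wext w -> dcoset R m J I w x -> Wext x.
Proof.
move=> Ww [u [v [fu fv ->]]]; have Wu := Wfix_Wext fu; have Wv := Wfix_Wext fv.
by apply: WextM => //; exact: WextM.
Qed.

Lemma dcoset_mull J I w x u : Wfix R m J u -> dcoset R m J I w x -> dcoset R m J I w (u * x)%g.
Proof.
by move=> fu [u' [v [fu' fv ->]]]; exists (u * u')%g, v; rewrite !mulgA; split=> //; exact: WfixM.
Qed.

Lemma dcoset_mulr J I w x v : Wfix R m I v -> dcoset R m J I w x -> dcoset R m J I w (x * v)%g.
Proof.
by move=> fv [u [v' [fu fv' ->]]]; exists u, (v' * v)%g; rewrite !mulgA; split=> //; exact: WfixM.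
Qed.

Lemma dcoset_conn J I w x y : dcoset R m J I w x -> dcoset R m J I w y ->
  exists u v, [/\ Wfix R m J u, Wfix R m I v & y = (u * x * v)%g].
Proof.
move=> [u [v [fu fv ->]]] [u' [v' [fu' fv' ->]]].
exists (u' * u^-1)%g, (v^-1 * v')%g; split; try by apply: WfixM => //; exact: WfixV.
by rewrite !mulgA mulgKV mulgK.
Qed.

Lemma min_length_ex D : (exists x, D x) -> exists x, min_length_in R m D x.
Proof.
move=> [x0 Dx0].
have ex : exists n, `[< exists2 x, D x & elen x = n >] by exists (elen x0); apply/asboolP; exists x0.
case: (ex_minnP ex) => n /asboolP[x Dx <-] mn; exists x; split=> // y Dy.
by apply: mn; apply/asboolP; exists y.
Qed.

(** First x is carried to a minimal representative, y following inside its double coset. Then y is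
    carried to its minimal representative with x0 kept fixed: by minimality no allowed phi lowers
    x0, so [gle_lift_min] applies. *)
Lemma bruhat_dcoset_intro J I w w' x y : Wext w -> Wext w' ->
  dcoset R m J I w x -> dcoset R m J I w' y -> gle x y ->
  bruhat_dcoset R m (dcoset R m J I w) (dcoset R m J I w').
Proof.
move=> Ww Ww' Dx Dy xy.
have [x0 [Dx0 mx0]] := min_length_ex (ex_intro (dcoset R m J I w) x Dx).
have [y0 [Dy0 my0]] := min_length_ex (ex_intro (dcoset R m J I w') y Dy).
have Wx0 := dcoset_Wext Ww Dx0.
exists x0, y0; split=> //; apply/(bruhatP _ m_gt0) => //.
have [y' Dy' x0y'] : exists2 y', dcoset R m J I w' y' & gle x0 y'.
  have [u [v [fu fv ->]]] := dcoset_conn Dx Dx0.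
  apply: (dcoset_ind (P := fun z => exists2 y', dcoset R m J I w' y' & gle z y') _ _
    (dcoset_Wext Ww Dx) fu fv (ex_intro2 _ _ y Dy xy)) => z r Wz br fr [y' Dy' zy'].
    case: (gle_lift_left (lifting_l br) Wz zy') => h; first by exists y'.
    by exists (refl r * y')%g => //; exact: dcoset_mull.
  case: (gle_lift_left (lifting_r br) Wz zy') => h; first by exists y'.
  by exists (y' * refl r)%g => //; exact: dcoset_mulr.
have [u [v [fu fv ->]]] := dcoset_conn Dy' Dy0.
have Wy' := dcoset_Wext Ww' Dy'.
apply: (dcoset_ind (P := gle x0) _ _ Wy' fu fv x0y') => z r Wz br fr.
  by apply: (gle_lift_min (lifting_l br)) => //; apply: mx0; exact: dcoset_mull.
by apply: (gle_lift_min (lifting_r br)) => //; apply: mx0; exact: dcoset_mulr.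
Qed.

End DoubleCosets.

(** * The vectors mu_k *)

Section Profiles.
Local Open Scope ring_scope.
Variable m : nat.
Implicit Types (i j t a b : 'I_(dimB m)) (u v w : affperm (dimB m)) (D k l : int).
Implicit Types (r : root m) (I J : {set 'I_m.+1}) (q : nat).
Local Notation N := (dimB m).
Local Notation NZ := ((dimB m)%:Z).

Definition om k a : int := omega m k 0 a.

(** [om k a] is the floor of (a - k) / N. Periodicity, duality and monotonicity in k follow from
    this. *)
Lemma om_bounds k a : NZ * om k a <= a%:Z - k < NZ * om k a + NZ.
Proof.
rewrite /om /omega mxE; have aN := ltn_ord a.
have := divz_eq k NZ; have := modz_ge0 k (isT : NZ != 0); have := ltz_pmod k (isT : 0 < NZ).
move: (modz k NZ) (divz k NZ) => c b h1 h2 h3; rewrite h3.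
by case: ifP => h4; rewrite ?mulrBr ?mulrN ?mulr1 ?mulr0; lia.
Qed.

Lemma NZ_le (x y : int) : NZ * x < NZ * y + NZ -> x <= y.
Proof. by move=> h; rewrite leNgt; apply/negP => xy; nia. Qed.

Lemma NZ_lt (x y : int) : NZ * x < NZ * y -> x < y.
Proof. by rewrite ltr_pM2l. Qed.

Lemma om_uniq k a (x : int) : NZ * x <= a%:Z - k < NZ * x + NZ -> om k a = x.
Proof.
move=> h; have h' := om_bounds k a; apply/eqP; rewrite eq_le.
by apply/andP; split; apply: NZ_le; move: h h'; move: (NZ * _) (NZ * _) => y z; lia.
Qed.

Lemma om_addN k a : om (k + NZ) a = om k a - 1.
Proof. by apply: om_uniq; have := om_bounds k a; rewrite mulrBr mulr1; lia. Qed.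

Lemma om_rev k a : om (- k) (rev_ord a) = - om k a.
Proof.
apply: om_uniq; have := om_bounds k a; rewrite mulrN rev_val; have := ltn_ord a.
by move: (NZ * _) => y; lia.
Qed.

Lemma om_anti k l a : k <= l -> om l a <= om k a.
Proof.
move=> kl; apply: NZ_le; have := om_bounds k a; have := om_bounds l a.
by move: (NZ * _) (NZ * _) => y z; lia.
Qed.

Lemma om_drop k l a : l <= k + NZ -> om k a - 1 <= om l a.
Proof. by move=> kl; have := om_anti a kl; rewrite om_addN. Qed.

(** Each parenthesis is a difference of floors at two numbers a fixed distance 2 k / N apart, so it
    takes at most two, adjacent, values. *)
Lemma om_gap k i t : `|(om k i - om (- k) i) - (om k t - om (- k) t)| <= 1.
Proof.
have := om_bounds k i; have := om_bounds (- k) i; have := om_bounds k t; have := om_bounds (- k) t.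
move=> h1 h2 h3 h4; rewrite ler_norml; apply/andP; split; rewrite -subr_ge0; apply: NZ_le;
  rewrite ?mulrDr ?mulrN ?mulr1 ?mulrBr mulr0;
  by move: h1 h2 h3 h4; move: (NZ * _) (NZ * _) (NZ * _) (NZ * _) => x y z z'; lia.
Qed.

(* gf w k is mu_k - 1, and Pf w k the image of omega_k minus 1. *)
Definition Pf w k a : int := trans w 0 a - 1 + om k ((lin w)^-1%g a).
Definition gf w k a : int := Pf w k a - om k a.

(** The value 1 is half the similitude factor of [mu]. It makes g odd, see [gf_rev], which is the
    duality required in (sp1). *)
Definition wt2 w := Wext w /\ trans w 0 (mid m) = 1.

Lemma muvecE w k a : muvec w k 0 a = gf w k a + 1.
Proof. by rewrite /muvec /gf /Pf /om !mxE intz; lia. Qed.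

Lemma wt2_Wext w : wt2 w -> Wext w. Proof. by case. Qed.

Lemma wt2_rev w a : wt2 w -> trans w 0 (rev_ord a) = 2 - trans w 0 a.
Proof. by case=> Ww w1; rewrite Wext_trans // w1. Qed.

Lemma Pf_rev w k a : wt2 w -> Pf w (- k) (rev_ord a) = - Pf w k a.
Proof.
by move=> w2; rewrite /Pf wt2_rev // Wext_linV ?om_rev; [ring | exact: wt2_Wext].
Qed.

Lemma gf_rev w k a : wt2 w -> gf w (- k) (rev_ord a) = - gf w k a.
Proof. by move=> w2; rewrite /gf Pf_rev // om_rev; ring. Qed.

Lemma gf_revN w k a : wt2 w -> gf w (- k) a = - gf w k (rev_ord a).
Proof. by move=> w2; rewrite -{1}[a]rev_ordK gf_rev. Qed.

Lemma Pf_addN w k a : Pf w (k + NZ) a = Pf w k a - 1.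
Proof. by rewrite /Pf om_addN; ring. Qed.

Lemma gf_addN w k a : gf w (k + NZ) a = gf w k a.
Proof. by rewrite /gf Pf_addN om_addN; ring. Qed.

Lemma Pf_anti w k l a : k <= l -> Pf w l a <= Pf w k a.
Proof. by move=> kl; rewrite lerD2l om_anti. Qed.

Lemma Pf_drop w k l a : l <= k + NZ -> Pf w k a - 1 <= Pf w l a.
Proof. by move=> kl; have := Pf_anti w a kl; rewrite Pf_addN. Qed.

(** Up to the constant 1, [Pf w k a] is the floor of (ht w a - k) / N; in k it drops by 1 once per
    period. *)
Lemma Pf_ht w k a : NZ * Pf w k a <= ht w a - NZ - k < NZ * Pf w k a + NZ.
Proof.
have := om_bounds k ((lin w)^-1%g a); rewrite /Pf /ht !mulrDr mulrN mulr1.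
by move: (NZ * _) (NZ * _) => x y; lia.
Qed.

(** The remainders of two floors differ by less than N, so a strict inequality at a single k already
    decides the side. *)
Lemma side_Pf w k i t D : Pf w k i - Pf w k t < D -> side w (i, t, D).
Proof.
have := Pf_ht w k i; have := Pf_ht w k t; rewrite /side /=.
move: (Pf w k i) (Pf w k t) => x y h1 h2 h.
have : NZ * (x - y + 1) <= NZ * D by rewrite ler_pM2l // lezD1.
rewrite mulrDr mulrBr mulr1; move: h1 h2.
by move: (NZ * x) (NZ * y) (NZ * D) => x' y' z; lia.
Qed.

Lemma side_Pf_le w k i t D : side w (i, t, D) -> Pf w k i - Pf w k t <= D.
Proof.
move=> h; have := Pf_ht w k i; have := Pf_ht w k t; move: h; rewrite /side /=.
move=> h1 h2 h3; apply: NZ_le; rewrite mulrBr.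
by move: h1 h2 h3; move: (NZ * _) (NZ * _) (NZ * _) => x y z; lia.
Qed.

Lemma Pf1 k a : Pf 1%g k a = om k a - 1.
Proof. by rewrite /Pf /= mxE invg1 perm1; ring. Qed.

Lemma side_om k i t D : om k i - om k t < D -> side 1%g (i, t, D).
Proof. by move=> h; apply: (@side_Pf _ k); rewrite !Pf1; lia. Qed.

Lemma side_om_le k i t D : side 1%g (i, t, D) -> om k i - om k t <= D.
Proof. by move=> /(side_Pf_le k); rewrite !Pf1; lia. Qed.

Lemma wt2_Waff u w : Waff u -> wt2 w -> wt2 (u * w)%g.
Proof.
move=> Wu [Ww w1]; have Wu' := Waff_ext Wu; split; first exact: WextM.
by rewrite trans_mul Waff_trans_mid // Wext_linVmid // w1.
Qed.

Lemma sum_gf w k : wt2 w -> \sum_a gf w k a = 0.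
Proof.
move=> w2; have E : \sum_a om k ((lin w)^-1%g a) = \sum_a om k a.
  by rewrite [RHS](reindex_perm (lin w)^-1%g).
have S0 : \sum_a (trans w 0 a - 1) + \sum_a (trans w 0 a - 1) = 0.
  rewrite {1}(reindex_inj rev_ord_inj) -big_split /= big1 // => a _.
  by rewrite wt2_rev //; ring.
rewrite sumrB big_split /= E addrK; move: S0; move: (\sum_a (_ - 1)) => x; lia.
Qed.

(* What the reflection in r adds to entry i and subtracts from entry t; by oddness
   it subtracts shift w r (- k) from entry i^* and adds it to entry t^*. *)
Definition shift w r k : int := r.2 - (Pf w k r.1.1 - Pf w k r.1.2).

Lemma Pf_refl w r k a : Pf (refl r * w)%g k a =
  rv r.1.1 r.1.2 a * r.2 + Pf w k ((lin (refl r))^-1%g a).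
Proof. by rewrite /Pf trans_mul lin_mul invMg permM trans_refl; ring. Qed.

Lemma gf_refl w r k a : wt2 w -> valid r -> gf (refl r * w)%g k a = gf w k a +
  (if a == r.1.1 then shift w r k else if a == r.1.2 then - shift w r k
   else if a == rev_ord r.1.1 then - shift w r (- k)
   else if a == rev_ord r.1.2 then shift w r (- k) else 0).
Proof.
move=> w2 vr; rewrite /gf Pf_refl lin_reflVE // /rv /rp /shift.
have E b : Pf w k (rev_ord b) = - Pf w (- k) b.
  by rewrite -Pf_rev // opprK.
case: (eqVneq a r.1.1) => [->|_]; first by ring.
case: (eqVneq a r.1.2) => [->|_]; first by ring.
case: (eqVneq a (rev_ord r.1.1)) => [->|_]; first by rewrite !E; ring.
case: (eqVneq a (rev_ord r.1.2)) => [->|_]; first by rewrite !E; ring.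
by ring.
Qed.

Lemma gf_refl_i w r k : wt2 w -> valid r ->
  gf (refl r * w)%g k r.1.1 = gf w k r.1.1 + shift w r k.
Proof. by move=> w2 vr; rewrite gf_refl // eqxx. Qed.

Lemma gf_refl_t w r k : wt2 w -> valid r ->
  gf (refl r * w)%g k r.1.2 = gf w k r.1.2 - shift w r k.
Proof.
by move=> w2 vr; have [it _ _] := valid_neq vr; rewrite gf_refl // eqxx eq_sym (negPf it).
Qed.

Lemma gf_refl_other w r k a : wt2 w -> valid r -> a != r.1.1 -> a != r.1.2 ->
  a != rev_ord r.1.1 -> a != rev_ord r.1.2 -> gf (refl r * w)%g k a = gf w k a.
Proof.
move=> w2 vr /negPf ai /negPf at_ /negPf ai' /negPf at'.
by rewrite gf_refl // ai at_ ai' at' addr0.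
Qed.

Lemma sum_quad i t (F : 'I_N -> int) : i != t -> i != mid m -> t != mid m ->
  (forall a, a != i -> a != t -> a != rev_ord i -> a != rev_ord t -> F a = 0) ->
  \sum_a F a = if t == rev_ord i then F i + F t
               else F i + F t + (F (rev_ord i) + F (rev_ord t)).
Proof.
move=> it im tm F0.
have i'i : rev_ord i != i by rewrite rev_eq_mid.
have t't : rev_ord t != t by rewrite rev_eq_mid.
rewrite (bigD1 i) //= (bigD1 t) 1?eq_sym //=.
case: (eqVneq t (rev_ord i)) => [E|ti'].
  rewrite big1 ?addr0 // => a /andP[ai at_].
  by rewrite F0 // ?E ?rev_ordK // -E.
have it' : i != rev_ord t by rewrite -rev_eq_sym eq_sym.
rewrite (bigD1 (rev_ord i)) /=; last by rewrite i'i eq_sym.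
rewrite (bigD1 (rev_ord t)) /=; last by rewrite t't eq_sym it' rev_eq eq_sym.
rewrite big1 => [|a /andP[/andP[/andP[ai at_] ai'] at']]; last exact: F0.
by ring.
Qed.

(* The number of entries 2 of mu_k. *)
Definition Uf w k : int := \sum_a (gf w k a == 1 : nat)%:Z.

Definition inK I k := exists2 k0 : 'I_m.+1, k0 \in I &
  ((NZ %| k - k0%:Z)%Z || (NZ %| k + k0%:Z)%Z).

Lemma inKN I k : inK I k -> inK I (- k).
Proof.
case=> k0 k0I h; exists k0 => //; rewrite orbC; move: h.
have -> : - k - k0%:Z = - (k + k0%:Z) by ring.
have -> : - k + k0%:Z = - (k - k0%:Z) by ring.
by rewrite !dvdzE !abszN.
Qed.

Lemma inK_addN I k : inK I k -> inK I (k + NZ).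
Proof.
case=> k0 k0I h; exists k0 => //; move: h; rewrite ![k + NZ + _]addrAC.
by rewrite !(rpredDr _ (dvdzz NZ)).
Qed.

Lemma inK_I I (k : 'I_m.+1) : k \in I -> inK I k%:Z.
Proof. by move=> kI; exists k => //; rewrite subrr dvdz0. Qed.

Definition selfdual w k := forall a, gf w k (rev_ord a) = - gf w k a.

(* For 0 <= k <= m the sum om k a + om k (rev_ord a) is odd exactly on A_k, so
   this is the failure of (sp3). *)
Definition bad q w k := [/\ selfdual w k, ~~ (2 %| Uf w k - q%:Z)%Z &
  forall a, gf w k a = 0 -> (2 %| om k a + om k (rev_ord a))%Z].

Definition good q I w := forall k, inK I k ->
  [/\ forall a, `|gf w k a| <= 1, Uf w k <= q%:Z & ~ bad q w k].

End Profiles.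

(** * Spin-permissibility is inherited downwards *)

Section Descent.
Local Open Scope ring_scope.
Variable m : nat.
Implicit Types (i j t a b : 'I_(dimB m)) (u v w : affperm (dimB m)) (D k l : int).
Implicit Types (r : root m) (I J : {set 'I_m.+1}) (q : nat).
Local Notation N := (dimB m).
Local Notation NZ := ((dimB m)%:Z).

Definition is1 (x : int) : int := (x == 1 : nat)%:Z.

(** Turns the count of ones into absolute values, to which convexity and parity apply. *)
Lemma is1E (x : int) : `|x| <= 1 -> 2 * is1 x = `|x| + x.
Proof.
move=> h; have : x = 1 \/ x = 0 \/ x = -1 by lia.
by case=> [|[|]] ->.
Qed.

Lemma is1NE (x : int) : `|x| <= 1 -> 2 * is1 (- x) = `|x| - x.
Proof. by move=> h; rewrite is1E ?normrN. Qed.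

Lemma Uf_refl w r k : wt2 w -> valid r ->
  Uf (refl r * w)%g k - Uf w k =
  let x := gf w k r.1.1 in let y := gf w k r.1.2 in let d := shift w r k in
  let x' := gf w (- k) r.1.1 in let y' := gf w (- k) r.1.2 in let d' := shift w r (- k) in
  if r.1.2 == rev_ord r.1.1 then is1 (x + d) - is1 x + (is1 (y - d) - is1 y)
  else is1 (x + d) - is1 x + (is1 (y - d) - is1 y) +
    (is1 (- (x' + d')) - is1 (- x') + (is1 (- (y' - d')) - is1 (- y'))).
Proof.
move=> w2 vr; have [it im tm] := valid_neq vr.
rewrite /Uf -sumrB (sum_quad it im tm) => [|a ai at_ ai' at']; last first.
  by rewrite gf_refl_other // subrr.
rewrite /= -!(gf_rev _ _ w2) -!gf_refl_i -?gf_refl_t //.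
have R b : - gf (refl r * w)%g (- k) b = gf (refl r * w)%g k (rev_ord b).
  rewrite gf_revN ?opprK //; exact: wt2_Waff (refl_Waff vr) w2.
by rewrite !R opprK.
Qed.

(** Let d be the shift and e its analogue for the identity; both are nonnegative by the side
    hypotheses. The entries x, y of g at i, t satisfy x - y = e - d, hence lie between y - d and x +
    d, and the sums agree: by convexity both the bound and [Uf] pass down. For (sp3), badness is
    passed up instead. *)
Lemma good_down_side q I w r : wt2 w -> valid r -> side w r -> side 1%g r ->
  good q I (refl r * w)%g -> good q I w.
Proof.
move=> w2 vr sw s1 gw'; have [it im tm] := valid_neq vr.
have w2' : wt2 (refl r * w)%g by apply: wt2_Waff (refl_Waff vr) w2.
pose e k := r.2 - (om k r.1.1 - om k r.1.2).
have d0 k : 0 <= shift w r k.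
  by move: sw; rewrite subr_ge0; case: (r) => [[? ?] ?]; apply: side_Pf_le.
have e0 k : 0 <= e k.
  by move: s1; rewrite subr_ge0; case: (r) => [[? ?] ?]; apply: side_om_le.
have de k : gf w k r.1.1 - gf w k r.1.2 = e k - shift w r k.
  by rewrite /gf /e /shift; ring.
have bd k : inK I k -> [/\ `|gf w k r.1.1| <= 1, `|gf w k r.1.2| <= 1,
    `|gf w k r.1.1 + shift w r k| <= 1 & `|gf w k r.1.2 - shift w r k| <= 1].
  move=> /gw'[h _ _]; have := h r.1.1; have := h r.1.2.
  rewrite gf_refl_i // gf_refl_t // => h1 h2; have := d0 k; have := e0 k; have := de k.
  by move: h1 h2; rewrite !ler_norml => *; split; lia.
have b1 k a : inK I k -> `|gf w k a| <= 1.
  move=> kK; have [h1 h2 _ _] := bd _ kK; have [h3 h4 _ _] := bd _ (inKN kK).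
  have [->//|ai] := eqVneq a r.1.1; have [->//|at_] := eqVneq a r.1.2.
  have [->|ai'] := eqVneq a (rev_ord r.1.1); first by rewrite -normrN -gf_revN.
  have [->|at'] := eqVneq a (rev_ord r.1.2); first by rewrite -normrN -gf_revN.
  by have [h _ _] := gw' _ kK; have := h a; rewrite gf_refl_other.
move=> k kK; have kNK := inKN kK; have [_ U' nb'] := gw' _ kK.
have [x1 y1 xd1 yd1] := bd _ kK; have [x1' y1' xd1' yd1'] := bd _ kNK.
have UE := Uf_refl k w2 vr; split=> [a||]; first exact: b1.
- have pair (x y d c : int) : 0 <= d -> 0 <= c -> x - y = c - d ->
      `|x| <= 1 -> `|y| <= 1 -> `|x + d| <= 1 -> `|y - d| <= 1 ->
      0 <= is1 (x + d) - is1 x + (is1 (y - d) - is1 y) /\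
      0 <= is1 (- (x + d)) - is1 (- x) + (is1 (- (y - d)) - is1 (- y)).
    move=> dp cp E xb yb xdb ydb; have cvx : `|x| + `|y| <= `|x + d| + `|y - d|.
      by clear -dp cp E; lia.
    have := is1E xb; have := is1E yb; have := is1E xdb; have := is1E ydb.
    have := is1NE xb; have := is1NE yb; have := is1NE xdb; have := is1NE ydb.
    move: (is1 _) (is1 _) (is1 _) (is1 _) (is1 _) (is1 _) (is1 _) (is1 _) cvx.
    move: `|x| `|y| `|x + d| `|y - d|; clear.
    by move=> *; split; lia.
  have [p1 _] := pair _ _ _ _ (d0 k) (e0 k) (de k) x1 y1 xd1 yd1.
  have [_ p2] := pair _ _ _ _ (d0 (- k)) (e0 (- k)) (de (- k)) x1' y1' xd1' yd1'.
  apply: le_trans U'; rewrite -subr_ge0 UE /=; case: ifP => _ //.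
  exact: addr_ge0.
case=> sd od ob; apply: nb'.
have sd' a : gf w (- k) a = gf w k a by rewrite gf_revN // sd opprK.
have omN a : om (- k) a = - om k (rev_ord a) by rewrite -om_rev rev_ordK.
have gap := om_gap k r.1.1 r.1.2.
have ox : gf w k r.1.1 = 0 -> _ := ob r.1.1; have oy : gf w k r.1.2 = 0 -> _ := ob r.1.2.
have De := d0 k; have De' := d0 (- k); have ee := e0 k; have ee' := e0 (- k).
have c1 := de k; have c2 := de (- k).
rewrite !omN in gap; rewrite !sd' in c2 x1' y1' xd1' yd1' *.
have eE : e k = r.2 - (om k r.1.1 - om k r.1.2) by [].
have eE' : e (- k) = r.2 - (om k (rev_ord r.1.2) - om k (rev_ord r.1.1)).
  by rewrite /e !omN; ring.
(* If the two shifts differed, the bounds and the signs of d and e would force both entries to be 0.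
   Both om sums would then be even, although their difference is that of the shifts, which is 1 in
   absolute value by [om_gap]. *)
have eqd : shift w r (- k) = shift w r k.
  move: (e k) (e (- k)) De De' ee ee' c1 c2 eE eE' x1 y1 xd1 yd1 x1' y1' xd1' yd1' ox oy gap => c c'.
  move: (shift w r k) (shift w r (- k)) (gf w k r.1.1) (gf w k r.1.2) => d d' x y.
  move: (om k _) (om k _) (om k _) (om k _) r.2 => oi oi' ot ot' D.
  clear; rewrite !ler_norml => *; lia.
have g'N a : gf (refl r * w)%g (- k) a = gf (refl r * w)%g k a.
  by rewrite !gf_refl // opprK sd' eqd.
split.
- by move=> a; rewrite -(gf_rev k a w2') g'N.
(* [Uf] changes by |x + d| - |x| plus |y - d| - |y|, which is even. A mirror pair contributes one
   such term only; there d is even because [r.2] is and because a zero has an even om sum. *)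
- move: UE; rewrite eqd !sd' /=.
  have P1 := Pf_rev k r.1.1 w2.
  case: eqP => ti UE.
    have D2 : (2 %| r.2)%Z by case/and4P: vr => _ _ _ /implyP; apply; apply/eqP.
    have xy : gf w k r.1.2 = - gf w k r.1.1 by rewrite ti sd.
    have Od : om k r.1.2 = om k (rev_ord r.1.1) by rewrite ti.
    have E2 : 2 * (Uf (refl r * w)%g k - Uf w k) =
        2 * (`|gf w k r.1.1 + shift w r k| - `|gf w k r.1.1|).
      have h1 := is1E xd1; have h2 := is1E x1; have h3 := is1NE xd1; have h4 := is1NE x1.
      rewrite UE xy -opprD; move: h1 h2 h3 h4.
      by move: (is1 _) (is1 _) (is1 _) (is1 _) `|_ + _| `|_|; clear => *; lia.
    move: E2 od c1 eE ox De ee x1 xd1; rewrite xy Od.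
    move: (gf w k r.1.1) (shift w r k) (e k) (om k _) (om k _) r.2 D2 (Uf _ _) (Uf _ _).
    move=> x d c oi oi' D D2 V V'; clear -D2 => *; lia.
  have E2 : 2 * (Uf (refl r * w)%g k - Uf w k) =
      2 * (`|gf w k r.1.1 + shift w r k| - `|gf w k r.1.1| +
           (`|gf w k r.1.2 - shift w r k| - `|gf w k r.1.2|)).
    have h1 := is1E xd1; have h2 := is1E x1; have h3 := is1NE xd1; have h4 := is1NE x1.
    have h5 := is1E yd1; have h6 := is1E y1; have h7 := is1NE yd1; have h8 := is1NE y1.
    rewrite UE; move: h1 h2 h3 h4 h5 h6 h7 h8.
    move: (is1 _) (is1 _) (is1 _) (is1 _) (is1 _) (is1 _) (is1 _) (is1 _).
    by move: `|_ + _| `|_ - _| `|_| `|_|; clear => *; lia.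
  have := c1; move: E2 od.
  move: (gf w k r.1.1) (gf w k r.1.2) (shift w r k) (e k) (Uf _ _) (Uf _ _).
  move=> x y d c V V'; clear => *; lia.
have [oxy oyx] : (gf w k r.1.1 + shift w r k = 0 -> (2 %| om k r.1.1 + om k (rev_ord r.1.1))%Z) /\
    (gf w k r.1.2 - shift w r k = 0 -> (2 %| om k r.1.2 + om k (rev_ord r.1.2))%Z).
  rewrite eqd in c2.
  move: (e k) (e (- k)) De ee c1 c2 eE eE' x1 y1 xd1 yd1 ox oy gap => c c'.
  move: (shift w r k) (gf w k r.1.1) (gf w k r.1.2) => d x y.
  move: (om k _) (om k _) (om k _) (om k _) r.2 => oi oi' ot ot' D.
  clear; rewrite !ler_norml => *; split=> *; lia.
move=> a; rewrite gf_refl // eqd.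
case: (eqVneq a r.1.1) => [->|_]; first exact: oxy.
case: (eqVneq a r.1.2) => [->|_]; first exact: oyx.
case: (eqVneq a (rev_ord r.1.1)) => [->|_].
  by rewrite rev_ordK sd => h; rewrite addrC; apply: oxy; clear -h; lia.
case: (eqVneq a (rev_ord r.1.2)) => [->|_]; last by rewrite addr0; exact: ob.
by rewrite rev_ordK sd => h; rewrite addrC; apply: oyx; clear -h; lia.
Qed.

Lemma good_down q I w r : wt2 w -> valid r -> ~~ sep w r ->
  good q I (refl r * w)%g -> good q I w.
Proof.
move=> w2 vr; have [it _ _] := valid_neq vr; rewrite /sep negbK => /eqP E.
case s1 : (side 1%g r) E => sw; first exact: good_down_side.
rewrite -refl_flip //; apply: good_down_side => //; first by rewrite valid_flip.
  by rewrite side_flip // sw.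
by rewrite side_flip // s1.
Qed.

End Descent.

(** * Raising spin-permissible elements *)

Section Ascent.
Local Open Scope ring_scope.
Variable m : nat.
Implicit Types (i j t o x : 'I_(dimB m)) (a b c e k l n : int) (r : root m).
Local Notation N := (dimB m).
Local Notation NZ := ((dimB m)%:Z).

Definition cond q w k := [/\ forall o, `|gf w k o| <= 1, Uf w k <= (q : nat)%:Z & ~ bad q w k].

Lemma gf_addNn w k n o : gf w (k + NZ * n) o = gf w k o :> int.
Proof.
have S l : gf w (l + NZ) o = gf w l o by exact: gf_addN.
have nat_case (p : nat) l : gf w (l + NZ * p%:Z) o = gf w l o.
  elim: p => [|p IH]; first by rewrite mulr0 addr0.
  have -> : l + NZ * p.+1%:Z = l + NZ * p%:Z + NZ by rewrite intS; ring.
  by rewrite S.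
case: n => p; first exact: nat_case.
by rewrite -(nat_case p.+1 (k + _)) NegzE mulrN subrK.
Qed.

Lemma om_addNn k n o : om (k + NZ * n) o = om k o - n.
Proof. by apply: om_uniq; have := om_bounds k o; rewrite mulrBr; move: (NZ * _) (NZ * _) => y z; lia. Qed.

Lemma Pf_addNn w k n o : Pf w (k + NZ * n) o = Pf w k o - n.
Proof. by rewrite /Pf om_addNn; ring. Qed.

Lemma Uf_addNn (w : affperm N) k n : Uf w (k + NZ * n) = Uf w k.
Proof. by apply: eq_bigr => o _; rewrite gf_addNn. Qed.

(** The ones of g_(-k) mirror the entries -1 of g_k, and these are as many as its ones since g_k
    sums to 0. *)
Lemma UfN w k : wt2 w -> (forall o, `|gf w k o| <= 1) -> Uf w (- k) = Uf w k.
Proof.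
move=> w2 gb; rewrite /Uf (reindex_inj rev_ord_inj) /=.
under eq_bigr do rewrite gf_rev //.
apply/eqP; rewrite eq_sym -subr_eq0 -sumrB -[X in _ == X](sum_gf k w2); apply/eqP.
apply: eq_bigr => o _; have := gb o; move: (gf w k o) => y h.
by have : y = 1 \/ y = 0 \/ y = -1; [lia | case=> [|[|]] ->].
Qed.

Lemma bad_addNn q (w : affperm N) k n : bad q w (k + NZ * n) -> bad q w k.
Proof.
case=> h1 h2 h3; split=> [o||o].
- by have := h1 o; rewrite !gf_addNn.
- by rewrite Uf_addNn in h2.
by have := h3 o; rewrite gf_addNn !om_addNn => h /h; lia.
Qed.

Lemma badN q w k : wt2 w -> (forall o, `|gf w k o| <= 1) -> bad q w (- k) -> bad q w k.
Proof.
move=> w2 gb [h1 h2 h3]; split=> [o||o].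
- by have := h1 o; rewrite gf_rev // gf_revN // opprK => ->.
- by rewrite UfN in h2.
have := h3 (rev_ord o); rewrite gf_rev // om_rev => h E; move: h; rewrite E oppr0 => /(_ erefl).
by rewrite -{2}[o]rev_ordK om_rev rev_ordK; lia.
Qed.

Lemma cond_addNn q w k n : cond q w k -> cond q w (k + NZ * n).
Proof.
case=> h1 h2 h3; split=> [o||/bad_addNn//]; first by rewrite gf_addNn.
by rewrite Uf_addNn.
Qed.

Lemma condN q w k : wt2 w -> cond q w k -> cond q w (- k).
Proof.
move=> w2 [h1 h2 h3]; split=> [o||/(badN w2 h1)//]; first by rewrite gf_revN // normrN.
by rewrite UfN.
Qed.

Lemma inK_addNn (I : {set 'I_m.+1}) k n : inK I k -> inK I (k + NZ * n).
Proof.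
move=> kK; have nat_case (p : nat) l : inK I l -> inK I (l + NZ * p%:Z).
  move=> lK; elim: p => [|p IH]; first by rewrite mulr0 addr0.
  have -> : l + NZ * p.+1%:Z = l + NZ * p%:Z + NZ by rewrite intS; ring.
  exact: inK_addN.
case: n => p; first exact: nat_case.
have -> : k + NZ * Negz p = - (- k + NZ * p.+1%:Z) by rewrite NegzE; ring.
apply: inKN.
by apply: nat_case; exact: inKN.
Qed.

Variables (q : nat) (I : {set 'I_m.+1}) (w : affperm N).
Hypotheses (w2 : wt2 w) (gw : good q I w) (I0 : I != finset.set0).
Local Notation K := (inK I).
Local Notation g := (gf w).
Local Notation P := (Pf w).

Lemma inK_above k : exists2 l, K l & k < l <= k + NZ.
Proof.
have [k0 k0I] := set0Pn _ I0.
exists (k0%:Z + NZ * (((k - k0%:Z) %/ NZ)%Z + 1)); first exact/inK_addNn/inK_I.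
have := divz_eq (k - k0%:Z) NZ; have := modz_ge0 (k - k0%:Z) (isT : NZ != 0).
have := ltz_pmod (k - k0%:Z) (isT : 0 < NZ).
rewrite mulrDr mulr1 [(_ * NZ)%R]mulrC; move: (NZ * _) (modz _ _) => y z.
by move=> h1 h2 h3; apply/andP; split; lia.
Qed.

Lemma nxt_ex k : exists l, [/\ K l, k < l & forall y, K y -> k < y -> l <= y].
Proof.
have ex : exists d : nat, `[< K (k + d.+1%:Z) >].
  have [l lK /andP[kl _]] := inK_above k; exists (absz (l - k)).-1; apply/asboolP.
  by rewrite prednK; [rewrite (_ : k + _ = l) //; lia | lia].
case: (ex_minnP ex) => d /asboolP dK dm; exists (k + d.+1%:Z); split=> //; first by lia.
move=> y yK ky; have : `[< K (k + (absz (y - k)).-1.+1%:Z) >].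
  by apply/asboolP; rewrite prednK; [rewrite (_ : k + _ = y) //; lia | lia].
by move/dm; lia.
Qed.

(* Successor and predecessor in K; k itself need not lie in K. *)
Definition nxt k : int := projT1 (cid (nxt_ex k)).
Definition prv k : int := - nxt (- k).

Lemma nxtK k : K (nxt k). Proof. by rewrite /nxt; case: cid => l []. Qed.
Lemma nxt_gt k : k < nxt k. Proof. by rewrite /nxt; case: cid => l []. Qed.
Lemma nxt_min k l : K l -> k < l -> nxt k <= l.
Proof. by rewrite /nxt; case: cid => y [_ _ h] /=; exact: h. Qed.
Lemma prvK k : K (prv k). Proof. exact/inKN/nxtK. Qed.
Lemma prv_lt k : prv k < k. Proof. by rewrite ltrNl nxt_gt. Qed.
Lemma prv_max k l : K l -> l < k -> l <= prv k.
Proof. by move=> lK lk; rewrite lerNr; apply: nxt_min; [exact: inKN | rewrite ltrN2]. Qed.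

Lemma nxt_le k : nxt k <= k + NZ.
Proof. by have [l lK /andP[kl]] := inK_above k; apply: le_trans; exact: nxt_min. Qed.
Lemma prv_ge k : k - NZ <= prv k.
Proof. by have := nxt_le (- k); rewrite /prv; lia. Qed.

Lemma nxt_prv k : K k -> nxt (prv k) = k.
Proof.
move=> kK; apply/eqP; rewrite eq_le nxt_min ?prv_lt //= leNgt; apply/negP => h.
by have := prv_max (nxtK (prv k)) h; rewrite leNgt nxt_gt.
Qed.

Lemma prv_nxt k : K k -> prv (nxt k) = k.
Proof.
move=> kK; apply/eqP; rewrite eq_le prv_max ?nxt_gt // andbT leNgt; apply/negP => h.
by have := nxt_min (prvK (nxt k)) h; rewrite leNgt prv_lt.
Qed.

Lemma prvN k : prv (- k) = - nxt k. Proof. by rewrite /prv opprK. Qed.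
Lemma nxtN k : nxt (- k) = - prv k. Proof. by rewrite /prv opprK. Qed.

Lemma nxt_addNn k n : nxt (k + NZ * n) = nxt k + NZ * n.
Proof.
apply/eqP; rewrite eq_le nxt_min /=; first 1 last.
- exact/inK_addNn/nxtK.
- by rewrite ltrD2r nxt_gt.
rewrite -lerBrDr; apply: nxt_min; last by rewrite ltrBrDr nxt_gt.
by rewrite -mulrN; exact/inK_addNn/nxtK.
Qed.

Lemma prv_addN k : prv (k + NZ) = prv k + NZ.
Proof. by have := nxt_addNn (- k) (-1); rewrite /prv mulrN1 opprD => ->; ring. Qed.

Lemma prv_addNn k n : prv (k + NZ * n) = prv k + NZ * n.
Proof. by rewrite /prv opprD -mulrN nxt_addNn opprD mulrN opprK. Qed.

Lemma K_ind (Q : int -> Prop) a : K a -> Q a ->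
  (forall k, K k -> a <= k -> Q k -> Q (nxt k)) -> forall k, K k -> a <= k -> Q k.
Proof.
move=> aK Qa QS k; have [d] := ubnP (absz (k - a)); elim: d => // d IH in k * => kd kK ak.
have [->//|ka] := eqVneq k a; have {}ak : a < k by rewrite lt_def ka.
have ap := prv_max aK ak; have pl := prv_lt k; rewrite -(nxt_prv kK).
by apply: QS => //; [exact: prvK | apply: IH => //; [lia | exact: prvK]].
Qed.

Lemma g_le1 k o : K k -> -1 <= g k o <= 1.
Proof. by move=> /gw[h _ _]; rewrite -ler_norml. Qed.

Lemma P_step k l o : k <= l -> l <= k + NZ -> P k o - 1 <= P l o <= P k o.
Proof. by move=> kl lk; rewrite Pf_drop // Pf_anti. Qed.

Lemma om_step k l o : k <= l -> l <= k + NZ -> om k o - 1 <= om l o <= om k o.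
Proof. by move=> kl lk; rewrite om_drop // om_anti. Qed.

Lemma gE k o : g k o = P k o - om k o. Proof. by []. Qed.

Definition Tset k : {set 'I_N} := [set o | g k o == 1]%SET.
Definition Zset k : {set 'I_N} := [set o | g k o == -1]%SET.

Lemma inT k o : (o \in Tset k) = (g k o == 1). Proof. by rewrite inE. Qed.
Lemma inZ k o : (o \in Zset k) = (g k o == -1). Proof. by rewrite inE. Qed.

Lemma cardT k : #|Tset k|%:Z = Uf w k.
Proof.
rewrite /Uf -(big_morph _ PoszD (erefl 0%:Z)); congr Posz.
by rewrite -sum1_card big_mkcond; apply: eq_bigr => o _; rewrite inE; case: eqP.
Qed.

Lemma ZsetN k : Zset (- k) = [set rev_ord o | o in Tset k]%SET.
Proof.
apply/setP=> o; rewrite inE -[o]rev_ordK gf_rev // eqr_opp -inT.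
by rewrite (mem_imset _ _ rev_ord_inj) ?rev_ordK.
Qed.

Lemma cardZ k : K k -> #|Zset k|%:Z = Uf w k.
Proof.
move=> kK; rewrite -[k]opprK ZsetN card_imset ?cardT; last exact: rev_ord_inj.
by rewrite opprK UfN // => o; have := g_le1 o kK; rewrite ler_norml.
Qed.

(** [Tset] and [Zset] have the common size [Uf], so opposite inclusions force equalities. *)
Lemma g_eq_of k l : K k -> K l -> Tset k \subset Tset l -> Zset l \subset Zset k -> g k =1 g l.
Proof.
move=> kK lK sT sZ.
have [] : Uf w k <= Uf w l /\ Uf w l <= Uf w k.
  by split; [rewrite -!cardT lez_nat; exact: subset_leq_card |
    rewrite -!cardZ // lez_nat; exact: subset_leq_card].
move=> h1 h2; have E : Uf w k = Uf w l by apply/eqP; rewrite eq_le h1.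
have ET : Tset k = Tset l.
  by apply/eqP; rewrite eqEcard sT -lez_nat !cardT E lexx.
have EZ : Zset l = Zset k.
  by apply/eqP; rewrite eqEcard sZ -lez_nat !cardZ // E lexx.
move=> o; have := g_le1 o kK; have := g_le1 o lK.
have := congr1 (fun A : {set _} => o \in A) ET; have := congr1 (fun A : {set _} => o \in A) EZ.
rewrite !inE; move: (g k o) (g l o) => y z; clear.
by do 4?[case: eqP => [?|?]] => //; lia.
Qed.

(** * Drops along [K] and the intervals between them *)

Definition Tdrop a i := [/\ K a, g (prv a) i = 1 & g a i = 0].
Definition Zdrop b t := [/\ K b, g b t = 0 & g (nxt b) t = -1].

(** From one element of K to the next, P and om drop by at most 1 each; when g falls, P has dropped
    and om has not. *)
Lemma Tdrop_P a i : Tdrop a i -> P (prv a) i = P a i + 1.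
Proof.
case=> aK h1 h2; have := P_step i (ltW (prv_lt a)) _; have := om_step i (ltW (prv_lt a)) _.
have pg := prv_ge a; have h : a <= prv a + NZ by move: pg; clear; lia.
by move=> /(_ h) + /(_ h); move: h1 h2; rewrite !gE; lia.
Qed.

Lemma Zdrop_P b t : Zdrop b t -> P (nxt b) t = P b t - 1.
Proof.
case=> bK h1 h2; have := P_step t (ltW (nxt_gt b)) (nxt_le b).
by have := om_step t (ltW (nxt_gt b)) (nxt_le b); move: h1 h2; rewrite !gE; lia.
Qed.

Lemma Tdrop_addNn a i n : Tdrop a i -> Tdrop (a + NZ * n) i.
Proof. by case=> aK h1 h2; split; [exact: inK_addNn | rewrite prv_addNn gf_addNn | rewrite gf_addNn]. Qed.

Lemma Zdrop_addNn a i n : Zdrop a i -> Zdrop (a + NZ * n) i.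
Proof. by case=> aK h1 h2; split; [exact: inK_addNn | rewrite gf_addNn | rewrite nxt_addNn gf_addNn]. Qed.

Lemma TdropN a i : Tdrop a i -> Zdrop (- a) (rev_ord i).
Proof.
case=> aK h1 h2; split; first exact: inKN.
  by rewrite gf_rev // h2 oppr0.
by rewrite nxtN gf_rev // h1.
Qed.

Lemma ZdropN a i : Zdrop a i -> Tdrop (- a) (rev_ord i).
Proof.
case=> aK h1 h2; split; first exact: inKN.
  by rewrite prvN gf_rev // h2 opprK.
by rewrite gf_rev // h1 oppr0.
Qed.

Lemma T_grow a : K a -> forall b, K b -> a <= b ->
  (forall k i, a < k -> k <= b -> ~ Tdrop k i) -> Tset a \subset Tset b.
Proof.
move=> aK b bK ab; move: b bK ab; apply: (K_ind aK) => [_|k kK ak IH h]; first exact: subxx.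
have nT : forall l i, a < l -> l <= k -> ~ Tdrop l i.
  by move=> l i al lk; apply: h => //; exact/(le_trans lk)/ltW/nxt_gt.
apply: fintype.subset_trans (IH nT) _.
apply/fintype.subsetP => o; rewrite !inT => /eqP ok.
have := g_le1 o (nxtK k); have := P_step o (ltW (nxt_gt k)) (nxt_le k).
have := om_step o (ltW (nxt_gt k)) (nxt_le k).
have : ~ Tdrop (nxt k) o by apply: h => //; apply: le_lt_trans ak (nxt_gt k).
have [//|ne] := eqVneq (g (nxt k) o) 1.
move=> nT' h1 h2 h3; case: nT'; split; [exact: nxtK | by rewrite prv_nxt |].
by move: ok ne h1 h2 h3; rewrite !gE; lia.
Qed.

Lemma Z_shrink a : K a -> forall b, K b -> a <= b ->
  (forall k i, a <= k -> k < b -> ~ Zdrop k i) -> Zset b \subset Zset a.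
Proof.
move=> aK b bK ab h; rewrite -[b]opprK -[a]opprK !ZsetN; apply: imsetS.
apply: (T_grow (inKN bK)) => [||k i k1 k2 /TdropN]; [exact: inKN | by rewrite lerN2 |].
by apply: h; [rewrite lerNr | rewrite ltrNl].
Qed.

(* A maximal run [a, b] of K bounded by a drop 1 -> 0 into a and a drop 0 -> -1 out
   of b; g is constant on it. *)
Definition isE a b := [/\ K a, K b, a <= b, exists i, Tdrop a i & exists t, Zdrop b t] /\
  (forall k i, a < k -> k <= b -> ~ Tdrop k i) /\
  (forall k i, a <= k -> k < b -> ~ Zdrop k i).

Lemma isE_const a b k : isE a b -> K k -> a <= k -> k <= b -> g a =1 g k.
Proof.
move=> [[aK bK ab _ _] [nT nZ]] kK ak kb; apply: g_eq_of => //.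
  by apply: T_grow => // l i al lk; apply: nT => //; exact: le_trans kb.
by apply: Z_shrink => // l i al lk; apply: nZ => //; exact: lt_le_trans kb.
Qed.

(** The interval contains no translate of its initial drop, and it stops short of [prv a + NZ],
    where entry i of g is 1 again instead of 0. *)
Lemma isE_len a b : isE a b -> nxt b <= prv a + NZ.
Proof.
move=> E; have [[aK bK ab [i Ti] [t Zt]] [nT nZ]] := E.
have ba : b < a + NZ.
  rewrite ltNge; apply/negP => h; have := @Tdrop_addNn _ _ 1 Ti; rewrite mulr1.
  by apply: nT => //; rewrite ltrDl.
have bp : b <= prv a + NZ.
  rewrite -prv_addN; exact: prv_max.
have paK : K (prv a + NZ) by apply: inK_addN; exact: prvK.
apply: nxt_min => //; rewrite lt_def bp andbT; apply/eqP => h.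
have := isE_const E bK ab (lexx b) i; rewrite -h.
by have := @gf_addNn w (prv a) 1 i; rewrite mulr1 => ->; case: Ti => _ -> ->.
Qed.

Lemma isE_eq a b a' b' k : isE a b -> isE a' b' -> a <= k -> k <= b -> a' <= k -> k <= b' ->
  a = a' /\ b = b'.
Proof.
move=> [[aK bK ab [i Ti] [t Zt]] [nT nZ]] [[aK' bK' ab' [i' Ti'] [t' Zt']] [nT' nZ']] h1 h2 h3 h4.
split.
  case: (ltrgtP a a') => // h.
    by case: (nT _ _ h (le_trans h3 h2) Ti').
  by case: (nT' _ _ h (le_trans h1 h4) Ti).
case: (ltrgtP b b') => // h.
  by case: (nZ' _ _ (le_trans h3 h2) h Zt).
by case: (nZ _ _ (le_trans h1 h4) h Zt').
Qed.

Lemma isE_mirror a b n : isE a b -> isE (NZ * n - b) (NZ * n - a).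
Proof.
move=> [[aK bK ab [i Ti] [t Zt]] [nT nZ]]; rewrite ![NZ * n - _]addrC.
split; [split | split].
- exact/inK_addNn/inKN.
- exact/inK_addNn/inKN.
- by rewrite lerD2r lerN2.
- by exists (rev_ord t); exact/Tdrop_addNn/ZdropN.
- by exists (rev_ord i); exact/Zdrop_addNn/TdropN.
- move=> k o k1 k2 /TdropN/(Zdrop_addNn n); apply: nZ; clear -k1 k2; lia.
- move=> k o k1 k2 /ZdropN/(Tdrop_addNn n); apply: nT; clear -k1 k2; lia.
Qed.

(** Distinct intervals are disjoint, so one that meets its mirror image coincides with it. *)
Lemma isE_central a b k n : isE a b -> a <= k -> k <= b -> a <= NZ * n - k -> NZ * n - k <= b ->
  a + b = NZ * n.
Proof.
move=> E h1 h2 h3 h4; have [] := isE_eq E (isE_mirror n E) h1 h2; clear -h3 h4; lia.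
Qed.

(** [b] is the first [Zdrop] from a on, and a' the last [Tdrop] up to b. No [Zdrop] lies between a
    and a', so [Zset] only shrinks and [Uf] does not grow. *)
Lemma isE_ex a i : Tdrop a i -> exists a' b, [/\ isE a' b, a <= a', Uf w a' <= Uf w a &
  forall k o, a <= k -> k < b -> ~ Zdrop k o].
Proof.
move=> Ti; have [aK _ _] := Ti.
have exb : exists d : nat, `[< exists t, Zdrop (a + d%:Z) t >].
  (* The mirror image of the given [Tdrop] is a [Zdrop] at -a; adding 2 |a| periods carries it to
     the right of a. *)
  have Z0 := Zdrop_addNn (absz a + absz a)%N%:Z (TdropN Ti).
  have : (absz a + absz a)%N%:Z <= NZ * (absz a + absz a)%N%:Z by rewrite ler_peMl.
  move: Z0; set l := - a + _ => Z0 h; exists (absz (l - a)); apply/asboolP; exists (rev_ord i).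
  suff -> : a + (absz (l - a))%:Z = l by [].
  by move: h; rewrite /l; move: (NZ * _) => y; clear; lia.
case: (ex_minnP exb) => d /asboolP[t Zt] dm; set b := a + d%:Z in Zt.
have nZ k o : a <= k -> k < b -> ~ Zdrop k o.
  move=> ak kb Zk; have : `[< exists t, Zdrop (a + (absz (k - a))%:Z) t >].
    by apply/asboolP; exists o; rewrite (_ : a + _ = k) //; clear -ak; lia.
  by move/dm; move: kb; rewrite /b; clear -ak; lia.
have exa : exists e : nat, `[< a <= b - e%:Z /\ exists i, Tdrop (b - e%:Z) i >].
  by exists d; apply/asboolP; rewrite /b addrK; split=> //; exists i.
case: (ex_minnP exa) => e /asboolP[ae [i' Ti']] em; set a' := b - e%:Z in ae Ti'.
have [aK' _ _] := Ti'; have ab' : a' <= b by rewrite /a'; clear; lia.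
exists a', b; split=> //.
- split; [|split].
  + by split=> //; [case: Zt | exists i' | exists t].
  + move=> k o ak kb Tk; have : `[< a <= b - (absz (b - k))%:Z /\ exists i, Tdrop (b - (absz (b - k))%:Z) i >].
      apply/asboolP; rewrite (_ : b - (absz (b - k))%:Z = k); last by clear -kb; lia.
      by split; [exact/(le_trans ae)/ltW | exists o].
    by move/em; move: ak; rewrite /a'; clear -kb; lia.
  + by move=> k o ak; apply: nZ; exact: le_trans ak.
rewrite -!cardZ // lez_nat; apply: subset_leq_card; apply: Z_shrink => // k o ak ka.
by apply: nZ => //; exact: lt_le_trans ab'.
Qed.

Definition up := exists r, [/\ valid r, ~~ sep w r & good q I (refl r * w)%g].

Lemma winding k a : exists n, a <= k + NZ * n < a + NZ.
Proof.
exists (- ((k - a) %/ NZ)%Z); have := divz_eq (k - a) NZ.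
have := modz_ge0 (k - a) (isT : NZ != 0); have := ltz_pmod (k - a) (isT : 0 < NZ).
rewrite mulrN [_ * NZ]mulrC; move: (NZ * _) (modz _ _) => y z h1 h2 h3.
by apply/andP; split; clear -h1 h2 h3; lia.
Qed.

(** P drops once per period, and in entry i it has just done so on reaching a. *)
Lemma Pi_const a i k : P (prv a) i = P a i + 1 -> a <= k -> k <= prv a + NZ -> P k i = P a i.
Proof.
move=> h ak ka; have := Pf_anti w i ak; have := Pf_anti w i ka.
by rewrite Pf_addN h; lia.
Qed.

Lemma Pt_const e t k : P (nxt e) t = P e t - 1 -> nxt e <= k + NZ -> k <= e -> P k t = P e t.
Proof.
move=> h ek ke; have := Pf_anti w t ke; have := Pf_anti w t ek.
by rewrite Pf_addN h; lia.
Qed.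

Lemma shift_addNn r k n : shift w r (k + NZ * n) = shift w r k.
Proof. by rewrite /shift !Pf_addNn; ring. Qed.

Definition proot a i t : root m := (i, t, P a i - P a t + 1).

(* Reflecting in [proot a i t] raises entry i and lowers entry t exactly on the
   translates of [a, e] by multiples of N. *)
Definition pairing a e i t := [/\ [/\ K a, K e & a <= e], valid (proot a i t), g a i = g a t &
  [/\ P (prv a) i = P a i + 1, P (nxt e) t = P e t - 1 & nxt e <= prv a + NZ]].

(** * The effect of one reflection on a window of [K] *)

Section PairMove.
Variables (a e : int) (i t : 'I_N).
Hypothesis H : pairing a e i t.
Let r := proot a i t.
Let w' := (refl r * w)%g.

Lemma pair_valid : valid r.
Proof. by case: H. Qed.

(** The constant of the root exceeds P_i - P_t at a by 1, and om_i - om_t is the same number since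
    g_i = g_t there. *)
Lemma pair_sep : ~~ sep w r.
Proof.
have [_ _ git _] := H.
rewrite /sep negbK (@side_Pf _ w a) ?(@side_om _ a) //; last by clear; lia.
by move: git; rewrite !gE; clear; lia.
Qed.

Lemma pair_shift1 k : a <= k -> k <= e -> shift w r k = 1.
Proof.
move=> ak ke; have el := nxt_gt e; have al := prv_lt a.
have [[aK eK ae] _ _ [Pi Pt len]] := H.
have h k' : a <= k' -> k' <= e -> P k' i = P a i /\ P k' t = P e t.
  move=> ak' ke'; split; [apply: Pi_const => // | apply: Pt_const => //];
  clear -ak' ke' el al len; lia.
have [h1 h2] := h k ak ke; have [_ h3] := h a (lexx a) ae.
by rewrite /shift /= h1 h2 h3; ring.
Qed.

(** Between e and the next translate of a, entry t of P has dropped and entry i has not, which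
    cancels the 1 in the constant of the root. *)
Lemma pair_shift0 k : K k -> shift w r k = 0 \/
  shift w r k = 1 /\ exists n, a <= k + NZ * n <= e.
Proof.
move=> kK; have [n /andP[h1 h2]] := winding k a.
have [[aK eK ae] _ _ [Pi Pt len]] := H.
have knK : K (k + NZ * n) by exact: inK_addNn.
rewrite -(shift_addNn r k n); case: (leP (k + NZ * n) e) => h3.
  by right; split; [exact: pair_shift1 | exists n; rewrite h1].
have h4 := nxt_min knK h3; left.
have el := nxt_gt e; have al := prv_lt a; have eN := nxt_le e.
have h5 : k + NZ * n <= prv a + NZ.
  rewrite -prv_addN; exact: prv_max.
have p1 : P (k + NZ * n) i = P a i by apply: Pi_const.
have h6 : k + NZ * n <= e + NZ by clear -h5 al ae; lia.
have p2 : P (k + NZ * n) t = P e t - 1.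
  have := Pf_anti w t h4; have := Pf_anti w t h6.
  by rewrite Pf_addN Pt; lia.
have p3 : P a t = P e t by apply: Pt_const => //; clear -len al; lia.
by rewrite /shift /= p1 p2 p3; ring.
Qed.

(** Only translates of the window and of its mirror image are affected, and the latter are settled
    by oddness. *)
Lemma pair_up : (forall k, K k -> a <= k -> k <= e -> cond q w' k) -> up.
Proof.
move=> h; have vr := pair_valid; exists r; split; [exact: vr | exact: pair_sep |].
have w2' : wt2 w' by apply: wt2_Waff (refl_Waff vr) w2.
have h' k n : K k -> a <= k + NZ * n <= e -> cond q w' k.
  move=> kK /andP[h1 h2]; have := h _ (inK_addNn n kK) h1 h2.
  by move/(cond_addNn (- n)); rewrite mulrN addrK.
move=> k kK; case: (pair_shift0 kK) => [s0|[_ [n hn]]]; last exact: h' hn.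
case: (pair_shift0 (inKN kK)) => [s0'|[_ [n hn]]]; last first.
  by rewrite -[k]opprK; apply: condN => //; apply: h' hn; exact: inKN.
have E : gf w' k =1 g k.
  by move=> o; rewrite /w' gf_refl // s0 s0' oppr0; do 4?case: ifP => _; rewrite addr0.
have EU : Uf w' k = Uf w k by apply: eq_bigr => o _; rewrite E.
have [c1 c2 c3] := gw kK; split=> [o||[b1 b2 b3]]; rewrite ?E ?EU //; apply: c3.
split=> [o||o]; [by rewrite -!E; exact: b1 | by rewrite -EU | by rewrite -E; exact: b3].
Qed.

Lemma pair_gf k o : K k -> a <= k -> k <= e -> gf w' k o = g k o +
  (if o == i then 1 else if o == t then -1 else if o == rev_ord i then - shift w r (- k)
   else if o == rev_ord t then shift w r (- k) else 0).
Proof. by move=> kK ak ke; rewrite /w' (gf_refl k o w2 pair_valid) pair_shift1. Qed.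

Lemma pair_Uf k : K k -> a <= k -> k <= e -> t != rev_ord i -> Uf w' k = Uf w k +
  (is1 (g k i + 1) - is1 (g k i) + (is1 (g k t - 1) - is1 (g k t)) +
   (if shift w r (- k) == 0 then 0 else
    is1 (g k (rev_ord i) - 1) - is1 (g k (rev_ord i)) +
    (is1 (g k (rev_ord t) + 1) - is1 (g k (rev_ord t))))).
Proof.
move=> kK ak ke /negPf ti; have := Uf_refl k w2 pair_valid; rewrite /= ti pair_shift1 //.
have R o : g k (rev_ord o) = - gf w (- k) o by rewrite gf_revN // opprK.
rewrite !R; move: (gf w (- k) i) (gf w (- k) t) => x' y'.
case: (pair_shift0 (inKN kK)) => [->|[-> _]] /=.
  by rewrite addr0 subr0 !subrr !addr0 => <-; rewrite addrC subrK.
by rewrite opprD opprB [1 - y']addrC => <-; rewrite addrC subrK.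
Qed.

Lemma pair_Uf_rev k : K k -> a <= k -> k <= e -> t = rev_ord i -> Uf w' k = Uf w k +
  (is1 (g k i + 1) - is1 (g k i) + (is1 (g k t - 1) - is1 (g k t))).
Proof.
move=> kK ak ke ti; have := Uf_refl k w2 pair_valid.
by rewrite /= {1}ti eqxx pair_shift1 // => <-; rewrite addrC subrK.
Qed.

(** The shift at -k tells whether k also lies in the mirror image of the window modulo N; if so, the
    mirror entries move too and [Uf] gains 2. *)
Lemma pair_zero k : K k -> a <= k -> k <= e -> t != rev_ord i -> g k i = 0 -> g k t = 0 ->
  (shift w r (- k) = 1 -> g k (rev_ord i) = 0 /\ g k (rev_ord t) = 0) ->
  (forall o, `|gf w' k o| <= 1) /\
  (shift w r (- k) = 0 /\ Uf w' k = Uf w k + 1 \/ shift w r (- k) = 1 /\ Uf w' k = Uf w k + 2).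
Proof.
move=> kK ak ke ti gi gt gs; split=> [o|].
  rewrite pair_gf //; case: (eqVneq o i) => [->|_]; first by rewrite gi.
  case: (eqVneq o t) => [->|_]; first by rewrite gt.
  have gko : `|g k o| <= 1 by rewrite ler_norml g_le1.
  case: (pair_shift0 (inKN kK)) gs => [->|[-> _] /(_ erefl)[g1 g2]].
    by rewrite oppr0 !if_same addr0.
  case: (eqVneq o _) => [->|_]; first by rewrite g1.
  by case: (eqVneq o _) => [->|_]; [rewrite g2 | rewrite addr0].
rewrite pair_Uf // gi gt.
case: (pair_shift0 (inKN kK)) gs => [->|[-> _] /(_ erefl)[-> ->]]; first by left.
by right.
Qed.

End PairMove.

Lemma g_mid k : g k (mid m) = 0.
Proof.
have [Ww w1] := w2.
by rewrite gE /Pf w1 Wext_linVmid //; ring.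
Qed.

(** * Reflections attached to an interval *)

Section OnInterval.
Variables (a b : int) (i t : 'I_N).
Hypothesis H : [/\ isE a b, Tdrop a i & Zdrop b t].
Let E : isE a b := let: And3 e _ _ := H in e.
Let Ti : Tdrop a i := let: And3 _ e _ := H in e.
Let Zt : Zdrop b t := let: And3 _ _ e := H in e.

Lemma isE_it : [/\ i != t, i != mid m & t != mid m].
Proof.
have pi := Tdrop_P Ti; have pt := Zdrop_P Zt; have len := isE_len E.
have [_ g1 _] := Ti; have [_ _ g2] := Zt; have [[_ _ ab _ _] _] := E.
split.
- apply/eqP => it; move: pt; rewrite -it => pt.
  have := Pf_drop w i len; have := Pf_anti w i ab; rewrite pi pt; clear; lia.
- by apply: contra_eq_neq g1 => ->; rewrite g_mid.
- by apply: contra_eq_neq g2 => ->; rewrite g_mid.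
Qed.

Lemma isE_g0 k : K k -> a <= k -> k <= b -> g k i = 0 /\ g k t = 0.
Proof.
move=> kK ak kb; have [[aK bK ab _ _] _] := E; rewrite -!(isE_const E kK ak kb).
by case: Ti => _ _ ->; rewrite (isE_const E bK ab (lexx b)); case: Zt => _ ->.
Qed.

(** The drop of i into a is mirrored by a drop of [rev_ord i] out of -a. That entry also drops out
    of b, and it drops once per period, so -a and b agree modulo N. *)
Lemma isE_rev : t = rev_ord i -> exists n, a + b = NZ * n.
Proof.
move=> ti; have pi := Zdrop_P (TdropN Ti); have pt := Zdrop_P Zt.
have bK : K b by case: Zt. have aK : K a by case: Ti.
have [n /andP[h1 h2]] := winding (- a) b; exists n; set k := - a + NZ * n in h1 h2.
have kK : K k by exact/inK_addNn/inKN.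
have [E0|ne] := eqVneq k b; first by rewrite -E0 /k; ring.
have h3 : nxt b <= k by apply: nxt_min => //; rewrite lt_def ne.
have h4 : nxt k <= b + NZ by apply: nxt_min => //; have := inK_addNn 1 bK; rewrite mulr1.
have := Pf_anti w t h4; have := Pf_anti w t h3; rewrite pt Pf_addN.
have -> : P (nxt k) t = P k t - 1.
  by move: pi; rewrite ti /k nxt_addNn !Pf_addNn => ->; ring.
by clear; lia.
Qed.

Lemma isE_selfdual n k : a + b = NZ * n -> K k -> a <= k -> k <= b -> selfdual w k.
Proof.
move=> ab kK ak kb o; have -> : g k (rev_ord o) = - g (NZ * n - k) o.
  by rewrite [NZ * n - k]addrC gf_addNn gf_revN // opprK.
have kK' : K (NZ * n - k) by rewrite addrC; exact/inK_addNn/inKN.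
rewrite -(isE_const E kK ak kb) -(isE_const E kK') //; clear -ab ak kb; lia.
Qed.

Let r := proot a i t.
Let w' := (refl r * w)%g.

Lemma isE_g0a : g a i = 0 /\ g a t = 0.
Proof. by have [[aK _ ab _ _] _] := E; apply: isE_g0. Qed.

Lemma isE_pairing : (t == rev_ord i) ==> (2 %| P a i - P a t + 1)%Z -> pairing a b i t.
Proof.
move=> D2; have [it im tm] := isE_it; have [[aK bK ab _ _] _] := E; have [gi gt] := isE_g0a.
split=> //; [by apply/and4P | by rewrite gi gt | split].
- exact: Tdrop_P.
- exact: Zdrop_P.
exact: isE_len.
Qed.

Lemma isE_pair k : K k -> a <= k -> k <= b -> t != rev_ord i ->
  (forall o, `|gf w' k o| <= 1) /\
  ((shift w r (- k) = 0 /\ Uf w' k = Uf w a + 1) \/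
   (shift w r (- k) = 1 /\ (exists n, a + b = NZ * n) /\ Uf w' k = Uf w a + 2)).
Proof.
move=> kK ak kb ti; have [gi gt] := isE_g0 kK ak kb.
have pH : pairing a b i t by apply: isE_pairing; rewrite (negPf ti).
have EU : Uf w a = Uf w k by apply: eq_bigr => o _; rewrite (isE_const E kK ak kb).
have s1 : shift w r (- k) = 1 -> exists n, a + b = NZ * n.
  move=> s1; case: (pair_shift0 pH (inKN kK)) => [s0|[_ [n /andP[n1 n2]]]].
    by move: s1; rewrite -/r s0.
  by exists n; apply: (isE_central E ak kb); rewrite [_ - k]addrC.
have [|h1 h2] := pair_zero pH kK ak kb ti gi gt.
  move=> /s1[n abn]; have sd := isE_selfdual abn kK ak kb.
  by rewrite !sd gi gt oppr0.
split=> //; rewrite EU; case: h2 => [[]|[s1' U2]]; [by left | right].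
by split=> //; split=> //; exact: s1.
Qed.

End OnInterval.

(** The interval misses its mirror image, so [Uf] rises by 1 and reaches the parity of q, where
    (sp3) holds automatically. *)
Lemma up_noncentral_odd a b i t : [/\ isE a b, Tdrop a i & Zdrop b t] ->
  (forall n, a + b <> NZ * n) -> Uf w a < q%:Z -> ~~ (2 %| Uf w a - q%:Z)%Z -> up.
Proof.
move=> H nc uq odd; have ti : t != rev_ord i.
  by apply/eqP => /(isE_rev H)[n]; exact: nc.
have pH : pairing a b i t by apply: (isE_pairing H); rewrite (negPf ti).
apply: (pair_up pH) => k kK ak kb.
have [h1 [[_ h2]|[_ [[n /nc]]]]] := isE_pair H kK ak kb ti; last by [].
split=> [//||[_ + _]]; rewrite h2; first by clear -uq; lia.
by clear -odd; lia.
Qed.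

(** The interval is its own mirror image: [Uf] rises by 2 and keeps the parity of q. *)
Lemma up_central_even a b i t n : [/\ isE a b, Tdrop a i & Zdrop b t] ->
  a + b = NZ * n -> t != rev_ord i -> Uf w a < q%:Z -> (2 %| Uf w a - q%:Z)%Z -> up.
Proof.
move=> H ab ti uq ev.
have pH : pairing a b i t by apply: (isE_pairing H); rewrite (negPf ti).
apply: (pair_up pH) => k kK ak kb.
have [h1 [[s0 h2]|[_ [_ h2]]]] := isE_pair H kK ak kb ti.
  move: s0; rewrite -(shift_addNn _ (- k) n) (pair_shift1 pH) //; clear -ab ak kb; lia.
split=> [//||[_ + _]]; rewrite h2; first by clear -uq ev; lia.
by clear -ev; lia.
Qed.

(** [Uf] rises by 1 to the wrong parity. The alternative records how (sp3) can then fail, in the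
    form in which the substitute is constructed later. *)
Lemma up_noncentral_even a b i t : [/\ isE a b, Tdrop a i & Zdrop b t] ->
  (forall n, a + b <> NZ * n) -> Uf w a < q%:Z ->
  up \/ exists k, [/\ K k, a <= k, k <= b &
    (forall o, g a (rev_ord o) + (rev_ord o == i)%:Z - (rev_ord o == t)%:Z =
       - (g a o + (o == i)%:Z - (o == t)%:Z)) /\
    forall o, g a o + (o == i)%:Z - (o == t)%:Z = 0 -> (2 %| om k o + om k (rev_ord o))%Z].
Proof.
move=> H nc uq; have ti : t != rev_ord i.
  by apply/eqP => /(isE_rev H)[n]; exact: nc.
have [E _ _] := H; have [it _ _] := isE_it H.
have pH : pairing a b i t by apply: (isE_pairing H); rewrite (negPf ti).
pose w' := (refl (proot a i t) * w)%g.
have [[k [kK [ak kb] [b1 _ b3]]]|nb] := pselect (exists k, [/\ K k, a <= k /\ k <= b & bad q w' k]); last first.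
  left; apply: (pair_up pH) => k kK ak kb.
  have [h1 [[_ h2]|[_ [[n /nc]]]]] := isE_pair H kK ak kb ti; last by [].
  split=> //; rewrite ?h2; first by clear -uq; lia.
  by move=> bk; apply: nb; exists k.
right; exists k; split=> //.
have vE o : gf w' k o = g a o + (o == i)%:Z - (o == t)%:Z.
  have [_ [[s0 _]|[_ [[n /nc]]]]] := isE_pair H kK ak kb ti; last by [].
  rewrite (pair_gf pH) // s0 oppr0 !if_same -(isE_const E kK ak kb).
  case: (eqVneq o i) => [->|_]; first by rewrite (negPf it); clear; lia.
  by case: (eqVneq o t) => _; clear; lia.
by split=> o; rewrite -!vE; [exact: b1 | exact: b3].
Qed.

(* On an interval centred at N / 2 entry i lies in A_k, which makes (i, i^* ) a root
   for the D at hand. *)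
Lemma up_single a b i : isE a b -> Tdrop a i -> a + b = NZ -> Uf w a < q%:Z ->
  ~~ (2 %| Uf w a - q%:Z)%Z \/
    (exists o, [/\ g a o = 0, o != i, o != rev_ord i & ~~ (2 %| om a o + om a (rev_ord o))%Z]) ->
  up.
Proof.
move=> E Ti ab uq hyp; have pi := Tdrop_P Ti; have len := isE_len E.
have [[aK bK leab _ _] _] := E; have bl := nxt_gt b; have pl := prv_lt a.
have Zi : Zdrop b (rev_ord i).
  have := Zdrop_addNn 1 (TdropN Ti); rewrite mulr1 (_ : - a + NZ = b) //; clear -ab; lia.
have H : [/\ isE a b, Tdrop a i & Zdrop b (rev_ord i)] by [].
(* As b = N - a and P is constant in entry i on the interval, D equals 2 (P a i + 1). *)
have D2 : (2 %| P a i - P a (rev_ord i) + 1)%Z.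
  have -> : P a (rev_ord i) = - (P a i + 1).
    rewrite -{1}[a]opprK Pf_rev //; congr (- _).
    have -> : P (- a) i = P b i + 1.
      by have := @Pf_addNn w (- a) 1 i; rewrite mulr1 (_ : - a + NZ = b) => [->|]; clear -ab; lia.
    by rewrite (Pi_const pi leab); [|clear -len bl; lia].
  by clear; lia.
have pH : pairing a b i (rev_ord i) by apply: (isE_pairing H); rewrite eqxx.
have a0 : 0 < a by clear -ab len bl pl; lia.
apply: (pair_up pH) => k kK ak kb; set w' := (refl _ * w)%g.
have [gi gt] := isE_g0 H kK ak kb.
have gE' o : gf w' k o = if o == i then 1 else if o == rev_ord i then -1 else g a o.
  rewrite (pair_gf pH) // -(isE_const E kK ak kb) rev_ordK.
  case: (eqVneq o i) => [->|_]; first by rewrite (isE_const E kK ak kb) gi.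
  case: (eqVneq o _) => [->|_]; last by rewrite addr0.
  by rewrite (isE_const E kK ak kb) gt.
have EU : Uf w a = Uf w k by apply: eq_bigr => o _; rewrite (isE_const E kK ak kb).
have U' : Uf w' k = Uf w a + 1 by rewrite (pair_Uf_rev pH) // gi gt EU.
split=> [o||[_ b2 b3]].
- rewrite gE'; do 2![case: ifP => _ //].
  by rewrite ler_norml g_le1.
- by rewrite U'; clear -uq; lia.
case: hyp => [odd|[o [go oi oi' odd]]].
  by move: b2; rewrite U'; clear -odd; lia.
have := b3 o; rewrite gE' (negPf oi) (negPf oi') => /(_ go).
(* At a the sum of om over o and [rev_ord o] is 0 or -1, hence -1 as it is odd. By symmetry it is -1
   at b too, and by monotonicity throughout. *)
have om1 x : om k x <= om a x by apply: om_anti.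
have om2 x : om b x <= om k x by apply: om_anti.
have omb x : om b x = - om a (rev_ord x) - 1.
  have -> : b = - a + NZ * 1 by rewrite mulr1; clear -ab; lia.
  by rewrite om_addNn -[X in om (- a) X]rev_ordK om_rev.
have := om1 o; have := om1 (rev_ord o); have := om2 o; have := om2 (rev_ord o).
rewrite !omb rev_ordK; have := @om_step (- a) a o.
have : a <= - a + NZ by clear -ab leab; lia.
have : - a <= a by clear -a0; lia.
rewrite -[X in om (- a) X]rev_ordK om_rev; move=> h1 h2 /(_ h1 h2).
by move: odd; clear; lia.
Qed.

Lemma mid_even k : (2 %| om k (mid m) + om k (rev_ord (mid m)))%Z.
Proof. by rewrite rev_mid; clear; lia. Qed.

Lemma not_bad k : K k -> selfdual w k -> ~~ (2 %| Uf w k - q%:Z)%Z ->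
  exists o, g k o = 0 /\ ~~ (2 %| om k o + om k (rev_ord o))%Z.
Proof.
move=> /gw[_ _ nb] sd odd; apply: contrapT => h; apply: nb; split=> // o go.
by apply/negPn/negP => h'; apply: h; exists o.
Qed.

(* On an interval centred at 0 the pair (i, i^* ) is not a root for the D at hand;
   (sp3) at the least k provides an entry o to lower instead. *)
Lemma up_zero_odd a b i : isE a b -> Tdrop a i -> a + b = 0 -> Uf w a < q%:Z ->
  ~~ (2 %| Uf w a - q%:Z)%Z -> up.
Proof.
move=> E Ti ab uq odd; have [[aK bK leab _ [t Zt]] _] := E.
have H : [/\ isE a b, Tdrop a i & Zdrop b t] by [].
have len := isE_len E; have bl := nxt_gt b; have al := prv_lt a.
have pi := Tdrop_P Ti; have [_ im _] := isE_it H.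
set k0 := nxt (-1); have k0K : K k0 := nxtK _.
have k00 : 0 <= k0 by have := nxt_gt (-1); rewrite -/k0; clear; lia.
have k0b : k0 <= b by apply: nxt_min => //; clear -ab leab; lia.
have sd k : K k -> a <= k -> k <= b -> selfdual w k.
  by move=> kK ak kb; apply: (@isE_selfdual _ _ i t H 0) => //; rewrite mulr0.
have ak0 : a <= k0 by clear -ab k00 k0b; lia.
have EU k : K k -> a <= k -> k <= b -> Uf w k = Uf w a.
  by move=> kK ak kb; apply: eq_bigr => o _; rewrite (isE_const E kK ak kb).
have [|o [go oo]] := not_bad k0K (sd _ k0K ak0 k0b); first by rewrite EU.
have go' : g k0 (rev_ord o) = 0 by rewrite sd // go oppr0.
(* Since g vanishes at o and at its mirror, the odd om sum is the amount by which P changes in entry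
   o between -k0 and k0; so P drops there. *)
have oP : om k0 o + om k0 (rev_ord o) = P k0 o - P (- k0) o.
  rewrite -[o in P (- _) o]rev_ordK Pf_rev // opprK.
  by move: go go'; rewrite !gE; clear; lia.
have ni x : P k0 x = P (- k0) x -> o != x.
  by move=> h; apply: contraNneq oo => ox; rewrite oP ox h subrr dvdz0.
have oi : o != i.
  by apply: ni; rewrite !(Pi_const pi) //; clear -ab k00 k0b len bl; lia.
have om0 : o != mid m by apply: contraNneq oo => ->; exact: mid_even.
have oi' : o != rev_ord i.
  apply: contraNneq oo => oi'; rewrite oP oi' -{1}[k0]opprK !Pf_rev //.
  by rewrite !(Pi_const pi) ?subrr ?dvdz0 //; clear -ab k00 k0b len bl; lia.
have nk0 : nxt (- k0) = k0.
  have k0p : - k0 < k0.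
    by rewrite lt_neqAle; apply/andP; split; [apply: contraNneq oo => h; rewrite oP h subrr | clear -k00; lia].
  apply/eqP; rewrite eq_le nxt_min //= leNgt; apply/negP => h.
  have h1 := nxt_gt (- k0); have h2 := nxtK (- k0).
  have [h3|h3] := leP 0 (nxt (- k0)).
    by have : k0 <= nxt (- k0); [apply: nxt_min => //; clear -h3; lia | clear -h; lia].
  have : k0 <= - nxt (- k0); last by clear -h1; lia.
  by apply: nxt_min; [exact: inKN | clear -h3; lia].
have dP : P k0 o = P (- k0) o - 1.
  have h : k0 <= - k0 + NZ by clear -k0b ab len bl al; lia.
  have := P_step o (_ : - k0 <= k0) h; move: oo; rewrite oP; clear -k00; lia.
have k0p : 0 < k0.
  by have := nxt_gt (- k0); rewrite nk0; clear; lia.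
have [gai _] := isE_g0a H.
have gao : g a o = 0 by rewrite (isE_const E k0K ak0 k0b).
(* The window stops at -k0, whose successor in K is k0. Together with its mirror image from k0 to b
   it covers the whole interval, so [Uf] rises by exactly 1 everywhere on it. *)
have pH : pairing a (- k0) i o.
  split=> //.
  - by split=> //; [exact: inKN | clear -k0b ab; lia].
  - by apply/and4P; split=> //=; [rewrite eq_sym | rewrite (negPf oi')].
  - by rewrite gai gao.
  by rewrite nk0; split=> //; clear -k0b len bl; lia.
apply: (pair_up pH) => k kK ak kk0.
have kb : k <= b by clear -kk0 k0b k00; lia.
have gk x : g a x = 0 -> g k x = 0 by rewrite (isE_const E kK ak kb).
have [|h1 [[_ h2]|[s1 _]]] := pair_zero pH kK ak kk0 oi' (gk _ gai) (gk _ gao).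
- by rewrite !sd // !gk // oppr0.
- by split=> [//||[_ + _]]; rewrite h2 EU //; [clear -uq; lia | clear -odd; lia].
case: (pair_shift0 pH (inKN kK)) => [s0|[_ [n /andP[n1 n2]]]]; first by move: s1; rewrite s0.
have n2b : NZ * n - k <= b by clear -n2 k0b k00; lia.
have n1b : a <= NZ * n - k by clear -n1; lia.
have := isE_central E ak kb n1b n2b; rewrite ab => h.
by move: n2; rewrite -h; clear -kk0 k0p; lia.
Qed.

(** The nonzero entries and the three excluded ones number at most 2 (q - 2) + 3, which is less than
    N because q <= m. *)
Lemma zero_ex a i t : K a -> (q <= m)%N -> Uf w a + 2 <= q%:Z ->
  exists o, [/\ o != mid m, o != i, o != t & g a o = 0].
Proof.
move=> aK qm uq.
pose S := (Tset a :|: Zset a :|: [set i; t; mid m])%SET.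
have : (#|S| < #|[set: 'I_N]%SET|)%N.
  have h1 := leq_card_setU (Tset a :|: Zset a)%SET [set i; t; mid m]%SET.
  have h2 := leq_card_setU (Tset a) (Zset a).
  have h3 : (#|[set i; t; mid m]%SET| <= 3)%N.
    apply: leq_trans (leq_card_setU _ _) _; rewrite cards1 addn1 ltnS.
    by rewrite cards2; case: (_ != _).
  have h4 : (#|Tset a| + #|Zset a|)%N%:Z = Uf w a + Uf w a by rewrite PoszD cardT cardZ.
  rewrite cardsT card_ord; apply: leq_ltn_trans (leq_trans h1 (leq_add h2 h3)) _.
  by move: h4; move: (#|Tset a| + _)%N => c; clear -uq qm; lia.
move=> lt; have /subsetPn[o _] : ~~ ([set: 'I_N]%SET \subset S).
  by apply: contraL lt => /subset_leq_card; rewrite -leqNgt.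
rewrite !inE !negb_or => /andP[/andP[g1 g2] /andP[/andP[oi ot] om]].
exists o; split=> //; have := g_le1 o aK; move: g1 g2; clear; lia.
Qed.

Lemma K_least (Q : int -> Prop) a : (exists k, [/\ K k, a < k & Q k]) ->
  exists k, [/\ K k, a < k, Q k & forall l, K l -> a < l -> Q l -> k <= l].
Proof.
move=> [k [kK ak Qk]].
have ex : exists d : nat, `[< K (a + d.+1%:Z) /\ Q (a + d.+1%:Z) >].
  exists (absz (k - a)).-1; apply/asboolP.
  by rewrite (_ : a + _ = k) //; clear -ak; lia.
case: (ex_minnP ex) => d /asboolP[dK Qd] dm; exists (a + d.+1%:Z); split=> //.
  by clear; lia.
move=> l lK al Ql; have : `[< K (a + (absz (l - a)).-1.+1%:Z) /\ Q (a + (absz (l - a)).-1.+1%:Z) >].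
  by apply/asboolP; rewrite (_ : a + _ = l) //; clear -al; lia.
by move/dm; clear -al; lia.
Qed.

Lemma cardTU1 k o : g k o = 0 -> #|o |: Tset k|%:Z = Uf w k + 1.
Proof. by move=> go; rewrite cardsU1 inT go /= add1n intS cardT addrC. Qed.

Lemma cardZU1 k o : K k -> g k o = 0 -> #|o |: Zset k|%:Z = Uf w k + 1.
Proof. by move=> kK go; rewrite cardsU1 inZ go /= add1n intS cardZ // addrC. Qed.

(* The pair (i, t) would violate (sp3) on [a, b]; t is replaced by the zero j of v for
   which Pf drops first after a. *)
Section Later.
Variables (a b : int) (i t : 'I_N).
Hypothesis H : [/\ isE a b, Tdrop a i & Zdrop b t].
Let E : isE a b := let: And3 e _ _ := H in e.
Let v o : int := g a o + (o == i)%:Z - (o == t)%:Z.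
Hypothesis v_rev : forall o, v (rev_ord o) = - v o.
Let ones o := o != mid m /\ v o = 0.

Lemma v_values : [/\ v i = 1, v t = -1, v (rev_ord i) = -1 & v (rev_ord t) = 1].
Proof.
have [it _ _] := isE_it H; have [gi gt] := isE_g0a H.
have vi : v i = 1 by rewrite /v gi eqxx (negPf it).
have vt : v t = -1 by rewrite /v gt eqxx eq_sym (negPf it).
by rewrite !v_rev vi vt opprK.
Qed.

Lemma ones_rev o : ones o -> ones (rev_ord o).
Proof. by case=> om vo; split; [rewrite rev_eq_sym rev_mid | rewrite v_rev vo oppr0]. Qed.

Lemma ones_neq o : ones o -> [/\ o != i, o != t, o != rev_ord i & o != rev_ord t].
Proof.
have [v1 v2 v3 v4] := v_values.
by case=> _ vo; split; apply: contra_eq_neq vo => ->; rewrite ?v1 ?v2 ?v3 ?v4.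
Qed.

Lemma ones_g o : ones o -> g a o = 0.
Proof.
move=> oo; have [oi ot _ _] := ones_neq oo; case: oo => _.
by rewrite /v (negPf oi) (negPf ot); clear; lia.
Qed.

(** Every entry of P drops within one period, so some zero of v drops first; c is the last element
    of K before that. *)
Lemma first_drop : (exists o, ones o) -> exists c j, [/\ K c, a <= c, ones j,
  P (nxt c) j = P c j - 1 & forall o k, ones o -> a <= k -> k <= c -> P k o = P a o].
Proof.
have [[aK bK ab _ _] _] := E.
move=> [o oo].
have [|c1 [c1K ac1 [j [jo dj]] mn]] := K_least (Q := fun k => exists o, ones o /\ P k o != P a o) (a := a).
  exists (a + NZ); split; [by have := inK_addNn 1 aK; rewrite mulr1 | by rewrite ltrDl|].
  by exists o; split=> //; rewrite Pf_addN; clear; lia.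
have cK := prvK c1; have ac : a <= prv c1 := prv_max aK ac1; have cc1 := prv_lt c1.
have cst o' k : ones o' -> a <= k -> k <= prv c1 -> P k o' = P a o'.
  move=> oo' ak kc; have h : P (prv c1) o' = P a o'.
    have [->//|ne] := eqVneq (prv c1) a; apply/eqP; apply: contraT => h.
    have : c1 <= prv c1; last by rewrite leNgt cc1.
    by apply: mn => //; [rewrite lt_def ne | exists o'].
  by have := Pf_anti w o' ak; have := Pf_anti w o' kc; rewrite h; clear; lia.
exists (prv c1), j; split=> //; rewrite nxt_prv //.
have h : c1 <= prv c1 + NZ by have := prv_ge c1; clear; lia.
by have := P_step j (ltW cc1) h; move: dj; rewrite -(cst j (prv c1)) //; clear; lia.
Qed.

Hypotheses (c0 : 0 <= a + b) (cN : a + b <= NZ) (uq : Uf w a + 2 <= q%:Z).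
Hypothesis ev : (2 %| Uf w a - q%:Z)%Z.
Hypothesis even_P : (forall o, ones o -> P b o = P a o) ->
  forall o, ones o -> (2 %| P a o + P a (rev_ord o))%Z.
Hypothesis noT : forall k o, b < k -> k + k <= NZ -> Uf w k <= Uf w a + 1 -> ~ Tdrop k o.

Variables (c : int) (j : 'I_N).
Hypotheses (cK : K c) (ac : a <= c) (jo : ones j) (dj : P (nxt c) j = P c j - 1).
Hypothesis cst : forall o k, ones o -> a <= k -> k <= c -> P k o = P a o.

Lemma later_even o k : b <= c -> ones o -> a <= k -> k <= c -> (2 %| P k o + P k (rev_ord o))%Z.
Proof.
have [[_ _ ab _ _] _] := E.
move=> bc oo ak kc; rewrite !cst //; last exact: ones_rev.
by apply: even_P => // o' oo'; exact: cst.
Qed.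

(** If the drop came later, the mirror k -> N - k would bring into [a, c], where the zeros of v are
    constant, either a drop of [rev_ord j] or two values of P with odd sum, against [later_even]. *)
Lemma later_half : b <= c -> c + nxt c <= NZ.
Proof.
move=> bc; have [[aK bK ab _ _] _] := E; have jo' := ones_rev jo.
have cc1 := nxt_gt c; have al := prv_lt a.
have cN1 : c < a + NZ.
  rewrite ltNge; apply/negP => h; have aN : a <= a + NZ by rewrite lerDl.
  by have := cst jo aN h; rewrite Pf_addN; clear; lia.
have c1N : nxt c <= a + NZ.
  by apply: nxt_min => //; have := inK_addNn 1 aK; rewrite mulr1.
have KN k : K k -> K (NZ - k) by move=> kK; rewrite addrC -[X in _ + X]mulr1; exact/inK_addNn/inKN.
have PN k o : P (NZ - k) o = - P k (rev_ord o) - 1.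
  by rewrite addrC Pf_addN -[X in P (- _) X]rev_ordK Pf_rev.
rewrite leNgt; apply/negP => h.
have h1 : NZ - c <= c.
  rewrite -[X in _ <= X](prv_nxt cK); apply: prv_max; [exact: KN | clear -h; lia].
have h2 : NZ - nxt c <= c by clear -h; lia.
have [h3|h3] := leP a (NZ - nxt c).
  have h4 : a <= NZ - c by clear -h3 cc1; lia.
  have := cst jo' h3 h2; have := cst jo' h4 h1; rewrite !PN !rev_ordK dj; clear; lia.
have h4 : NZ - a <= c.
  rewrite -[X in _ <= X](prv_nxt cK); apply: prv_max; first exact: KN.
  have := prv_max (KN _ (nxtK c)) h3; clear -al; lia.
have [a0|a0] := leP a 0; first by clear -h4 cN1 a0; lia.
have h5 : a <= NZ - a by clear -ab cN; lia.
have := cst jo h5 h4; rewrite PN; have := later_even bc jo (lexx a) ac; clear; lia.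
Qed.

Lemma later_len : nxt c <= prv a + NZ.
Proof.
have [[aK bK ab _ _] _] := E; have len := isE_len E.
have bb1 := nxt_gt b; have cc1 := nxt_gt c; have al := prv_lt a.
have [cb|bc] := leP c b.
  apply: le_trans len; apply: nxt_min; first exact: nxtK.
  exact: le_lt_trans cb bb1.
have half := later_half (ltW bc).
have paK : K (prv a + NZ) by apply: inK_addN; exact: prvK.
rewrite leNgt; apply/negP => h.
have h1 : prv a + NZ <= c.
  by rewrite -(prv_nxt cK); apply: prv_max.
have : a <= - NZ - prv a; last by clear -c0 len bb1; lia.
have xK : K (- (prv a + NZ)) by exact: inKN.
have xl : prv a < - (prv a + NZ) by clear -h1 half cc1; lia.
by have := nxt_min xK xl; rewrite nxt_prv //; clear; lia.
Qed.

Lemma later_pairing : pairing a c i j.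
Proof.
have [ji jt ji' jt'] := ones_neq jo; have [_ im tm] := isE_it H.
have [[aK bK ab _ _] _] := E; have [gi _] := isE_g0a H.
split=> //.
- by apply/and4P; split; rewrite //= ?(negPf ji') //; [rewrite eq_sym | case: jo].
- by rewrite gi ones_g.
split=> //; [by apply: Tdrop_P; case: H | exact: later_len].
Qed.

Let w' := (refl (proot a i j) * w)%g.

Lemma later_Pi k : a <= k -> k <= c -> P k i = P a i.
Proof.
move=> ak kc; have cc1 := nxt_gt c; have len := later_len.
by apply: Pi_const => //; [apply: Tdrop_P; case: H | clear -kc cc1 len; lia].
Qed.

(** An entry newly equal to -1 was 0 at a and has undergone a drop of P. It is not i, and if it were
    not t it would be a zero of v, none of which drops before c. *)
Lemma later_Z k : K k -> b < k -> k <= c -> Zset k \subset t |: Zset a.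
Proof.
move=> kK bk kc; have [[aK bK ab _ _] _] := E; have cc1 := nxt_gt c; have al := prv_lt a.
have len := later_len; have ak : a <= k by exact/ltW/(le_lt_trans ab).
have kaN : k <= a + NZ by clear -kc cc1 len al; lia.
apply/fintype.subsetP => x; rewrite !inE => /eqP gx.
have [//|xt] := eqVneq x t; have [//|gax] := eqVneq (g a x) (-1).
have p1 := P_step x ak kaN; have p2 := om_step x ak kaN; have := g_le1 x aK.
move: gx gax; rewrite !gE => gx gax gb.
have [p3 p4] : P a x - om a x = 0 /\ P k x = P a x - 1 by clear -p1 p2 gx gax gb; lia.
have xi : x != i by apply: contra_eq_neq p4 => ->; rewrite later_Pi //; clear; lia.
have xm : x != mid m.
  by apply: contra_eq_neq gx => ->; rewrite -gE g_mid.
have ox : ones x by split=> //; rewrite /v (negPf xi) (negPf xt) gE p3.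
by have := cst ox ak kc; rewrite p4; clear; lia.
Qed.

Lemma later_U k : K k -> b < k -> k <= c -> Uf w k <= Uf w a + 1.
Proof.
move=> kK bk kc; have [[aK _ _ _ _] _] := E.
have [_ gt] := isE_g0a H.
by rewrite -(cardZU1 aK gt) -cardZ // lez_nat; exact/subset_leq_card/later_Z.
Qed.

(** Up to b this is the maximality of the interval; beyond b it is [noT], supplied by the extremal
    choice in [up_drop]. *)
Lemma later_T k : K k -> a <= k -> k <= c -> Tset a \subset Tset k.
Proof.
have [[aK bK ab _ _] [nT _]] := E; move=> kK ak kc; apply: T_grow => // l o al lk.
have [lb|bl] := leP l b; first exact: nT.
have cc1 := nxt_gt c.
have bc : b <= c by clear -bl lk kc; lia.
have lc := le_trans lk kc; move=> Tl; have [lK _ _] := Tl.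
apply: noT (later_U lK bl lc) Tl => //.
by have := later_half bc; clear -lk kc cc1; lia.
Qed.

(** When [Uf] rises by 1 only, the new vector is 0 at t but 1 at [rev_ord t]; it is not self-dual,
    and (sp3) is void. *)
Lemma later_cond_in k : K k -> a <= k -> k <= c -> k <= b -> cond q w' k.
Proof.
move=> kK ak kc kb; have [[aK bK ab _ _] _] := E; have pH := later_pairing.
have [ji jt ji' jt'] := ones_neq jo; have [it im tm] := isE_it H.
have Ek := isE_const E kK ak kb.
have EU : Uf w k = Uf w a by apply: eq_bigr => o _; rewrite Ek.
have [gai gat] := isE_g0a H; have gaj := ones_g jo; have cc1 := nxt_gt c.
have gki : g k i = 0 by rewrite -Ek.
have gkj : g k j = 0 by rewrite -Ek.
have [|h1 h2] := pair_zero pH kK ak kc ji' gki gkj.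
  case: (pair_shift0 pH (inKN kK)) => [->//|[_ [n /andP[n1 n2]]] _].
  have nb : - k + NZ * n <= b.
    rewrite leNgt; apply/negP => h; have half := later_half (ltW (lt_le_trans h n2)).
    have l1 : NZ * 0 < NZ * n by rewrite mulr0; clear -h ak c0; lia.
    have l2 : NZ * n < NZ * 1 by rewrite mulr1; clear -n2 kc half cc1; lia.
    by move: (NZ_lt l1) (NZ_lt l2); clear; lia.
  rewrite addrC in n1 nb; have abn := isE_central E ak kb n1 nb.
  have sd := isE_selfdual H abn kK ak kb.
  by rewrite !sd -!Ek gai gaj oppr0.
case: h2 => [[s0 U2]|[_ U2]]; last first.
  split=> [//||[_ + _]]; rewrite U2 EU; first exact: uq.
  by clear -ev; lia.
split=> [//||[sd _ _]]; first by rewrite U2 EU; clear -uq; lia.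
have [v1 v2 v3 v4] := v_values.
have g't : gf w' k t = 0.
  rewrite (pair_gf pH) // s0 oppr0 !if_same -Ek gat eq_sym (negPf it).
  by rewrite eq_sym (negPf jt) addr0.
have tt : rev_ord t != t by rewrite rev_eq_mid.
have g't' : gf w' k (rev_ord t) = 1.
  rewrite (pair_gf pH) // s0 oppr0 !if_same -Ek; move: v4; rewrite /v (negPf tt).
  rewrite [rev_ord t == j]eq_sym (negPf jt'); case: eqP => [->|_]; last by clear; lia.
  by rewrite gai.
by have := sd t; rewrite g't g't'.
Qed.

Lemma later_cond_out k : K k -> b < k -> k <= c -> cond q w' k.
Proof.
move=> kK bk kc; have [[aK bK ab _ _] _] := E; have pH := later_pairing.
have [ji jt ji' jt'] := ones_neq jo; have [it im tm] := isE_it H.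
have [gai gat] := isE_g0a H; have gaj := ones_g jo; have cc1 := nxt_gt c.
have ak : a <= k by exact/ltW/(le_lt_trans ab).
have bc : b <= c by exact/ltW/(lt_le_trans bk).
have half := later_half bc; have len := later_len.
have al := prv_lt a.
have kaN : k <= a + NZ by clear -kc cc1 len al; lia.
have sT := later_T kK ak kc.
have sTU : Uf w a <= Uf w k by rewrite -!cardT lez_nat; exact: subset_leq_card.
have s0 : shift w (proot a i j) (- k) = 0.
  case: (pair_shift0 pH (inKN kK)) => [//|[_ [n /andP[n1 n2]]]].
  have l1 : NZ * 0 < NZ * n by rewrite mulr0; clear -n1 bk c0; lia.
  have l2 : NZ * n < NZ * 1 by rewrite mulr1; clear -n2 kc half cc1; lia.
  by move: (NZ_lt l1) (NZ_lt l2); clear; lia.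
have Pki := later_Pi ak kc.
have gi0 : 0 <= g k i.
  by have := om_anti i ak; move: gai; rewrite !gE Pki; clear; lia.
have Pkj : P k j = P a j by exact: cst.
have gj0 : 0 <= g k j.
  by have := om_anti j ak; move: gaj; rewrite !gE Pkj; clear; lia.
have sZ := later_Z kK bk kc; have sZU := later_U kK bk kc.
have sub1 o : g a o = 0 -> g k o = 1 -> o |: Tset a \subset Tset k /\ Uf w k = Uf w a + 1.
  move=> gao gko; have s1 : o |: Tset a \subset Tset k by rewrite finset.subUset sT andbT finset.sub1set inT gko.
  split=> //; apply/eqP; rewrite eq_le sZU -(cardTU1 gao) -cardT lez_nat.
  exact: subset_leq_card.
(* If entry i were already 1, the inclusions for [Tset] and [Zset] would be equalities and g_k would
   be v, which has no zero of odd om sum; w itself would violate (sp3). *)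
have gi : g k i = 0.
  have := g_le1 i kK; have [gki|ne] := eqVneq (g k i) 1; last by clear -gi0 ne; lia.
  have [s1 U1] := sub1 i gai gki.
  have ET : i |: Tset a = Tset k.
    by apply/eqP; rewrite eqEcard s1 -lez_nat cardT U1 cardTU1 // lexx.
  have EZ : Zset k = t |: Zset a.
    by apply/eqP; rewrite eqEcard sZ -lez_nat cardZ // U1 cardZU1 // lexx.
  have vk o : g k o = v o.
    have := congr1 (fun A : {set 'I_N} => o \in A) ET.
    have := congr1 (fun A : {set 'I_N} => o \in A) EZ.
    have := g_le1 o kK; have := g_le1 o aK; rewrite !inE /v.
    have [->|oi] := eqVneq o i; first by rewrite gki gai (negPf it).
    have [->|ot] := eqVneq o t; first by rewrite gat /=; clear; lia.
    by move: (g k o) (g a o) => y z; clear; do 4?[case: eqP => [?|?]] => //; lia.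
  have sd : selfdual w k by move=> o; rewrite !vk v_rev.
  have [|o [go odd]] := not_bad kK sd; first by rewrite U1; clear -ev; lia.
  have oo : ones o.
    by split; [apply: contraNneq odd => ->; exact: mid_even | rewrite -vk].
  case/negP: odd.
  have := later_even bc oo ak kc.
  have := sd o; rewrite go oppr0; move: go; rewrite !gE; clear; lia.
have jj : rev_ord j != j by rewrite rev_eq_mid; case: jo.
have g'E o : gf w' k o = g k o + (if o == i then 1 else if o == j then -1 else 0).
  by rewrite (pair_gf pH) // s0 oppr0 !if_same.
have g'j' : gf w' k (rev_ord j) = g k (rev_ord j).
  have ij : rev_ord j != i by rewrite rev_eq_sym.
  by rewrite g'E (negPf ij) (negPf jj) addr0.
have U' := pair_Uf pH kK ak kc ji'; rewrite s0 eqxx addr0 gi -/w' in U'.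
have gjb := g_le1 j kK.
have gj : g k j = 0 \/ g k j = 1 by clear -gj0 gjb; lia.
have g'b o : `|gf w' k o| <= 1.
  rewrite g'E; case: (eqVneq o i) => [->|_]; first by rewrite gi.
  case: (eqVneq o j) => [->|_]; first by case: gj => ->.
  by rewrite addr0 ler_norml g_le1.
have oo' := later_even bc jo ak kc.
case: gj => gj; rewrite gj in U'; split=> //.
(* For g_j = 0 a wrong parity forces [Tset k] = [Tset a], and self-duality would place [rev_ord j]
   in it. For g_j = 1 a self-dual result has a zero at j, whose om sum is odd, as (sp3) demands. *)
- by rewrite U' /is1 /=; clear -sZU uq; lia.
- case=> sd od _; have EU : Uf w k = Uf w a.
    by move: od; rewrite U' /is1 /=; clear -sTU sZU ev; lia.
  have ET : Tset a = Tset k by apply/eqP; rewrite eqEcard sT -lez_nat !cardT EU lexx.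
  have := sd j; rewrite g'j' g'E eqxx (negPf ji) gj => /eqP.
  by rewrite add0r opprK -inT -ET inT ones_g //; exact: ones_rev.
- by rewrite U' /is1 /=; have [_ + _] := gw kK; clear; lia.
case=> sd _ od; have := od j; rewrite g'E eqxx (negPf ji) gj subrr => /(_ erefl).
have := sd j; rewrite g'j' g'E eqxx (negPf ji) gj subrr oppr0.
by move: oo' gj; rewrite !gE; clear; lia.
Qed.

Lemma later_up : up.
Proof.
apply: (pair_up later_pairing) => k kK ak kc.
by have [kb|bk] := leP k b; [exact: later_cond_in | exact: later_cond_out].
Qed.

End Later.

Hypothesis qm : (q <= m)%N.

Lemma later_up_ex a b i t : [/\ isE a b, Tdrop a i & Zdrop b t] ->
  0 <= a + b -> a + b <= NZ -> Uf w a + 2 <= q%:Z -> (2 %| Uf w a - q%:Z)%Z ->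
  let v o := g a o + (o == i)%:Z - (o == t)%:Z in
  (forall o, v (rev_ord o) = - v o) ->
  ((forall o, o != mid m /\ v o = 0 -> P b o = P a o) ->
    forall o, o != mid m /\ v o = 0 -> (2 %| P a o + P a (rev_ord o))%Z) ->
  (forall k o, b < k -> k + k <= NZ -> Uf w k <= Uf w a + 1 -> ~ Tdrop k o) -> up.
Proof.
move=> H c0 cN uq ev v v_rev even_P noT; have [[[aK _ _ _ _] _] _ _] := H.
have [|c [j [cK ac jo dj cst]]] := first_drop H.
  have [o [om oi ot go]] := zero_ex i t aK qm uq.
  by exists o; rewrite (negPf oi) (negPf ot) go.
exact: (later_up H v_rev c0 cN uq ev even_P noT cK ac jo dj cst).
Qed.

(** Translation by N changes a + b by 2 N; the remaining reduction to [0, N] uses a mirror image. *)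
Lemma isE_normal a b : isE a b -> exists a' b', [/\ isE a' b', Uf w a' = Uf w a,
  0 <= a' + b' & a' + b' <= NZ].
Proof.
move=> E; have [[aK bK ab _ _] _] := E; have Eb := isE_const E bK ab (lexx b).
have EU : Uf w b = Uf w a by apply: eq_bigr => o _; rewrite Eb.
have UM n : Uf w (NZ * n - b) = Uf w a.
  by rewrite addrC Uf_addNn UfN // => o; rewrite ler_norml g_le1.
have [n /andP[n1 n2]] := winding (a + b) 0; rewrite add0r in n2.
have [p [np|np]] : exists p : int, n = p + p \/ n = p + p + 1.
  exists (n %/ 2)%Z; have := divz_eq n 2; have := modz_ge0 n (isT : 2 != 0 :> int).
  by have := ltz_pmod n (isT : (0 : int) < 2); clear; lia.
  have := isE_mirror p (isE_mirror 0 E); rewrite mulr0 !sub0r !opprK => E'.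
  exists (NZ * p + a), (NZ * p + b); split=> //; first by rewrite addrC Uf_addNn.
    by move: n1; rewrite np mulrDr; clear; lia.
  by move: n2; rewrite np mulrDr; clear; lia.
exists (NZ * (- p) - b), (NZ * (- p) - a); split; [exact: isE_mirror | exact: UM | |].
  by move: n2; rewrite np !mulrDr mulr1 mulrN; clear; lia.
by move: n1; rewrite np !mulrDr mulr1 mulrN; clear; lia.
Qed.

Lemma not_mult (c : int) : 0 < c -> c < NZ -> forall n, c <> NZ * n.
Proof.
move=> c0 cN n E; have l1 : NZ * 0 < NZ * n by rewrite mulr0 -E.
have l2 : NZ * n < NZ * 1 by rewrite mulr1 -E.
by move: (NZ_lt l1) (NZ_lt l2); clear; lia.
Qed.

Lemma up_odd a b : isE a b -> 0 <= a + b -> a + b <= NZ -> Uf w a < q%:Z ->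
  ~~ (2 %| Uf w a - q%:Z)%Z -> up.
Proof.
move=> E c0 cN uq odd; have [[aK bK ab [i Ti] [t Zt]] _] := E.
have H : [/\ isE a b, Tdrop a i & Zdrop b t] by [].
have [e0|ne0] := eqVneq (a + b) 0; first exact: (up_zero_odd E Ti e0 uq odd).
have [eN|neN] := eqVneq (a + b) NZ; first by apply: (up_single E Ti eN uq); left.
apply: (up_noncentral_odd H) => //; apply: not_mult; first by rewrite lt_def ne0.
by rewrite lt_neqAle neN.
Qed.

(** The difference P (-k) o - P k o is 0 or 1 and has the parity of the given sum, by oddness of
    P. *)
Lemma Pf_pm k o : 0 <= k -> k + k <= NZ -> (2 %| P k o + P k (rev_ord o))%Z -> P (- k) o = P k o.
Proof.
move=> k0 kN; rewrite -[k in P k (rev_ord o)]opprK Pf_rev //.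
have h : k <= - k + NZ by clear -kN; lia.
have kk : - k <= k by clear -k0; lia.
by have := P_step o kk h; move: (P k o) (P (- k) o) => x y; clear; lia.
Qed.

Lemma up_even a b : isE a b -> 0 <= a + b -> a + b <= NZ -> Uf w a < q%:Z ->
  (2 %| Uf w a - q%:Z)%Z ->
  (forall k o, b < k -> k + k <= NZ -> Uf w k <= Uf w a + 1 -> ~ Tdrop k o) -> up.
Proof.
move=> E c0 cN uq ev noT; have [[aK bK ab [i Ti] [t Zt]] _] := E.
have uq2 : Uf w a + 2 <= q%:Z by clear -uq ev; lia.
have al := prv_lt a; have bl := nxt_gt b; have len := isE_len E.
have central n : a + b = NZ * n ->
    [/\ isE a b, Tdrop a i & Zdrop b (rev_ord i)] /\ selfdual w a /\
    forall o, g a (rev_ord o) + (rev_ord o == i)%:Z - (rev_ord o == rev_ord i)%:Z =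
      - (g a o + (o == i)%:Z - (o == rev_ord i)%:Z).
  move=> abn; have H : [/\ isE a b, Tdrop a i & Zdrop b t] by [].
  have sd := isE_selfdual H abn aK (lexx a) ab; split; [split=> // | split=> // o].
    by rewrite (_ : b = - a + NZ * n); [exact/Zdrop_addNn/TdropN | clear -abn; lia].
  by rewrite sd rev_eq rev_eq_sym; clear; lia.
have [eN|neN] := eqVneq (a + b) NZ.
  have [[o [go oi oi' odd]]|none] := pselect (exists o, [/\ g a o = 0, o != i, o != rev_ord i &
      ~~ (2 %| om a o + om a (rev_ord o))%Z]).
    by apply: (up_single E Ti eN uq); right; exists o.
  have [|H [sd v_rev]] := central 1; first by rewrite mulr1.
  apply: (later_up_ex H c0 cN uq2 ev v_rev) => [_ o [o_m vo]|k o bk kN]; last first.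
    by exfalso; clear -bk kN eN ab; lia.
  have [oi oi' _ _] := ones_neq H v_rev (conj o_m vo).
  have go : g a o = 0 by move: vo; rewrite (negPf oi) (negPf oi'); clear; lia.
  have go' : g a (rev_ord o) = 0 by rewrite sd go oppr0.
  have : (2 %| om a o + om a (rev_ord o))%Z by apply/negPn/negP => h; apply: none; exists o.
  by move: go go'; rewrite !gE; clear; lia.
have [e0|ne0] := eqVneq (a + b) 0.
  have [ti|ti] := eqVneq t (rev_ord i); last first.
    by apply: (@up_central_even a b i t 0) => //; rewrite mulr0.
  have [|H [sd v_rev]] := central 0; first by rewrite mulr0.
  apply: (later_up_ex H c0 cN uq2 ev v_rev _ noT) => hb o oo.
  rewrite -(hb _ oo).
  have -> : P a (rev_ord o) = - P b o by rewrite (_ : a = - b) ?Pf_rev //; clear -e0; lia.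
  by rewrite subrr dvdz0.
have nc : forall n, a + b <> NZ * n.
  by apply: not_mult; [rewrite lt_def ne0 | rewrite lt_neqAle neN].
have H : [/\ isE a b, Tdrop a i & Zdrop b t] by [].
have a0 : 0 < a.
  rewrite ltNge; apply/negP => h; apply: (nc 0); rewrite mulr0; move: ne0 => _.
  have := @isE_central a b a 0 E (lexx a) ab; rewrite mulr0 sub0r => -> //; clear -h c0; lia.
have b2 : b + b < NZ.
  rewrite ltNge; apply/negP => h; apply: (nc 1).
  by apply: (isE_central E ab (lexx b)); rewrite mulr1; clear -h cN ab; lia.
case: (up_noncentral_even H nc uq) => [//|[k [kK ak kb [v_rev hk]]]].
apply: (later_up_ex H c0 cN uq2 ev v_rev _ noT) => _ o [o_m vo].
have [oi ot oi' ot'] := ones_neq H v_rev (conj o_m vo).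
have go : g a o = 0 by move: vo; rewrite (negPf oi) (negPf ot); clear; lia.
have go' : g a (rev_ord o) = 0.
  by have := v_rev o; rewrite vo !rev_eq_sym (negPf oi') (negPf ot'); clear; lia.
have Ek := isE_const E kK ak kb.
have ev' : (2 %| P k o + P k (rev_ord o))%Z.
  have := hk o vo; move: go go'; rewrite !Ek !gE; clear; lia.
(* Evenness at k means no drop of entry o between -k and k; the points -a and a lie in between, so
   the sum is even at a as well. *)
have hPk : P (- k) o = P k o by apply: Pf_pm ev'; [clear -a0 ak; lia | clear -kb b2; lia].
have hPa : P (- a) o = P a o.
  have l1 : - k <= - a by rewrite lerN2.
  have l2 : - a <= a by clear -a0; lia.
  have := Pf_anti w o l1; have := Pf_anti w o l2; have := Pf_anti w o ak; rewrite hPk.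
  by clear; lia.
have -> : P a (rev_ord o) = - P (- a) o by rewrite -{1}[a]opprK Pf_rev.
by rewrite hPa subrr dvdz0.
Qed.

(** Without a [Tdrop], [Tset] only grows along K, and periodicity turns growth into equality. *)
Lemma noT_const : (forall k i, ~ Tdrop k i) -> forall k l, K k -> K l -> g k =1 g l.
Proof.
move=> nT k l kK lK; have TT k' l' : K k' -> K l' -> Tset k' \subset Tset l'.
  move=> kK' lK'; have [n /andP[h _]] := winding l' k'.
  have -> : Tset l' = Tset (l' + NZ * n) by apply/setP => o; rewrite !inE gf_addNn.
  by apply: (T_grow kK' (inK_addNn n lK') h) => k'' i' _ _; exact: nT.
apply: g_eq_of => //; first exact: TT.
by rewrite -[l]opprK -[k]opprK !ZsetN; apply: imsetS; apply: TT; exact: inKN.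
Qed.

(** An interval of odd parity is settled by [up_odd]. If there is none, an interval with least [Uf]
    and largest a + b <= N is taken. A further [Tdrop] forbidden by [noT] would start an interval
    further right with [Uf] at most u + 1, hence equal to u by parity and minimality. *)
Lemma up_drop a0 i0 k0 : Tdrop a0 i0 -> K k0 -> Uf w k0 < q%:Z -> up.
Proof.
move=> T0 k0K u0.
have exu : exists n : nat, `[< exists2 k, K k & Uf w k = n%:Z >].
  by exists #|Tset k0|; apply/asboolP; exists k0; rewrite ?cardT.
case: (ex_minnP exu) => u /asboolP[k1 k1K Uk1] mu.
have mn k : K k -> u%:Z <= Uf w k.
  move=> kK; rewrite -cardT lez_nat; apply: mu; apply/asboolP; exists k; rewrite ?cardT //.
have uq : u%:Z < q%:Z by apply: le_lt_trans u0; exact: mn.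
have [a [i [Ta Ua]]] : exists a i, Tdrop a i /\ Uf w a <= u%:Z.
  (* The last [Tdrop] up to k1 is sought; from there on [Tset] only grows, so [Uf] is no larger at
     the drop than at k1. *)
  have ex : exists d : nat, `[< exists i, Tdrop (k1 - d%:Z) i >].
    have [n /andP[n1 n2]] := winding a0 (k1 - NZ); have := Tdrop_addNn n T0.
    move: (a0 + NZ * n) n1 n2 => l l1 l2 Tl; exists (absz (k1 - l)); apply/asboolP; exists i0.
    by rewrite (_ : k1 - _ = l) //; clear -l1 l2; lia.
  case: (ex_minnP ex) => d /asboolP[i Ti] dm; exists (k1 - d%:Z), i; split=> //.
  have [aK _ _] := Ti; rewrite -Uk1 -!cardT lez_nat; apply: subset_leq_card.
  apply: T_grow => // [|k i' k2 k3 Tk]; first by clear; lia.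
  have : `[< exists i, Tdrop (k1 - (absz (k1 - k))%:Z) i >].
    by apply/asboolP; exists i'; rewrite (_ : k1 - _ = k) //; clear -k3; lia.
  by move/dm; clear -k2 k3; lia.
have [a' [b [E _ Ua' _]]] := isE_ex Ta.
have EU : Uf w a' = u%:Z.
  have [[aK _ _ _ _] _] := E; apply/eqP; rewrite eq_le mn // andbT; exact: le_trans Ua' Ua.
have [[a1 [b1 [E1 U1 o1 o2 o3]]]|noX] := pselect (exists a b, [/\ isE a b, Uf w a < q%:Z,
    0 <= a + b, a + b <= NZ & ~~ (2 %| Uf w a - q%:Z)%Z]).
  exact: up_odd E1 o1 o2 U1 o3.
pose Q (n : nat) := `[< exists a b, [/\ isE a b, Uf w a = u%:Z & a + b = n%:Z] >] && (n <= N)%N.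
have exQ : exists n : nat, Q n.
  have [a1 [b1 [E1 U1 o1 o2]]] := isE_normal E.
  exists (absz (a1 + b1)); apply/andP; split; last by clear -o1 o2; lia.
  by apply/asboolP; exists a1, b1; split; rewrite ?U1 //; clear -o1; lia.
have bQ (n : nat) : Q n -> (n <= N)%N by case/andP.
case: (ex_maxnP exQ bQ) => c /andP[/asboolP[a2 [b2 [E2 U2 c2]]] cN] mc.
have ev : (2 %| Uf w a2 - q%:Z)%Z.
  apply/negPn/negP => h; apply: noX; exists a2, b2; split=> //; rewrite ?U2 ?c2 //.
apply: (up_even E2) => //; rewrite ?c2 ?U2 // => k o bk kN Uk Tk.
have [a3 [b3 [E3 ka3 U3 nZ]]] := isE_ex Tk.
have [[aK2 bK2 ab2 _ _] _] := E2; have [[aK3 bK3 ab3 _ _] _] := E3.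
(* The mirror image of the [Tdrop] at k is a [Zdrop] at N - k, so the new interval ends there at the
   latest; it or its mirror image then has its centre in the required range. *)
have b3k : b3 <= NZ - k.
  rewrite leNgt; apply/negP => h.
  have := Zdrop_addNn 1 (TdropN Tk); rewrite mulr1 addrC; apply: nZ => //; clear -kN; lia.
have [a4 [b4 [E4 U4 c4 N4]]] : exists a b, [/\ isE a b, Uf w a = Uf w a3,
    a2 + b2 < a + b & a + b <= NZ].
  have [le|gt] := leP (a3 + b3) NZ.
    by exists a3, b3; split=> //; clear -ab2 bk ka3 ab3; lia.
  exists (NZ * 1 - b3), (NZ * 1 - a3); split; first exact: isE_mirror.
  - rewrite addrC Uf_addNn UfN //; last by move=> o'; rewrite ler_norml g_le1.
    by apply: eq_bigr => o' _; rewrite (isE_const E3 bK3 ab3 (lexx b3)).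
  - by rewrite mulr1; clear -b3k ab3 bk ab2; lia.
  by rewrite mulr1; clear -gt; lia.
have U4' : Uf w a4 <= u%:Z + 1 by rewrite U4; exact: le_trans U3 Uk.
have c40 : 0 <= a4 + b4 by clear -c4 c2; lia.
have uq2 : u%:Z + 2 <= q%:Z by rewrite -U2; rewrite -U2 in uq; clear -ev uq; lia.
have ev4 : (2 %| Uf w a4 - q%:Z)%Z.
  apply/negPn/negP => h; apply: noX; exists a4, b4; split=> //; clear -U4' uq2; lia.
have U4u : Uf w a4 = u%:Z.
  have [[aK4 _ _ _ _] _] := E4; have := mn _ aK4; rewrite U2 in ev.
  by clear -U4' ev ev4; lia.
have : (absz (a4 + b4)%R <= c)%N; last by clear -c4 c2 c40; lia.
apply: mc; apply/andP; split; last by clear -N4 c40; lia.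
by apply/asboolP; exists a4, b4; split=> //; clear -c40; lia.
Qed.

(** * Families with [Uf] equal to [q] throughout *)

Lemma sep_intro k k' i t D : P k i - P k t < D -> om k' i - om k' t < D -> ~~ sep w (i, t, D).
Proof. by move=> h1 h2; rewrite /sep negbK (side_Pf h1) (side_om h2). Qed.

(** A nonzero shift exchanges the values of g at i and t, so [Uf] remains q and (sp3) is void. *)
Lemma up_swap r : valid r -> ~~ sep w r -> (forall k, K k -> Uf w k = q%:Z) ->
  (forall k, K k -> shift w r k = 0 \/ g k r.1.1 + shift w r k = g k r.1.2) -> up.
Proof.
move=> vr nr Uq sw; exists r; split=> // k kK.
have w2' := wt2_Waff (refl_Waff vr) w2.
have br l : K l -> `|g l r.1.1 + shift w r l| <= 1 /\ `|g l r.1.2 - shift w r l| <= 1.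
  move=> lK; have [h _ _] := gw lK; case: (sw l lK) => [->|e]; first by rewrite addr0 subr0.
  by split; [rewrite e | rewrite -e addrK].
have U' : Uf (refl r * w)%g k = Uf w k.
  apply/eqP; rewrite -subr_eq0 Uf_refl //=; apply/eqP.
  have z (x y d : int) : d = 0 \/ x + d = y ->
      is1 (x + d) - is1 x + (is1 (y - d) - is1 y) = 0 /\
      is1 (- (x + d)) - is1 (- x) + (is1 (- (y - d)) - is1 (- y)) = 0.
    case=> [->|<-]; first by rewrite addr0 subr0 !subrr.
    by rewrite addrK; split; rewrite addrC subrKA subrr.
  have [z1 _] := z _ _ _ (sw k kK); have [_ z2] := z _ _ _ (sw _ (inKN kK)).
  by case: ifP => _; rewrite z1 // z2.
split=> [o||[_ + _]]; last 2 first.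
- by rewrite U' Uq.
- by rewrite U' Uq // subrr dvdz0.
have [h _ _] := gw kK; rewrite gf_refl //.
have [b1 b2] := br _ kK; have [b3 b4] := br _ (inKN kK).
case: (eqVneq o _) => [->//|_]; case: (eqVneq o _) => [->//|_].
case: (eqVneq o _) => [->|_].
  by rewrite -[g k _]opprK -gf_revN // -opprD normrN.
case: (eqVneq o _) => [->|_]; last by rewrite addr0.
by rewrite -[g k _]opprK -gf_revN // addrC distrC.
Qed.

(** Two parallel hyperplanes compete, x_i - x_t = D and D - 1. The first fails only where om_i has
    dropped before P_t, the second only where P_t has dropped before om_i, and these exclude each
    other. For t = [rev_ord i] the two drops coincide, neither fails, and the even one of D and 1 -
    D gives a root. *)
Lemma up_all_q k i t : (forall l, K l -> Uf w l = q%:Z) -> K k -> g (prv k) i = 1 -> g k i <> 1 ->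
  g (prv k) t <> 1 -> g k t = 1 -> up.
Proof.
move=> Uq kK gi1 gi2 gt1 gt2; have kl := prv_lt k; have kg := prv_ge k.
have kN : k <= prv k + NZ by clear -kg; lia.
have bi := g_le1 i kK; have bt := g_le1 t (prvK k).
have pi := P_step i (ltW kl) kN; have oi := om_step i (ltW kl) kN.
have pt := P_step t (ltW kl) kN; have ot := om_step t (ltW kl) kN.
move: gi1 gi2 gt1 gt2 bi bt; rewrite !gE => gi1 gi2 gt1 gt2 bi bt.
have [Pi Oi] : P (prv k) i = P k i + 1 /\ om (prv k) i = om k i.
  by clear -gi1 gi2 bi pi oi; lia.
have [Pt Ot] : P (prv k) t = P k t /\ om (prv k) t = om k t + 1.
  by clear -gt1 gt2 bt pt ot; lia.
have gki : P k i = om k i by clear -gi1 Pi Oi; lia.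
have gkt : P k t = om k t + 1 by clear -gt2; lia.
pose D := P k i - P k t + 1.
have it : i != t by apply: contra_eq_neq Pi => ->; rewrite Pt; clear; lia.
have im : i != mid m.
  by apply/eqP => e; have := g_mid (prv k); rewrite gE -e; clear -gi1; lia.
have tm : t != mid m.
  by apply/eqP => e; have := g_mid k; rewrite gE -e; clear -gt2; lia.
have Wi l : k <= l -> l <= prv k + NZ -> P l i = P k i.
  exact: Pi_const.
have Wt l : k <= l -> l <= prv k + NZ -> om l t = om k t.
  move=> h1 h2; have := om_anti t h1; have := om_anti t h2.
  by rewrite om_addN Ot; clear; lia.
have Vt l : k <= l -> l <= prv k + NZ -> P k t - 1 <= P l t <= P k t.
  move=> h1 h2; have := Pf_anti w t h1; have := Pf_anti w t h2.
  by rewrite Pf_addN Pt; clear; lia.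
have Vi l : k <= l -> l <= prv k + NZ -> om k i - 1 <= om l i <= om k i.
  move=> h1 h2; have := om_anti i h1; have := om_anti i h2.
  by rewrite om_addN Oi; clear; lia.
have win l : K l -> exists n, [/\ K (l + NZ * n), k <= l + NZ * n & l + NZ * n <= prv k + NZ].
  move=> lK; have [n /andP[n1 n2]] := winding l k; exists n.
  have lnK : K (l + NZ * n) by exact: inK_addNn.
  by split=> //; rewrite -prv_addN; exact: prv_max.
have up1 : (t == rev_ord i) ==> (2 %| D)%Z ->
    (forall l, K l -> k <= l -> l <= prv k + NZ -> ~ (P l t = P k t /\ om l i = om k i - 1)) -> up.
  move=> D2 h; apply: (@up_swap (i, t, D)) => //; first by apply/and4P.
    by apply: (@sep_intro k (prv k)); rewrite ?Oi ?Ot /D; clear -gki gkt; lia.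
  move=> l lK; have [n [nK n1 n2]] := win l lK.
  rewrite -(shift_addNn _ l n) -![g l _](gf_addNn _ l n) /=.
  move: (h _ nK n1 n2) (Wi _ n1 n2) (Wt _ n1 n2) (Vt _ n1 n2) (Vi _ n1 n2).
  rewrite /shift !gE /= /D; move: (l + NZ * n) => l'; move: gki gkt; clear.
  move: (P k i) (P k t) (om k i) (om k t) (P l' i) (P l' t) (om l' i) (om l' t).
  move=> x y z y' x1 y1 z1 y1' -> -> nh -> -> h1 h2.
  by have [e|e] := eqVneq y1 (y' + 1); [right | left]; move: nh; lia.
have up2 : (i == rev_ord t) ==> (2 %| 1 - D)%Z ->
    (forall l, K l -> k <= l -> l <= prv k + NZ -> ~ (P l t = P k t - 1 /\ om l i = om k i)) -> up.
  move=> D2 h; apply: (@up_swap (t, i, 1 - D)) => //.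
  - by apply/and4P; split; rewrite // eq_sym.
  - by apply: (@sep_intro (prv k) k); rewrite ?Pi ?Pt /D; clear -gki gkt; lia.
  move=> l lK; have [n [nK n1 n2]] := win l lK.
  rewrite -(shift_addNn _ l n) -![g l _](gf_addNn _ l n) /=.
  move: (h _ nK n1 n2) (Wi _ n1 n2) (Wt _ n1 n2) (Vt _ n1 n2) (Vi _ n1 n2).
  rewrite /shift !gE /= /D; move: (l + NZ * n) => l'; move: gki gkt; clear.
  move: (P k i) (P k t) (om k i) (om k t) (P l' i) (P l' t) (om l' i) (om l' t).
  move=> x y z y' x1 y1 z1 y1' -> -> nh -> -> h1 h2.
  by have [e|e] := eqVneq y1 y'; [right | left]; move: nh; lia.
have [ti|ti] := eqVneq t (rev_ord i); last first.
  have [h1|] := pselect (forall l, K l -> k <= l -> l <= prv k + NZ ->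
      ~ (P l t = P k t /\ om l i = om k i - 1)).
    by apply: up1 => //; rewrite (negPf ti).
  move=> /existsNP[l1 /not_implyP[l1K /not_implyP[k1 /not_implyP[k1' /contrapT[P1 o1]]]]].
  apply: up2; first by rewrite -rev_eq_sym eq_sym (negPf ti).
  move=> l2 l2K k2 k2' [P2 o2]; have [le|le] := leP l1 l2.
    by have := om_anti i le; rewrite o1 o2; clear; lia.
  by have := Pf_anti w t (ltW le); rewrite P1 P2; clear; lia.
(* A translate of -k: mirroring the step into k shows that P_t and om_i drop together on leaving
   [x]. *)
have [n /andP[n1 n2]] := winding (- k) k; set x := - k + NZ * n in n1 n2.
have xK : K x by exact/inK_addNn/inKN.
have nx : nxt x = - prv k + NZ * n by rewrite nxt_addNn nxtN.
have px : P (nxt x) t = P x t - 1.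
  by rewrite nx /x !Pf_addNn ti !Pf_rev // Pi; clear; lia.
have ox : om (nxt x) i = om x i - 1.
  by rewrite nx /x !om_addNn -[i]rev_ordK -ti !om_rev Ot; clear; lia.
have x1 : x <= prv k + NZ.
  by rewrite -prv_addN; exact: prv_max.
have x2 : nxt x <= prv k + NZ.
  apply: nxt_min; first by apply: inK_addN; exact: prvK.
  rewrite lt_neqAle x1 andbT; apply: contra_eq_neq px => ->.
  by have := @nxt_addNn (prv k) 1; rewrite mulr1 nxt_prv // => ->; rewrite !Pf_addN Pt; clear; lia.
have xx := nxt_gt x; have kx : k <= nxt x by clear -n1 xx; lia.
have dich l : K l -> k <= l -> l <= prv k + NZ -> P l t = P k t /\ om l i = om k i \/
    P l t = P k t - 1 /\ om l i = om k i - 1.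
  move=> lK l1 l2; have [lx|xl] := leP l x; [left | right].
    have := Pf_anti w t lx; have := om_anti i lx; have := Vt _ l1 l2; have := Vi _ l1 l2.
    have := Vt _ kx x2; have := Vi _ kx x2; rewrite px ox; clear; lia.
  have xl' := nxt_min lK xl.
  have := Pf_anti w t xl'; have := om_anti i xl'; have := Vt _ l1 l2; have := Vi _ l1 l2.
  have := Vt _ n1 x1; have := Vi _ n1 x1; rewrite px ox; clear; lia.
have [D2|D2] := boolP (2 %| D)%Z.
  by apply: up1 => [|l lK l1 l2]; [rewrite D2 implybT | case: (dich l lK l1 l2); clear; lia].
apply: up2 => [|l lK l1 l2]; last by case: (dich l lK l1 l2); clear; lia.
by apply/implyP => _; move: D2; clear; lia.
Qed.

(** * Families g_k constant along [K] *)

Lemma nxt_centre : exists2 k0, K k0 & [/\ 0 <= k0, k0 + k0 < NZ & 0 < k0 -> prv k0 = - k0].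
Proof.
have [k1 k1I] := set0Pn _ I0; have k1K := inK_I k1I.
have gt := nxt_gt (-1); have le : nxt (-1) <= k1%:Z by apply: nxt_min => //; clear; lia.
exists (nxt (-1)); first exact: nxtK.
have k1m := ltn_ord k1; split; [by clear -gt; lia | by clear -le k1m; lia | move=> k0].
set k := nxt (-1) in gt le k0 *; have kK : K k by exact: nxtK.
have kk : - k < k by clear -k0; lia.
apply/eqP; rewrite eq_le (prv_max (inKN kK) kk) andbT.
rewrite leNgt; apply/negP => h; have pK := prvK k; have pk := prv_lt k.
have [p0|p0] := leP 0 (prv k).
  by have : k <= prv k; [apply: nxt_min => //; clear -p0; lia | clear -pk; lia].
have : k <= - prv k; last by clear -h; lia.
by apply: nxt_min; [exact: inKN | clear -p0; lia].
Qed.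

(** (sp3) at the element of K nearest to 0 gives a zero i whose P drops between -k and k. This is
    its only drop per period, so the root (i, [rev_ord i]) has shift 1 on all of K and corrects the
    parity of [Uf]. *)
Lemma up_const_odd : (forall k l, K k -> K l -> g k =1 g l) -> (forall k, K k -> Uf w k < q%:Z) ->
  (forall k, K k -> ~~ (2 %| Uf w k - q%:Z)%Z) -> up.
Proof.
move=> gc uq odd; have [k kK [k0 kN pk]] := nxt_centre.
have sd l : K l -> selfdual w l.
  by move=> lK o; rewrite (gc l (- l)) ?gf_rev //; exact: inKN.
have [i [gi oi]] := not_bad kK (sd k kK) (odd k kK).
have gi' : g k (rev_ord i) = 0 by rewrite sd // gi oppr0.
have im : i != mid m by apply: contraNneq oi => ->; exact: mid_even.
have E : om k i + om k (rev_ord i) = P k i - P (- k) i.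
  rewrite -[i in P (- _) i]rev_ordK Pf_rev // opprK.
  by move: gi gi'; rewrite !gE; clear; lia.
have kk : - k <= k by clear -k0; lia.
have kNk : k <= - k + NZ by clear -kN; lia.
have dP : P (- k) i = P k i + 1.
  by have := P_step i kk kNk; move: oi; rewrite E; move: (P _ _) (P _ _) => x y; clear; lia.
have kp : 0 < k.
  rewrite lt_def k0 andbT; apply/eqP => e; move: dP; rewrite e oppr0.
  by move: (P 0 i) => x; clear; lia.
have {}pk := pk kp; rewrite -pk in dP.
have cst l : k <= l -> l <= NZ - k -> P l i = P k i.
  by move=> h1 h2; apply: Pi_const => //; rewrite pk; clear -h2; lia.
pose D := P k i - P k (rev_ord i) + 1; pose r : root m := (i, rev_ord i, D).
have PR l : P l (rev_ord i) = - P (- l) i by rewrite -{1}[l]opprK Pf_rev.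
have sh l : K l -> shift w r l = 1.
  move=> lK; have [n /andP[n1 n2]] := winding l k.
  have lnK : K (l + NZ * n) by exact: inK_addNn.
  have h : l + NZ * n <= NZ - k.
    rewrite [NZ - k]addrC -pk; rewrite -prv_addN; exact: prv_max.
  rewrite -(shift_addNn r l n); move: (l + NZ * n) n1 h => l' h1 h2.
  have c2 : P (NZ - l') i = P k i by apply: cst; clear -h1 h2; lia.
  have c3 : P (- l') i = P (NZ - l') i + 1.
    by have := @Pf_addNn w (- l') 1 i; rewrite mulr1 [- l' + _]addrC => ->; ring.
  rewrite /shift /r /D /= !PR c3 c2 -{1}pk dP (cst _ h1 h2); ring.
have vr : valid r.
  apply/and4P; split=> //=; first by rewrite eq_sym rev_eq_mid.
    by rewrite rev_eq_sym rev_mid.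
  by rewrite eqxx /= /D PR -pk dP; clear; lia.
exists r; split=> //.
  apply: (@sep_intro k k); rewrite /D; first by clear; lia.
  by move: gi gi'; rewrite !gE; clear; lia.
move=> l lK; have w2' := wt2_Waff (refl_Waff vr) w2.
have gli : g l i = 0 by rewrite (gc l k).
have gli' : g l (rev_ord i) = 0 by rewrite (gc l k).
have U' : Uf (refl r * w)%g l = Uf w l + 1.
  have := Uf_refl l w2 vr; rewrite /= eqxx sh // gli gli' /is1 /= => h.
  by rewrite -[LHS](subrK (Uf w l)) h; clear; lia.
split=> [o||[_ + _]]; rewrite ?U'.
- rewrite gf_refl // !sh //=; last exact: inKN.
  case: (eqVneq o i) => [->|_]; first by rewrite gli.
  case: (eqVneq o (rev_ord i)) => [->|oi']; first by rewrite gli'.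
  rewrite rev_ordK; case: (eqVneq o i) => [->|_]; first by rewrite gli.
  by rewrite addr0 ler_norml g_le1.
- by have := uq l lK; clear; lia.
by have := odd l lK; clear; lia.
Qed.

Lemma Pf_gap k l i j : `|(P k i - P k j) - (P l i - P l j)| <= 1.
Proof.
have := Pf_ht w k i; have := Pf_ht w k j; have := Pf_ht w l i; have := Pf_ht w l j.
move: (P k i) (P k j) (P l i) (P l j) => x y z t h1 h2 h3 h4.
rewrite ler_norml; apply/andP; split; rewrite -subr_ge0; apply: (@NZ_le m);
  rewrite !(mulrDr, mulrN, mulr1, mulr0, opprD, opprK);
  by move: h1 h2 h3 h4; move: (NZ * x) (NZ * y) (NZ * z) (NZ * t); clear => *; lia.
Qed.

(** By [Pf_gap] the difference P_i - P_j has a minimum and exceeds it by at most 1; with D one above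
    the minimum all shifts are 0 or 1. If [Uf] acquires the wrong parity, the shifts at k and -k
    differ, and entries i and [rev_ord i] destroy self-duality. *)
Lemma up_const_even k1 : (forall k l, K k -> K l -> g k =1 g l) -> K k1 -> Uf w k1 < q%:Z ->
  (2 %| Uf w k1 - q%:Z)%Z -> up.
Proof.
move=> gc k1K u1 ev; have uq2 : Uf w k1 + 2 <= q%:Z by clear -u1 ev; lia.
have sd l : K l -> selfdual w l.
  by move=> lK o; rewrite (gc l (- l)) ?gf_rev //; exact: inKN.
have [i [im _ _ gi]] := zero_ex (mid m) (mid m) k1K qm uq2.
have [j [jm ji ji' gj]] := zero_ex i (rev_ord i) k1K qm uq2.
have [k kK mk] : exists2 k, K k & forall l, K l -> P k i - P k j <= P l i - P l j.
  have [[l lK hl]|h] := pselect (exists2 l, K l & P l i - P l j < P k1 i - P k1 j).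
    exists l => // l' l'K; have := Pf_gap k1 l' i j; move: hl; clear; lia.
  exists k1 => // l lK; rewrite leNgt; apply/negP => hl; apply: h; exists l => //.
pose D := P k i - P k j + 1; pose r : root m := (i, j, D).
have vr : valid r by apply/and4P; split; rewrite //= ?(negPf ji') // eq_sym.
have g0 l : K l -> [/\ g l i = 0, g l j = 0, g l (rev_ord i) = 0 & g l (rev_ord j) = 0].
  by move=> lK; rewrite !sd // !(gc l k1) // gi gj oppr0.
have sh l : K l -> 0 <= shift w r l <= 1.
  move=> lK; rewrite /shift /= /D; have := mk l lK; have := Pf_gap k l i j; clear; lia.
exists r; split=> //.
  have [g1 g2 _ _] := g0 k kK; apply: (@sep_intro k k); rewrite /D; first by clear; lia.
  by move: g1 g2; rewrite !gE; clear; lia.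
move=> l lK; have w2' := wt2_Waff (refl_Waff vr) w2.
have [g1 g2 g3 g4] := g0 l lK; have [g1' g2' _ _] := g0 _ (inKN lK).
have UE : Uf w l = Uf w k1 by apply: eq_bigr => o _; rewrite (gc l k1).
have s1 := sh l lK; have s2 := sh _ (inKN lK).
have U' : Uf (refl r * w)%g l = Uf w k1 + shift w r l + shift w r (- l).
  have := Uf_refl l w2 vr; rewrite /= (negPf ji') g1 g2 g1' g2' UE.
  move: (Uf _ _) (shift w r l) (shift w r (- l)) s1 s2 => U d d' h1 h2 h3.
  have hd : d = 0 \/ d = 1 by clear -h1; lia.
  have hd' : d' = 0 \/ d' = 1 by clear -h2; lia.
  by move: h3; case: hd hd' => -> [->|->]; rewrite /is1 /=; clear; lia.
split=> [o||[sd' od _]]; rewrite ?U'.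
- rewrite gf_refl //=; case: (eqVneq o i) => [->|_]; first by rewrite g1 ler_norml; clear -s1; lia.
  case: (eqVneq o j) => [->|_]; first by rewrite g2 ler_norml; clear -s1; lia.
  case: (eqVneq o _) => [->|_]; first by rewrite g3 ler_norml; clear -s2; lia.
  case: (eqVneq o _) => [->|_]; first by rewrite g4 ler_norml; clear -s2; lia.
  by rewrite addr0 ler_norml g_le1.
- by clear -s1 s2 uq2; lia.
have := sd' i; rewrite !gf_refl //= eqxx rev_eq_mid (negPf im) g1 g3 !add0r.
rewrite rev_eq_sym [i == _]eq_sym -rev_eq_sym [rev_ord j == _]eq_sym.
have -> : (i == rev_ord j) = false by rewrite -rev_eq_sym eq_sym (negPf ji').
rewrite eqxx; move: od; rewrite U'; clear -ev s1 s2; lia.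
Qed.

Lemma ascent : up \/ (forall k l, K k -> K l -> g k =1 g l) /\ (forall k, K k -> Uf w k = q%:Z).
Proof.
have le k : K k -> Uf w k <= q%:Z by move=> /gw[].
have [Uq|nUq] := pselect (forall k, K k -> Uf w k = q%:Z).
  have [E|] := pselect (forall k, K k -> Tset (prv k) = Tset k).
    right; split=> //; apply: noT_const => k i [kK h1 h2].
    by have := congr1 (fun A : {set 'I_N} => i \in A) (E k kK); rewrite !inT h1 h2.
  move=> /existsNP[k /not_implyP[kK /eqP ne]]; left.
  have cE : #|Tset (prv k)| = #|Tset k|.
    by apply/eqP; rewrite -eqz_nat !cardT !Uq //; exact: prvK.
  have /subsetPn[i] : ~~ (Tset (prv k) \subset Tset k).
    by apply: contra ne => h; rewrite eqEcard h cE leqnn.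
  have /subsetPn[t] : ~~ (Tset k \subset Tset (prv k)).
    by apply: contra ne => h; rewrite eq_sym eqEcard h cE leqnn.
  rewrite !inT => /eqP h1 /eqP h2 /eqP h3 /eqP h4.
  exact: up_all_q Uq kK h3 h4 h2 h1.
left; move/existsNP: nUq => [k /not_implyP[kK /eqP ne]].
have uk : Uf w k < q%:Z by rewrite lt_neqAle ne le.
have [nT|] := pselect (forall a i, ~ Tdrop a i); last first.
  by move=> /existsNP[a /existsNP[i /contrapT Ti]]; exact: up_drop Ti kK uk.
have gc := noT_const nT.
have UE l : K l -> Uf w l = Uf w k.
  by move=> lK; apply: eq_bigr => o _; rewrite (gc l k).
have [ev|od] := boolP (2 %| Uf w k - q%:Z)%Z; first exact: up_const_even gc kK uk ev.
by apply: up_const_odd => // l lK; rewrite UE.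
Qed.

End Ascent.

(** * Conclusion *)

Section Assembly.
Local Open Scope ring_scope.
Variable m : nat.
Implicit Types (i j t a b o : 'I_(dimB m)) (u v w x y : affperm (dimB m)) (k l : int).
Implicit Types (r : root m) (I J : {set 'I_m.+1}) (q : nat).
Local Notation N := (dimB m).
Local Notation NZ := ((dimB m)%:Z).

Lemma om_small (k : nat) a : (k <= m)%N -> om k%:Z a = - (a < k)%N%:Z.
Proof. by move=> km; apply: om_uniq; have := ltn_ord a; case: ltnP => /=; lia. Qed.

Lemma om_smallN (k : nat) a : (k <= m)%N -> om (- k%:Z) a = (N - k <= a)%N%:Z.
Proof. by move=> km; apply: om_uniq; have := ltn_ord a; case: leqP => /=; lia. Qed.

Lemma ht_bound q I w a : wt2 w -> good q I w -> I != finset.set0 ->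
  `|ht w a - a%:Z| <= 4 * NZ.
Proof.
move=> w2 gw /set0Pn[k kI]; have [gb _ _] := gw _ (inK_I kI).
have km : (k <= m)%N by have := ltn_ord k.
have := gb a; rewrite /gf /Pf !om_small // /ht => h.
have {}h : -1 <= trans w 0 a <= 3.
  by move: h; rewrite ler_norml; case: (_ < k)%N; case: (_ < k)%N => /=; lia.
have := ltn_ord a; have := ltn_ord ((lin w)^-1%g a).
move: (nat_of_ord ((lin w)^-1%g a)) (nat_of_ord a) => c d cN dN.
have h1 : NZ * (-1) <= NZ * trans w 0 a by rewrite ler_pM2l //; lia.
have h2 : NZ * trans w 0 a <= NZ * 3 by rewrite ler_pM2l //; lia.
by move: h1 h2; move: (NZ * trans w 0 a) => z; rewrite ler_norml; clear -cN dN; lia.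
Qed.

Lemma disp_bound q I w : wt2 w -> good q I w -> I != finset.set0 ->
  disp w <= \sum_(a < N) (4 * NZ) ^+ 2.
Proof.
move=> w2 gw I0; apply: ler_sum => a _; have := ht_bound a w2 gw I0.
by rewrite -[(ht w a - _) ^+ 2]real_normK ?num_real // => h; rewrite ler_sqr ?nnegrE //; lia.
Qed.

Lemma ascent_max q I w : (q <= m)%N -> I != finset.set0 -> wt2 w -> good q I w ->
  exists x, [/\ gle w x, wt2 x, good q I x,
    forall k l, inK I k -> inK I l -> gf x k =1 gf x l &
    forall k, inK I k -> Uf x k = q%:Z].
Proof.
move=> qm I0; pose C : int := \sum_(a < N) (4 * NZ) ^+ 2.
have [n] := ubnP (absz (C - disp w)%R); elim: n => // n IH in w * => wn w2 gw.
case: (ascent w2 gw I0 qm) => [[r [vr nr gr]]|[gc Uq]]; last first.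
  by exists w; split=> //; exact: gle_refl.
have w2' : wt2 (refl r * w)%g by apply: wt2_Waff (refl_Waff vr) w2.
have [|//|//|x [wx x2 gx gc Uq]] := IH (refl r * w)%g.
  have := disp_bound w2 gw I0; have := disp_bound w2' gr I0; rewrite -/C.
  have : disp w < disp (refl r * w)%g.
    have := sep_disp (wt2_Wext w2') vr; rewrite sep_refl_mul // nr.
    by rewrite mulgA refl_invol // mul1g => <-.
  by move: wn; clear; lia.
exists x; split=> //; apply: gle_trans wx; apply: gle_step => //; exact: gle_refl.
Qed.

Lemma wt2_refl_mul r w : valid r -> wt2 (refl r * w)%g -> wt2 w.
Proof.
move=> vr /(wt2_Waff (refl_Waff vr)); by rewrite mulgA refl_invol // mul1g.
Qed.

Lemma good_gle q I x y : gle x y -> wt2 y -> good q I y -> wt2 x /\ good q I x.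
Proof.
elim=> // z r _ IH vr ns z2 gz; have w2 := wt2_refl_mul vr z2.
by apply: IH => //; exact: good_down gz.
Qed.

Lemma gle_cls x y u : gle x y -> Waff (y * u)%g <-> Waff (x * u)%g.
Proof.
elim=> // z r _ [IH1 IH2] vr _; have Wr := refl_Waff vr; split=> h.
  by apply: IH1; have := WaffM Wr h; rewrite !mulgA refl_invol // mul1g.
by rewrite -mulgA; apply: WaffM => //; exact: IH2.
Qed.

(** * Conjugates of [mu] and their translations *)

Definition balanced (f : 'I_N -> int) := forall a, f (rev_ord a) = 2 - f a /\ 0 <= f a <= 2.

(** A balanced vector is determined by the positions of its entries 2. Each signed transposition
    moves one of these to a place where h has a 2, and duality takes care of the zeros. *)
Lemma balanced_perm f h : balanced f -> balanced h ->
  #|[set a | f a == 2]%SET| = #|[set a | h a == 2]%SET| ->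
  exists2 s : 'S_N, Sstar s & forall a, f (s a) = h a.
Proof.
move=> bf bh; have [n] := ubnP #|[set a | (h a == 2) && (f a != 2)]%SET|.
elim: n => // n IH in f bf * => fn cE.
have val_ext (f' : 'I_N -> int) : balanced f' ->
    (forall a, (f' a == 2) = (h a == 2)) -> forall a, f' a = h a.
  move=> bf' E a; have [h1 h2] := bf' a; have [h3 h4] := bh a.
  by have := E a; have := E (rev_ord a); rewrite h1 h3; clear -h2 h4; lia.
have [sub|] := boolP ([set a | h a == 2]%SET \subset [set a | f a == 2]%SET).
  exists 1%g; first by move=> a; rewrite !perm1.
  move=> a; rewrite perm1; apply: val_ext => // b.
  have /eqP/setP/(_ b) : [set a | h a == 2]%SET == [set a | f a == 2]%SET.
    by rewrite eqEcard sub cE leqnn.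
  by rewrite !inE.
case/subsetPn=> i; rewrite !inE => hi fi.
have /subsetPn[j] : ~~ ([set a | f a == 2]%SET \subset [set a | h a == 2]%SET).
  apply: contra fi => sub; have /eqP/setP/(_ i) : [set a | f a == 2]%SET == [set a | h a == 2]%SET.
    by rewrite eqEcard sub cE leqnn.
  by rewrite !inE hi.
rewrite !inE => fj hj.
have midE f' : balanced f' -> f' (mid m) = 1 by move=> bf'; have [] := bf' (mid m); rewrite rev_mid; lia.
have ij : i != j by apply: contraNneq hj => <-.
have im : i != mid m by apply/eqP => e; move: hi; rewrite e midE.
have jm : j != mid m by apply/eqP => e; move: fj; rewrite e midE.
pose p := rperm i j.
have pE a : p a = rp i j a by exact: rpermE.
have Sp : Sstar p by move=> a; rewrite !pE rp_rev.
have bp : balanced (fun a => f (p a)) by move=> a; rewrite Sp; exact: bf.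
have [||s Ss Es] := IH (fun a => f (p a)) bp.
- rewrite -ltnS; apply: leq_ltn_trans fn; apply: proper_card; apply/properP; split; last first.
    by exists i; rewrite !inE ?hi ?fi // pE /rp eqxx fj andbF.
  apply/fintype.subsetP => a; rewrite !inE => /andP[ha]; rewrite ha /= pE /rp.
  have [->|ai] := eqVneq a i; first by rewrite fj.
  have [aj|aj] := eqVneq a j; first by move: hj; rewrite -aj ha.
  have [ai'|ai'] := eqVneq a (rev_ord i).
    by move: ha; rewrite ai' (bh i).1 (eqP hi).
  have [->|//] := eqVneq a (rev_ord j).
  by rewrite (bf j).1 (eqP fj).
- rewrite -cE -(card_imset _ (@perm_inj _ p)); apply: eq_card => a.
  rewrite inE -[a](permKV p); rewrite (mem_imset _ _ (@perm_inj _ p)) inE.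
  by [].
exists (s * p)%g => [a|a]; first by rewrite !permM Ss Sp.
by rewrite permM Es.
Qed.

Lemma mu_balanced q : (q <= m)%N -> balanced (fun a => mu_vec m q 0 a).
Proof.
move=> qm a; rewrite !mxE rev_val; have aN := ltn_ord a.
by do 4?[case: ltnP => ?]; lia.
Qed.

Lemma card_mu q : (q <= m)%N -> #|[set a | mu_vec m q 0 a == 2]%SET| = q.
Proof.
move=> qm; have qN : (q <= N)%N by lia.
have inj : injective (widen_ord qN) by move=> x y /(congr1 val)/= h; exact: val_inj.
rewrite -[RHS](card_ord q) -(card_imset _ inj); apply: eq_card => a.
rewrite inE mxE; apply/idP/imsetP => [|[b _ ->]]; last by rewrite /= ltn_ord.
case: ltnP => [aq _|_]; last by case: ifP.
by exists (Ordinal aq) => //; apply: val_inj.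
Qed.

Section Translations.
Variables (q : nat) (lam : 'rV[int]_N).
Hypothesis blam : balanced (fun a => lam 0 a).

Lemma transl_wt2 : wt2 (transl lam).
Proof.
have lm : lam 0 (mid m) = 1 by have [] := blam (mid m); rewrite rev_mid; lia.
split=> //; split=> [a|a]; last by rewrite /= !perm1.
by rewrite /= (blam a).1 lm; lia.
Qed.

Lemma transl_gf k a : gf (transl lam) k a = lam 0 a - 1.
Proof. by rewrite /gf /Pf /= invg1 perm1; ring. Qed.

Lemma transl_Uf k : Uf (transl lam) k = #|[set a | lam 0 a == 2]%SET|%:Z.
Proof.
rewrite /Uf -(big_morph _ PoszD (erefl 0%:Z)) -sum1_card [in RHS]big_mkcond; congr Posz.
apply: eq_bigr => a _; rewrite inE transl_gf; have -> : (lam 0 a - 1 == 1) = (lam 0 a == 2) by lia.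
by case: (_ == _).
Qed.

Lemma transl_good I : #|[set a | lam 0 a == 2]%SET| = q -> good q I (transl lam).
Proof.
move=> c k _; split=> [a||[_ + _]]; rewrite ?transl_Uf ?c ?subrr ?dvdz0 //.
by rewrite transl_gf; have := (blam a).2; rewrite ler_norml; lia.
Qed.

End Translations.

(** By self-duality the first half contains exactly [Uf] nonzero entries, each congruent to 1 modulo
    2. *)
Lemma selfdual_parity w k : wt2 w -> selfdual w k -> (forall a, `|gf w k a| <= 1) ->
  (2 %| Uf w k - \sum_(a < N | (a < m)%N) gf w k a)%Z.
Proof.
move=> w2 sd gb; have E : \sum_a `|gf w k a| = Uf w k *+ 2.
  have -> : \sum_a `|gf w k a| = \sum_a ((gf w k a == 1 : nat)%:Z *+ 2 - gf w k a).
    apply: eq_bigr => a _; have := gb a; move: (gf w k a) => z h.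
    by have : z = 1 \/ z = 0 \/ z = -1; [lia | case=> [|[|]] ->].
  by rewrite sumrB sum_gf // subr0 sumrMnl.
have := sum_norm_mod2 (gf w k); move: E; rewrite sum_norm_low // => /eqP.
by rewrite eqr_pMn2r // => /eqP ->.
Qed.

(** The difference is odd under [rev_ord], so only the parity of its half sum matters;
    [selfdual_parity] for w and for the translation by mu evaluates it. *)
Lemma Qvee_parity q w k : (q <= m)%N -> wt2 w -> selfdual w k -> (forall a, `|gf w k a| <= 1) ->
  in_Qvee (muvec w k - mu_vec m q) <-> (2 %| Uf w k - q%:Z)%Z.
Proof.
move=> qm w2 sd gb; have bm := mu_balanced qm.
have p1 := selfdual_parity w2 sd gb.
have t2 := transl_wt2 bm.
have sdt : selfdual (transl (mu_vec m q)) 0.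
  by move=> a; rewrite !transl_gf (bm a).1; ring.
have p2 : (2 %| q%:Z - \sum_(a < N | (a < m)%N) (mu_vec m q 0 a - 1))%Z.
  have := selfdual_parity t2 sdt; rewrite transl_Uf (card_mu qm).
  under eq_bigr do rewrite transl_gf; apply=> a.
  by rewrite transl_gf; have := (bm a).2; rewrite ler_norml; lia.
have vE a : (muvec w k - mu_vec m q) 0 a = gf w k a - (mu_vec m q 0 a - 1).
  by rewrite [LHS]mxE [X in _ + X]mxE muvecE; ring.
have rv a : (muvec w k - mu_vec m q) 0 (rev_ord a) = - (muvec w k - mu_vec m q) 0 a.
  by rewrite !vE sd (bm a).1; ring.
have mE : (muvec w k - mu_vec m q) 0 (mid m) = 0 by have := rv (mid m); rewrite rev_mid; lia.
have sE : \sum_(a < N | (a < m)%N) (muvec w k - mu_vec m q) 0 a =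
    \sum_(a < N | (a < m)%N) gf w k a - \sum_(a < N | (a < m)%N) (mu_vec m q 0 a - 1).
  by rewrite -sumrB; apply: eq_bigr => a _; rewrite vE.
split=> [[_ _]|h]; rewrite ?sE; last split.
- move: p1 p2; move: (\sum_(_ < _ | _) _) (\sum_(_ < _ | _) _) => x y; clear; lia.
- by move=> a; rewrite rv mE; ring.
- by move=> a; rewrite rv addrN.
rewrite sE; move: p1 p2 h; move: (\sum_(_ < _ | _) _) (\sum_(_ < _ | _) _) => x y; clear; lia.
Qed.

Lemma Aset_om (k : nat) a : (k <= m)%N -> (a \in Aset m k) = ~~ (2 %| om k%:Z a + om k%:Z (rev_ord a))%Z.
Proof.
move=> km; rewrite inE !om_small // rev_val; have := ltn_ord a.
by do 3?[case: ltnP => ?]; lia.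
Qed.

Lemma selfdual_muvec w k : wt2 w -> muvec w k = muvec w (- k) <-> selfdual w k.
Proof.
move=> w2; split=> [E a|sd].
  have := congr1 (fun f : 'rV[int]_N => f 0 (rev_ord a)) E; rewrite /= !muvecE gf_rev //.
  by move: (gf _ _ _) (gf _ _ _); lia.
by apply/rowP => a; rewrite !muvecE gf_revN // sd opprK.
Qed.

Lemma spin_cond q w (k : nat) : (q <= m)%N -> wt2 w -> (k <= m)%N ->
  spin_conditions q (mu_vec m q) w k <-> cond q w k%:Z.
Proof.
move=> qm w2 km; have cE : #|[pred j | (muvec w k%:Z 0 j == 2)%R]|%:Z = Uf w k%:Z.
  rewrite /Uf -(big_morph _ PoszD (erefl 0%:Z)) -sum1_card big_mkcond; congr Posz.
  apply: eq_bigr => a _; rewrite inE muvecE; have -> : (gf w k a + 1 == 2) = (gf w k a == 1) by lia.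
  by case: (_ == _).
split=> [[_ s2 s3 s4]|[c1 c2 c3]].
  have gb a : `|gf w k%:Z a| <= 1 by have := s2 a; rewrite muvecE ler_norml; lia.
  split=> [//||[sd od ob]]; first by rewrite -cE lez_nat.
  have [||a aA] := s4; [exact/selfdual_muvec | by move=> /(Qvee_parity qm w2 sd gb); exact/negP |].
  rewrite Aset_om // in aA; rewrite muvecE => h; case/negP: aA; apply: ob.
  by move: h; move: (gf _ _ _); lia.
split=> [a|a||/(selfdual_muvec _ w2) sd nQ].
- by rewrite !muvecE gf_rev //; ring.
- by rewrite muvecE; have := c1 a; rewrite ler_norml; lia.
- by rewrite -lez_nat cE.
apply: contrapT => h; apply: c3; split=> // [|a ga].
  by apply/negP => ev; apply: nQ; apply/Qvee_parity.
apply/negPn/negP => od; apply: h; exists a; first by rewrite Aset_om.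
by rewrite muvecE ga.
Qed.

Lemma spin_good q I w : (q <= m)%N -> wt2 w ->
  (forall k : 'I_m.+1, k \in I -> spin_conditions q (mu_vec m q) w k) <-> good q I w.
Proof.
move=> qm w2; split=> h k kI; last first.
  by apply/spin_cond => //; [rewrite -ltnS ltn_ord | exact/h/inK_I].
case: kI => k0 k0I; have c : cond q w k0%:Z.
  by apply/spin_cond => //; [rewrite -ltnS ltn_ord | exact: h].
case/orP => /dvdzP[n E].
  have -> : k = k0%:Z + NZ * n by move: E; rewrite mulrC; move: (_ * _) => z; lia.
  exact: cond_addNn.
have -> : k = - k0%:Z + NZ * n by move: E; rewrite mulrC; move: (_ * _) => z; lia.
exact/cond_addNn/condN.
Qed.

(** * The action of the stabilisers *)

Section Stabilisers.
Variable R : realType.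

Lemma avec_om (k : nat) a : (k <= m)%N ->
  avec R m k 0 a = (om k%:Z a + om (- k%:Z) a)%:~R / 2.
Proof.
move=> km; rewrite mxE om_small // om_smallN //; case: (ltnP a k) => h1.
  have -> : (N - k <= a)%N = false by lia.
  by rewrite /= addr0 mulrN1z mulN1r.
case: (ltnP a (N - k)) => h2; first by rewrite /= mul0r.
by rewrite /= add0r mul1r.
Qed.

(** a_k is the midpoint of omega_k and omega_(-k). An element of W_I fixes both ends: twice its
    integral translation is a difference of om sums in {-1, 0, 1}, and for k <= m each sum
    determines its two summands. *)
Lemma Wfix_om I u k a : Wfix R m I u -> inK I k ->
  trans u 0 a = om k a - om k ((lin u)^-1%g a).
Proof.
move=> [Wu fu] [k0 k0I]; have km : (k0 <= m)%N by rewrite -ltnS ltn_ord.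
have h b : trans u 0 b = om k0%:Z b - om k0%:Z ((lin u)^-1%g b) /\
    trans u 0 b = om (- k0%:Z) b - om (- k0%:Z) ((lin u)^-1%g b).
  have := congr1 (fun f : 'rV[R]_N => f 0 b) (fu _ k0I); rewrite /= affactE.
  rewrite !avec_om // => /(congr1 (fun z : R => z * 2)); rewrite mulrDl !divfK ?pnatr_eq0 //.
  rewrite -[2 in LHS]/(2%:~R) -intrM -intrD => /eqP; rewrite eqr_int => /eqP.
  rewrite !om_small // !om_smallN //; move: ((lin u)^-1%g b) => c.
  by do 4?[case: ltnP => ?]; do 2?[case: leqP => ?]; lia.
case/orP => /dvdzP[n E].
  have -> : k = k0%:Z + NZ * n by move: E; rewrite mulrC; move: (_ * _) => z; lia.
  by rewrite !om_addNn (h a).1; ring.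
have -> : k = - k0%:Z + NZ * n by move: E; rewrite mulrC; move: (_ * _) => z; lia.
by rewrite !om_addNn (h a).2; ring.
Qed.

Lemma gf_mull I u w k a : Wfix R m I u -> inK I k ->
  gf (u * w)%g k a = gf w k ((lin u)^-1%g a).
Proof.
move=> fu kK; rewrite /gf /Pf trans_mul lin_mul invMg permM (Wfix_om a fu kK); ring.
Qed.

(** Hence mu_k depends on the left coset of W_I only. *)
Lemma gf_mulr I v w k a : Wfix R m I v -> inK I k -> gf (w * v)%g k a = gf w k a.
Proof.
move=> fv kK; rewrite /gf /Pf trans_mul lin_mul invMg permM (Wfix_om _ fv kK); ring.
Qed.

Lemma good_mulr q I v w : Wfix R m I v -> good q I w -> good q I (w * v)%g.
Proof.
move=> fv gw k kK; have E a := gf_mulr w a fv kK; have [c1 c2 c3] := gw k kK.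
have EU : Uf (w * v)%g k = Uf w k by apply: eq_bigr => a _; rewrite E.
split=> [a||[b1 b2 b3]]; rewrite ?E ?EU //; apply: c3.
by split=> [a||a]; [rewrite -!E; exact: b1 | rewrite -EU | rewrite -E; exact: b3].
Qed.

Lemma good_mull q I u w : Wfix R m I u -> good q I w -> good q I (u * w)%g.
Proof.
move=> fu gw k kK; have E a := gf_mull w a fu kK; have [c1 c2 c3] := gw k kK.
have Wu := fu.1; have Wu' := Waff_ext Wu.
have E' a : gf (u * w)%g k (lin u a) = gf w k a by rewrite E permK.
have EU : Uf (u * w)%g k = Uf w k.
  rewrite /Uf (reindex_inj (@perm_inj _ (lin u))) /=.
  by apply: eq_bigr => a _; rewrite E'.
split=> [a||[b1 b2 b3]]; rewrite ?E ?EU //; apply: c3.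
split=> [a||a ga]; [by rewrite -!E' Wext_lin // b1 | by rewrite -EU |].
(* The changes of om at mirror positions are opposite translation entries, so the om sums in [bad]
   are carried along unchanged. *)
have := b3 (lin u a); rewrite E' -Wext_lin // => /(_ ga).
have := Wfix_om (lin u a) fu kK; have := Wfix_om (lin u (rev_ord a)) fu kK.
rewrite !permK Wext_lin // Waff_trans_rev //.
by move: (om _ _) (om _ _) (om _ _) (om _ _) (trans _ _ _) => x y z t c; clear; lia.
Qed.

Lemma WfixS I J u : I \subset J -> Wfix R m J u -> Wfix R m I u.
Proof. by move=> sIJ [Wu fu]; split=> // k kI; apply: fu; exact: (fintype.subsetP sIJ). Qed.

(** Constancy says that x omega_k = lam + omega_k for k and -k; translating back by lam fixes both
    vectors and hence their midpoint a_k. *)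
Lemma const_Wfix I x (lam : 'rV[int]_N) : I != finset.set0 -> wt2 x ->
  (forall k a, inK I k -> gf x k a = lam 0 a - 1) -> Waff ((transl lam)^-1 * x)%g ->
  Wfix R m I ((transl lam)^-1 * x)%g.
Proof.
move=> I0 x2 gx Wv; split=> // k kI; have km : (k <= m)%N by rewrite -ltnS ltn_ord.
apply/rowP => a; rewrite affactE.
have lE : lin ((transl lam)^-1 * x)%g = lin x by rewrite lin_mul lin_inv /= invg1 mulg1.
have tE : trans ((transl lam)^-1 * x)%g 0 a = trans x 0 a - lam 0 a.
  by rewrite trans_mul trans_inv lin_inv /= invgK !perm1 addrC.
have h l : inK I l -> trans ((transl lam)^-1 * x)%g 0 a = om l a - om l ((lin x)^-1%g a).
  by move=> lK; have := gx l a lK; rewrite tE /gf /Pf; lia.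
have h1 := h _ (inK_I kI); have h2 := h _ (inKN (inK_I kI)); rewrite lE.
rewrite !avec_om //; apply: (mulIf (_ : 2 != 0)); first by rewrite pnatr_eq0.
rewrite mulrDl !divfK ?pnatr_eq0 // -[X in _ * X]/(2%:~R) -intrM -intrD; congr (_%:~R).
by move: h1 h2; move: (trans _ _ _) (om _ _) (om _ _) (om _ _) (om _ _); clear; lia.
Qed.

End Stabilisers.

Section Main.
Variables (R : realType) (q : nat) (I J : {set 'I_m.+1}).
Hypotheses (m_gt0 : (0 < m)%N) (qm : (q <= m)%N) (I0 : I != finset.set0) (sIJ : I \subset J).
Local Notation mu := (mu_vec m q).

Lemma perm_vec_balanced (s : 'S_N) : Sstar s -> balanced (fun a => perm_vec s mu 0 a).
Proof.
by move=> Ss a; rewrite !mxE (Sstar_inv Ss); have := mu_balanced qm ((s^-1)%g a); rewrite !mxE.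
Qed.

Lemma card_perm_vec (s : 'S_N) : #|[set a | perm_vec s mu 0 a == 2]%SET| = q.
Proof.
rewrite -[RHS](card_mu qm) -(card_imset [set a | mu 0 a == 2]%SET (@perm_inj _ s)).
apply: eq_card => a; rewrite -[a](permKV s) (mem_imset _ _ (@perm_inj _ s)) !inE.
by rewrite mxE permK.
Qed.

(** The translation by s mu is the conjugate of that by mu under s; since s lies in the normal
    subgroup Waff, the class modulo Waff is unchanged. *)
Lemma Waff_perm_vec (s : 'S_N) : Sstar s -> Waff (transl (perm_vec s mu) * (transl mu)^-1)%g.
Proof.
move=> Ss; have w2 := transl_wt2 (mu_balanced qm); have Wm := wt2_Wext w2.
have Ws : Waff (AffPerm 0 s).
  split=> //; split=> [i|i|]; rewrite ?mxE ?addr0 ?mul0rn //.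
  by rewrite big1 // => i _; rewrite mxE.
have -> : transl (perm_vec s mu) = (AffPerm 0 s * transl mu * (AffPerm 0 s)^-1)%g.
  apply: affpermP => a; last by rewrite !lin_mul lin_inv /= !mul1g mulVg.
  have Z b : trans (AffPerm 0 s) 0 b = 0 by rewrite mxE.
  by rewrite !trans_mul trans_inv !Z oppr0 addr0 add0r /= [LHS]mxE.
rewrite -!mulgA; apply: WaffM => //; rewrite !mulgA.
by apply: Waff_conj => //; exact: WaffV.
Qed.

Lemma Waff_transl_comm (l1 l2 : 'rV[int]_N) x : Wext (transl l1) ->
  Waff (x * (transl l2)^-1)%g -> Waff (transl l1 * (transl l2)^-1)%g ->
  Waff ((transl l1)^-1 * x)%g.
Proof.
move=> W1 h1 h2; have Wx : Waff (x * (transl l1)^-1)%g.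
  have -> : (x * (transl l1)^-1 = (x * (transl l2)^-1) * (transl l1 * (transl l2)^-1)^-1)%g.
    by rewrite invMg invgK mulgA mulgKV.
  by apply: WaffM => //; exact: WaffV.
have := Waff_conj (WextV W1) Wx; by rewrite invgK mulgA mulgKV.
Qed.

Lemma Adm_SPerm D : Adm R m J I mu D -> SPerm R m q J I mu D.
Proof.
move=> [[w0 [Ww0 DE]] [s [Ss [x [x' [[Dx _] [Dx' _] xx']]]]]].
have bs := perm_vec_balanced Ss; have t2 := transl_wt2 bs.
rewrite DE in Dx; have Wx := dcoset_Wext Ww0 Dx.
move/(bruhatP R m_gt0 _ Wx): xx' => xx'.
case: Dx' => u [v [fu fv E]].
have x'2 : wt2 x'.
  rewrite E -mulgA; apply: wt2_Waff; first by case: fu.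
  have -> : (transl (perm_vec s mu) * v = transl (perm_vec s mu) * v * (transl (perm_vec s mu))^-1 * transl (perm_vec s mu))%g.
    by rewrite mulgKV.
  apply: wt2_Waff => //; apply: Waff_conj; [exact: wt2_Wext | by case: fv].
have gx' : good q I x'.
  (* The left factor lies in W_J; the inclusion of I in J places it in W_I. *)
  rewrite E; apply: (good_mulr fv); apply: good_mull (WfixS sIJ fu) _.
  by apply: transl_good => //; exact: card_perm_vec.
have [x2 gx] := good_gle xx' x'2 gx'.
split; first by exists w0.
exists x; split; [by rewrite DE | | exact/spin_good].
apply/(gle_cls _ xx'); rewrite E.
have -> : (u * transl (perm_vec s mu) * v * (transl mu)^-1 =
    u * (transl (perm_vec s mu) * v * (transl (perm_vec s mu))^-1) *
    (transl (perm_vec s mu) * (transl mu)^-1))%g by rewrite !mulgA mulgKV.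
apply: WaffM; last exact: Waff_perm_vec.
apply: WaffM; first by case: fu.
by apply: Waff_conj; [exact: wt2_Wext | case: fv].
Qed.

Lemma SPerm_Adm D : SPerm R m q J I mu D -> Adm R m J I mu D.
Proof.
move=> [[w0 [Ww0 DE]] [w [Dw cw sp]]]; split; first by exists w0.
have w2 : wt2 w.
  by rewrite -[w](mulgKV (transl mu)); apply: wt2_Waff => //; exact/transl_wt2/mu_balanced.
have gw : good q I w by apply/spin_good.
have [x [wx x2 gx gc Uq]] := ascent_max qm I0 w2 gw.
have [k0 k0I] := set0Pn _ I0; have k0K := inK_I k0I.
(* The common value of all mu_k of the maximal element x. Equality of the vectors for k0 and -k0
   makes it self-dual, and [Uf] = q makes it a conjugate of mu. *)
pose lam : 'rV[int]_N := \row_a (gf x k0%:Z a + 1).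
have lE a : lam 0 a = gf x k0%:Z a + 1 by rewrite mxE.
have blam : balanced (fun a => lam 0 a).
  move=> a; have [gb _ _] := gx _ k0K; rewrite !lE; split; last first.
    by have := gb a; rewrite ler_norml; lia.
  by have := gc _ _ k0K (inKN k0K) a; rewrite gf_revN // => ->; ring.
have cl : #|[set a | lam 0 a == 2]%SET| = #|[set a | mu 0 a == 2]%SET|.
  rewrite card_mu //; apply/eqP; rewrite -eqz_nat -(transl_Uf lam 0) -(Uq _ k0K); apply/eqP.
  by apply: eq_bigr => a _; rewrite transl_gf lE addrK.
have [s Ss sE] := balanced_perm blam (mu_balanced qm) cl.
have El : lam = perm_vec s mu by apply/rowP => a; rewrite [RHS]mxE -sE permKV.
exists s; split=> //; rewrite -El DE.
have t2 := transl_wt2 blam.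
apply: (bruhat_dcoset_intro m_gt0 Ww0 (wt2_Wext t2) _ _ wx); first by rewrite -DE.
exists 1%g, ((transl lam)^-1 * x)%g; split; [exact: Wfix1 | | by rewrite mul1g mulKVg].
apply: const_Wfix => // [k a kK|]; first by rewrite lE addrK (gc k k0%:Z).
apply: (@Waff_transl_comm _ mu); [exact: wt2_Wext | | by rewrite El; exact: Waff_perm_vec].
exact/(gle_cls _ wx).
Qed.

End Main.

End Assembly.

Theorem theorem9p6p1 (R : realType) (m q : nat) (I J : {set 'I_m.+1})
    (m_ge1 : (1 <= m)%N) (q_le_m : (q <= m)%N)
    (I_neq0 : I != finset.set0) (J_neq0 : J != finset.set0)
    (sIJ : I \subset J)
    (I10 : (inord 1 : 'I_m.+1) \in I -> (ord0 : 'I_m.+1) \in I)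
    (J10 : (inord 1 : 'I_m.+1) \in J -> (ord0 : 'I_m.+1) \in J) :
  Adm R m J I (mu_vec m q) = SPerm R m q J I (mu_vec m q).
Proof. by apply/seteqP; split=> D; [exact: Adm_SPerm | exact: SPerm_Adm]. Qed.
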